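(* Let $\mathbb{F}$ be a field of characteristic $\neq 2,3$ and let $V$ be the two-dimensional natural module for $\mathbf{SL}_2$ over $\mathbb{F}$. (1) Let $\mathcal{L}$ be a Lie algebra over $\mathbb{F}$ endowed with a short inner $(\mathbf{SL}_2\times\mathbf{SL}_2)$-structure $\Phi:\mathbf{SL}_2\times\mathbf{SL}_2\rightarrow\mathbf{Aut}(\mathcal{L})$. Let $\Delta:\mathbf{SL}_2\to\mathbf{SL}_2\times\mathbf{SL}_2$, $g\mapsto (g,g)$, be the diagonal embedding, and let $(\mathcal{J},\mathcal{T})$ be the $J$-ternary algebra that coordinatizes the short inner $\mathbf{SL}_2$-structure $\Psi=\Phi\circ\Delta$ on $\mathcal{L}$, with isotypic decomposition $$\mathcal{L}=\bigl(\mathfrak{sl}(V)\otimes\mathcal{J}\bigr)\oplus\bigl(V\otimes\mathcal{T}\bigr)\oplus\mathcal{D}.$$ Then the unital Jordan algebra $\mathcal{J}$ contains an idempotent $e=e^{\cdot 2}\neq 0,1$ such that the image of the Lie algebra homomorphism $\iota:\mathfrak{sl}_2\oplus\mathfrak{sl}_2\hookrightarrow\mathcal{L}$ (the injective homomorphism with $\mathrm{ad}\circ\iota=\mathrm{d}\Phi$ given by the fact that $\Phi$ is inner) is $$\bigl(\mathfrak{sl}(V)\otimes e\bigr)\oplus\bigl(\mathfrak{sl}(V)\otimes(1-e)\bigr).$$ (2) Conversely, let $\mathcal{L}$ be a Lie algebra over $\mathbb{F}$ endowed with an inner $\mathbf{SL}_2$-structure $\Psi:\mathbf{SL}_2\rightarrow\mathbf{Aut}(\mathcal{L})$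 with isotypic decomposition $\mathcal{L}=\bigl(\mathfrak{sl}(V)\otimes\mathcal{J}\bigr)\oplus\bigl(V\otimes\mathcal{T}\bigr)\oplus\mathcal{D}$ (so that $\Psi$ is short), and suppose that the unital Jordan algebra $\mathcal{J}$ contains a nontrivial idempotent $e$ (that is, $e\cdot e=e\neq 0,1$). Then $\mathcal{L}$ is endowed with a short inner $(\mathbf{SL}_2\times\mathbf{SL}_2)$-structure $\Phi$, with $\Psi=\Phi\circ\Delta$, whose isotypic decomposition is $$\mathcal{L}=\bigl(\mathfrak{sl}(V)\otimes\mathcal{J}_1\bigr)\oplus\bigl(\mathfrak{sl}(V)\otimes\mathcal{J}_0\bigr)\oplus\Bigl(\bigl(\mathfrak{sl}(V)\otimes\mathcal{J}_{\frac12}\bigr)\oplus D_{e,\mathcal{J}_{\frac12}}\Bigr)\oplus\bigl(V\otimes\mathcal{T}_1\bigr)\oplus\bigl(V\otimes\mathcal{T}_0\bigr)\oplus\mathcal{S},$$ where $\mathcal{J}=\mathcal{J}_1\oplus\mathcal{J}_{\frac12}\oplus\mathcal{J}_0$ is the Peirce decomposition of $\mathcal{J}$ relative to $e$: $$\mathcal{J}_1=\{a\in\mathcal{J}\mid e\cdot a=a\},\quad \mathcal{J}_{\frac12}=\{a\in\mathcal{J}\mid e\cdot a=\tfrac12 a\},\quad \mathcal{J}_0=\{a\in\mathcal{J}\mid e\cdot a=0\},$$ $\mathcal{T}=\mathcal{T}_1\oplus\mathcal{T}_0$ is the induced decomposition of $\mathcal{T}$: $$\mathcal{T}_1=\{x\in\mathcal{T}\mid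 e\bullet x=x\},\quad \mathcal{T}_0=\{x\in\mathcal{T}\mid e\bullet x=0\},$$ $D_{e,\mathcal{J}_{\frac12}}=\{D_{e,a}\mid a\in\mathcal{J}_{\frac12}\}\subseteq\mathcal{D}$, and where the following assertions hold: - for any nonzero $a\in\mathcal{J}_1$, $\mathfrak{sl}(V)\otimes a$ is a copy of the adjoint module for the first copy of $\mathbf{SL}_2$; - for any nonzero $a\in\mathcal{J}_0$, $\mathfrak{sl}(V)\otimes a$ is a copy of the adjoint module for the second copy of $\mathbf{SL}_2$; - for any nonzero $a\in\mathcal{J}_{\frac12}$, $\bigl(\mathfrak{sl}(V)\otimes a\bigr)\oplus\mathbb{F}D_{e,a}$ is a copy of the tensor product of the natural module for the first copy of $\mathbf{SL}_2$ and the natural module for the second copy of $\mathbf{SL}_2$; - for any nonzero $x\in\mathcal{T}_1$, $V\otimes x$ is a copy of the natural module for the first copy of $\mathbf{SL}_2$; - for any nonzero $x\in\mathcal{T}_0$, $V\otimes x$ is a copy of the natural module for the second copy of $\mathbf{SL}_2$; - $\mathcal{S}$ is the subspace of elements fixed by $\mathbf{SL}_2\times\mathbf{SL}_2$. Moreover, the subspace of elements fixed by $\mathbf{SL}_2$ under $\Psi=\Phi\circ\Delta$ is the direct sum $\mathcal{D}=\mathcal{S}\oplus D_{e,\mathcal{J}_{\frac12}}$.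
   Context: All algebras and vector spaces are over a ground field $\mathbb{F}$ of characteristic $\neq 2,3$; $\otimes=\otimes_{\mathbb{F}}$. No finite-dimensionality is assumed for $\mathcal{L}$. Algebraic groups are affine group schemes of finite type over $\mathbb{F}$. **$\mathbf{S}$-structures.** Let $\mathbf{S}$ be a reductive algebraic group with Lie algebra $\mathfrak{s}$. An $\mathbf{S}$-structure on a Lie algebra $\mathcal{L}$ is a homomorphism $\Phi:\mathbf{S}\to\mathbf{Aut}(\mathcal{L})$ into the group scheme of automorphisms of $\mathcal{L}$ (so $\mathcal{L}$ is an $\mathbf{S}$-module on which $\mathbf{S}$ acts by Lie algebra automorphisms). Its differential is a Lie algebra homomorphism $\mathrm{d}\Phi:\mathfrak{s}\to\mathrm{Der}(\mathcal{L})$. The structure is *inner* if there is a one-to-one Lie algebra homomorphism $\iota:\mathfrak{s}\hookrightarrow\mathcal{L}$ with $\mathrm{ad}\circ\iota=\mathrm{d}\Phi$. **Short $\mathbf{SL}_2$-structures.** An $\mathbf{SL}_2$-structure on $\mathcal{L}$ is *short* if $\mathcal{L}$, as an $\mathbf{SL}_2$-module, is a direct sum of copies of the adjoint module, the natural two-dimensional module $V$, and the trivial one-dimensional module. Collecting isomorphic submodules gives the isotypic decomposition $\mathcal{L}=(\mathfrak{sl}(V)\otimes\mathcal{J})\oplus(V\otimes\mathcal{T})\oplus\mathcal{D}$ with vector spaces $\mathcal{J},\mathcal{T},\mathcal{D}$, where $\mathbf{SL}_2\simeq\mathbf{SL}(V)$ acts by the adjoint action on $\mathfrak{sl}(V)$,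 naturally on $V$, and trivially on $\mathcal{J},\mathcal{T},\mathcal{D}$ ($\mathcal{D}$ is the subalgebra of fixed elements). If the structure is inner, there is a distinguished element $1\in\mathcal{J}$ such that $\mathfrak{sl}(V)\otimes 1$ is the image of $\iota$, with $\iota(f)=f\otimes 1$. **Short $(\mathbf{SL}_2\times\mathbf{SL}_2)$-structures.** An $(\mathbf{SL}_2\times\mathbf{SL}_2)$-structure on $\mathcal{L}$ is *short* if $\mathcal{L}$, as a module for $\mathbf{SL}_2\times\mathbf{SL}_2$, is a direct sum of copies of: the adjoint module for each of the two copies of $\mathbf{SL}_2$; the natural two-dimensional modules $V_1$ and $V_0$ for the first and second copies of $\mathbf{SL}_2$, respectively; the tensor product $V_1\otimes V_0$; and the trivial one-dimensional module. If $\Phi$ is a short inner $(\mathbf{SL}_2\times\mathbf{SL}_2)$-structure, then $\Phi\circ\Delta$ is a short inner $\mathbf{SL}_2$-structure (with corresponding homomorphism $\mathfrak{sl}_2\to\mathcal{L}$, $f\mapsto\iota(f,f)$). **Operations on $(\mathcal{J},\mathcal{T})$.** Fix a nonzero skew-symmetric bilinear form $(\cdot\mid\cdot)$ on $V$ and set $\gamma_{u,v}(w)=(u\mid w)v+(v\mid w)u$. For an inner short $\mathbf{SL}_2$-structure on $\mathcal{L}$ with isotypic decomposition $\mathcal{L}=(\mathfrak{sl}(V)\otimes\mathcal{J})\oplus(V\otimes\mathcal{T})\oplus\mathcal{D}$, invariance of the bracket gives, for $f,g\in\mathfrak{sl}(V)$, $u,v\in V$, $a,b\in\mathcal{J}$,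 $x,y\in\mathcal{T}$, $D\in\mathcal{D}$: $$[f\otimes a,g\otimes b]=[f,g]\otimes a\cdot b+2\,\mathrm{tr}(fg)D_{a,b},\quad [f\otimes a,u\otimes x]=f(u)\otimes a\bullet x,$$ $$[u\otimes x,v\otimes y]=\gamma_{u,v}\otimes\langle x\mid y\rangle+(u\mid v)d_{x,y},\quad [D,f\otimes a]=f\otimes D(a),\quad [D,u\otimes x]=u\otimes D(x),$$ for uniquely determined bilinear maps $a\cdot b\in\mathcal{J}$ (symmetric), $D_{a,b}\in\mathcal{D}$ (skew-symmetric), $a\bullet x\in\mathcal{T}$, $\langle x\mid y\rangle\in\mathcal{J}$ (skew-symmetric), $d_{x,y}\in\mathcal{D}$ (symmetric), $D(a)\in\mathcal{J}$, $D(x)\in\mathcal{T}$. It is known that then $\mathcal{J}$ is a unital Jordan algebra with product $a\cdot b$ and unity $1$, that $\mathcal{T}$ is a special unital Jordan module for $\mathcal{J}$ with action $\bullet$ (i.e. $1\bullet x=x$ and $(a\cdot b)\bullet x=\frac12(a\bullet(b\bullet x)+b\bullet(a\bullet x))$), and that $(\mathcal{J},\mathcal{T})$ is a $J$-ternary algebra with the triple product $(x,y,z)=\frac12\bigl(-d_{x,y}(z)+\langle x\mid y\rangle\bullet z\bigr)$ on $\mathcal{T}$. This $(\mathcal{J},\mathcal{T})$ is said to *coordinatize* the $\mathbf{SL}_2$-structure. **$J$-ternary algebras.** Let $\mathcal{J}$ be a unital Jordan algebra, $\mathcal{T}$ a special unital Jordan module for $\mathcal{J}$, $\langle\cdot\mid\cdot\rangle:\mathcal{T}\times\mathcal{T}\to\mathcal{J}$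 a skew-symmetric bilinear map, and $(\cdot,\cdot,\cdot):\mathcal{T}^3\to\mathcal{T}$ a trilinear product. $(\mathcal{J},\mathcal{T})$ is a $J$-ternary algebra if for all $a\in\mathcal{J}$, $x,y,z,w,v\in\mathcal{T}$: (JT1) $a\cdot\langle x\mid y\rangle=\frac12(\langle a\bullet x\mid y\rangle+\langle x\mid a\bullet y\rangle)$; (JT2) $a\bullet(x,y,z)=(a\bullet x,y,z)-(x,a\bullet y,z)+(x,y,a\bullet z)$; (JT3) $(x,y,z)=(z,y,x)-\langle x\mid z\rangle\bullet y$; (JT4) $(x,y,z)=(y,x,z)+\langle x\mid y\rangle\bullet z$; (JT5) $\langle(x,y,z)\mid w\rangle+\langle z\mid(x,y,w)\rangle=\langle x\mid\langle z\mid w\rangle\bullet y\rangle$; (JT6) $(x,y,(z,w,v))=((x,y,z),w,v)+(z,(y,x,w),v)+(z,w,(x,y,v))$. *)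

(* Defs.v *)
From HB Require Import structures.
From mathcomp Require Import all_boot all_algebra generic_quotient.
From mathcomp Require Import ring.
From mathcomp Require Import boolp classical_sets.

Set Implicit Arguments.
Unset Strict Implicit.
Unset Printing Implicit Defensive.

Import GRing.Theory.
Local Open Scope classical_set_scope.
Local Open Scope ring_scope.

Definition bilin (F : nzRingType) (U V W : lmodType F) (B : U -> V -> W) : Prop :=
  (forall v, linear (B^~ v)) /\ (forall u, linear (B u)).

Section LinearFacts.
Variables (F : nzRingType) (U V : lmodType F) (f : U -> V).
Hypothesis flin : linear f.

Lemma lin0 : f 0 = 0.
Proof.
have := flin 1 0 0; rewrite !scale1r addr0 => /(congr1 (fun x => x - f 0)).
by rewrite subrr addrK => ->.
Qed.
Lemma linD x y : f (x + y) = f x + f y.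
Proof. by have := flin 1 x y; rewrite !scale1r. Qed.
Lemma linZ a x : f (a *: x) = a *: f x.
Proof. by have := flin a x 0; rewrite !addr0 lin0 addr0. Qed.
Lemma linN x : f (- x) = - f x.
Proof. by rewrite -scaleN1r linZ scaleN1r. Qed.
Lemma lin_sum I (r : seq I) (P : pred I) (E : I -> U) :
  f (\sum_(i <- r | P i) E i) = \sum_(i <- r | P i) f (E i).
Proof. by apply: (big_morph f linD lin0). Qed.
End LinearFacts.

(* Tensor products over F: formal sums of pairs, two of them being identified
   when no bilinear map separates them.  [tlift_tens], [tlift_linear] and
   [tensor_ext] are the universal property. *)
Section Tensor.
Variables (F : comNzRingType) (U V : lmodType F).

Definition bsum (W : lmodType F) (B : U -> V -> W) (s : seq (U * V)) : W :=
  \sum_(p <- s) B p.1 p.2.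

Definition teq (s t : seq (U * V)) : bool :=
  `[< forall (W : lmodType F) (B : U -> V -> W), bilin B -> bsum B s = bsum B t >].

Lemma teq_refl : reflexive teq.
Proof. by move=> s; apply/asboolP. Qed.
Lemma teq_sym : symmetric teq.
Proof. by move=> s t; apply/asboolP/asboolP => h W B b; rewrite h. Qed.
Lemma teq_trans : transitive teq.
Proof. by move=> s t u /asboolP h /asboolP k; apply/asboolP => W B b; rewrite h ?k. Qed.

Canonical teq_equiv := EquivRel teq teq_refl teq_sym teq_trans.

Definition tensor := {eq_quot teq_equiv}%qT.
HB.instance Definition _ := Choice.copy tensor {eq_quot teq_equiv}%qT.

Definition tpi (s : seq (U * V)) : tensor := (\pi_{eq_quot teq_equiv} s)%qT.
Definition trepr (t : tensor) : seq (U * V) := repr (t : {eq_quot teq_equiv}%qT).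

Lemma treprK t : tpi (trepr t) = t.
Proof. exact: reprK. Qed.
Lemma tpiP s t : reflect (tpi s = tpi t) (teq s t).
Proof. exact: eqmodP. Qed.

Definition tens (u : U) (v : V) : tensor := tpi [:: (u, v)].

Definition tlift (W : lmodType F) (B : U -> V -> W) (t : tensor) : W :=
  bsum B (trepr t).

Lemma tlift_pi (W : lmodType F) (B : U -> V -> W) s :
  bilin B -> tlift B (tpi s) = bsum B s.
Proof.
move=> b; rewrite /tlift.
by have /tpiP/asboolP/(_ _ _ b) := treprK (tpi s).
Qed.

Lemma tensor_sepP (t t' : tensor) :
  (forall (W : lmodType F) (B : U -> V -> W), bilin B -> tlift B t = tlift B t') ->
  t = t'.
Proof. by rewrite -[t]treprK -[t']treprK => h; apply/tpiP/asboolP => W B b; rewrite -!tlift_pi //; exact: h. Qed.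

Definition tscale (a : F) (t : tensor) : tensor :=
  tpi [seq (a *: p.1, p.2) | p <- trepr t].
Definition tadd (t t' : tensor) : tensor := tpi (trepr t ++ trepr t').
Definition tzero : tensor := tpi [::].
Definition topp := tscale (-1).

Lemma tlift0 (W : lmodType F) (B : U -> V -> W) : bilin B -> tlift B tzero = 0.
Proof. by move=> b; rewrite tlift_pi // /bsum big_nil. Qed.
Lemma tliftD (W : lmodType F) (B : U -> V -> W) t t' :
  bilin B -> tlift B (tadd t t') = tlift B t + tlift B t'.
Proof. by move=> b; rewrite tlift_pi // /bsum big_cat. Qed.
Lemma tliftZ (W : lmodType F) (B : U -> V -> W) a t :
  bilin B -> tlift B (tscale a t) = a *: tlift B t.
Proof.
move=> b; rewrite tlift_pi // /bsum big_map scaler_sumr.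
by apply: eq_bigr => p _; rewrite (linZ (b.1 _)).
Qed.

Fact taddA : associative tadd.
Proof. by move=> x y z; apply: tensor_sepP => W B b; rewrite !tliftD // addrA. Qed.
Fact taddC : commutative tadd.
Proof. by move=> x y; apply: tensor_sepP => W B b; rewrite !tliftD // addrC. Qed.
Fact tadd0 : left_id tzero tadd.
Proof. by move=> x; apply: tensor_sepP => W B b; rewrite !tliftD // tlift0 // add0r. Qed.
Fact taddN : left_inverse tzero topp tadd.
Proof.
move=> x; apply: tensor_sepP => W B b.
by rewrite !tliftD // tliftZ // tlift0 // scaleN1r addNr.
Qed.
HB.instance Definition _ := GRing.isZmodule.Build tensor taddA taddC tadd0 taddN.

Fact tscaleA a b t : tscale a (tscale b t) = tscale (a * b) t.
Proof. by apply: tensor_sepP => W B bl; rewrite !tliftZ // scalerA. Qed.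
Fact tscale1 : left_id 1 tscale.
Proof. by move=> t; apply: tensor_sepP => W B bl; rewrite !tliftZ // scale1r. Qed.
Fact tscaleDr : right_distributive tscale +%R.
Proof.
by move=> a t t'; apply: tensor_sepP => W B bl; rewrite !(tliftZ, tliftD) // scalerDr.
Qed.
Fact tscaleDl t : {morph tscale^~ t : a b / a + b}.
Proof.
by move=> a b; apply: tensor_sepP => W B bl; rewrite !(tliftZ, tliftD) // scalerDl.
Qed.
HB.instance Definition _ :=
  GRing.Zmodule_isLmodule.Build F tensor tscaleA tscale1 tscaleDr tscaleDl.

Lemma tlift_linear (W : lmodType F) (B : U -> V -> W) : bilin B -> linear (tlift B).
Proof. by move=> b a x y; rewrite tliftD // tliftZ. Qed.

Lemma tlift_tens (W : lmodType F) (B : U -> V -> W) u v :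
  bilin B -> tlift B (tens u v) = B u v.
Proof. by move=> b; rewrite tlift_pi // /bsum big_seq1. Qed.

Lemma tens_bilin : bilin tens.
Proof.
split=> [v | u] a x y; apply: tensor_sepP => W B b; rewrite (tlift_linear b).
  by rewrite !tlift_tens // (b.1 v).
by rewrite !tlift_tens // (b.2 u).
Qed.

Lemma tensor_sum (t : tensor) : exists s : seq (U * V), t = \sum_(p <- s) tens p.1 p.2.
Proof.
exists (trepr t); apply: tensor_sepP => W B b.
rewrite (lin_sum (tlift_linear b)); apply: eq_bigr => p _; by rewrite tlift_tens.
Qed.

Lemma tensor_ext (W : zmodType) (f g : tensor -> W) :
  {morph f : x y / x + y} -> {morph g : x y / x + y} ->
  (forall u v, f (tens u v) = g (tens u v)) -> f =1 g.
Proof.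
move=> fD gD fg t.
have f0 : f 0 = 0 by apply: (addrI (f 0)); rewrite -fD !addr0.
have g0 : g 0 = 0 by apply: (addrI (g 0)); rewrite -gD !addr0.
have [s ->] := tensor_sum t.
by rewrite (big_morph f fD f0) (big_morph g gD g0); apply: eq_bigr.
Qed.

End Tensor.

Lemma alg_mul_bilin (F : comNzRingType) (R : comAlgType F) :
  bilin (fun r s : R => r * s).
Proof.
by split=> [s | r] a x y; rewrite ?mulrDl ?mulrDr -?scalerAl -?scalerAr.
Qed.

(* Base change M_R = M (x)_F R, as an R-module. *)
Section BaseChange.
Variables (F : comNzRingType) (M : lmodType F) (R : comAlgType F).

Definition bext : Type := tensor M R.
HB.instance Definition _ := GRing.Zmodule.copy bext (tensor M R).

Definition bten (m : M) (r : R) : bext := tens m r.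

Definition bscale (r : R) (t : bext) : bext :=
  tlift (fun m s => tens m (r * s) : tensor M R) t.

Lemma bscale_bilin r : bilin (fun (m : M) (s : R) => tens m (r * s) : tensor M R).
Proof.
split=> [s | m] a x y; first exact: (tens_bilin M R).1.
by rewrite (alg_mul_bilin R).2 (tens_bilin M R).2.
Qed.
Lemma bscaleD r : {morph bscale r : x y / x + y}.
Proof. by move=> x y; apply: (linD (tlift_linear (bscale_bilin r))). Qed.
Lemma bscale_bten r m s : bscale r (bten m s) = bten m (r * s).
Proof. by rewrite /bscale tlift_tens //; apply: bscale_bilin. Qed.

Lemma btenDl m n r : bten (m + n) r = bten m r + bten n r.
Proof. exact: (linD ((tens_bilin M R).1 r)). Qed.
Lemma btenDr m r s : bten m (r + s) = bten m r + bten m s.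
Proof. exact: (linD ((tens_bilin M R).2 m)). Qed.

Lemma bext_ext (W : zmodType) (f g : bext -> W) :
  {morph f : x y / x + y} -> {morph g : x y / x + y} ->
  (forall u v, f (bten u v) = g (bten u v)) -> f =1 g.
Proof. exact: tensor_ext. Qed.

Fact bscaleA r s t : bscale r (bscale s t) = bscale (r * s) t.
Proof.
apply: (bext_ext (f := bscale r \o bscale s) (g := bscale (r * s))) t => [x y|x y|m q] /=.
- by rewrite !bscaleD.
- exact: bscaleD.
- by rewrite !bscale_bten mulrA.
Qed.
Fact bscale1 : left_id 1 bscale.
Proof.
apply: (bext_ext (f := bscale 1) (g := id)) => [x y|x y|m q] //=.
  exact: bscaleD.
by rewrite bscale_bten mul1r.
Qed.
Fact bscaleDl t : {morph bscale^~ t : a b / a + b}.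
Proof.
move=> a b; apply: (bext_ext (f := bscale (a + b)) (g := fun t => bscale a t + bscale b t)) t.
- exact: bscaleD.
- by move=> x y; rewrite !bscaleD addrACA.
- by move=> m q; rewrite !bscale_bten mulrDl btenDr.
Qed.
HB.instance Definition _ := GRing.Zmodule_isLmodule.Build R bext
  bscaleA bscale1 bscaleD bscaleDl.

Lemma scale_bten (r : R) m s : r *: bten m s = bten m (r * s).
Proof. exact: bscale_bten. Qed.
Lemma bten0r m : bten m 0 = 0.
Proof. exact: (lin0 ((tens_bilin M R).2 m)). Qed.
Lemma bten0l r : bten 0 r = 0.
Proof. exact: (lin0 ((tens_bilin M R).1 r)). Qed.
Lemma btenNl m r : bten (- m) r = - bten m r.
Proof. exact: (linN ((tens_bilin M R).1 r)). Qed.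
Lemma btenZl (a : F) m r : bten (a *: m) r = bten m (a *: r).
Proof.
by rewrite /bten (linZ ((tens_bilin M R).1 r)) (linZ ((tens_bilin M R).2 m)).
Qed.
Lemma bten_suml I (r : seq I) (P : pred I) (E : I -> M) s :
  bten (\sum_(i <- r | P i) E i) s = \sum_(i <- r | P i) bten (E i) s.
Proof. exact: (lin_sum ((tens_bilin M R).1 s)). Qed.
Lemma bten_sumr I (r : seq I) (P : pred I) m (E : I -> R) :
  bten m (\sum_(i <- r | P i) E i) = \sum_(i <- r | P i) bten m (E i).
Proof. exact: (lin_sum ((tens_bilin M R).2 m)). Qed.

End BaseChange.

(* An R-module N seen as an F-module along F -> R. *)
Section Restriction.
Variables (F : comNzRingType) (R : comAlgType F) (N : lmodType R).
Definition rsc : Type := N.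
HB.instance Definition _ := GRing.Zmodule.copy rsc N.
Definition rsc_scale (a : F) (x : rsc) : rsc := (a%:A : R) *: (x : N).
Fact rsc_scaleA a b x : rsc_scale a (rsc_scale b x) = rsc_scale (a * b) x.
Proof. by rewrite /rsc_scale scalerA -scalerAl mul1r scalerA. Qed.
Fact rsc_scale1 : left_id 1 rsc_scale.
Proof. by move=> x; rewrite /rsc_scale !scale1r. Qed.
Fact rsc_scaleDr : right_distributive rsc_scale +%R.
Proof. by move=> a x y; rewrite /rsc_scale scalerDr. Qed.
Fact rsc_scaleDl x : {morph rsc_scale^~ x : a b / a + b}.
Proof. by move=> a b; rewrite /rsc_scale !scalerDl. Qed.
HB.instance Definition _ := GRing.Zmodule_isLmodule.Build F rsc
  rsc_scaleA rsc_scale1 rsc_scaleDr rsc_scaleDl.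
Lemma rscZ (a : F) (x : rsc) : a *: x = (a%:A : R) *: (x : N).
Proof. by []. Qed.
End Restriction.

(* The R-linear extension M_R -> N of an F-linear map M -> N. *)
Section BaseLift.
Variables (F : comNzRingType) (M : lmodType F) (R : comAlgType F) (N : lmodType R).

Definition blift (f : M -> N) (t : bext M R) : N :=
  tlift (fun m r => r *: f m : rsc N) t.

Definition semilin (f : M -> N) :=
  forall a x y, f (a *: x + y) = (a%:A : R) *: f x + f y.

Lemma blift_bilin f : semilin f -> bilin (fun m (r : R) => r *: f m : rsc N).
Proof.
move=> h; split=> [r | m] a x y; rewrite rscZ.
  by rewrite h scalerDr !scalerA mulrC.
by rewrite scalerDl scalerA mulr_algl.
Qed.
Lemma blift_bten f m r : semilin f -> blift f (bten m r) = r *: f m.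
Proof. by move=> h; rewrite /blift tlift_tens //; apply: blift_bilin. Qed.
Lemma bliftD f : semilin f -> {morph blift f : x y / x + y}.
Proof. by move=> h x y; apply: (linD (tlift_linear (blift_bilin h))). Qed.
Lemma bliftZ f : semilin f -> forall r x, blift f (r *: x) = r *: blift f x.
Proof.
move=> h r.
apply: (bext_ext (f := fun x => blift f (r *: x)) (g := fun x => r *: blift f x)).
- by move=> x y; rewrite scalerDr bliftD.
- by move=> x y; rewrite bliftD // scalerDr.
- by move=> m s; rewrite scale_bten !blift_bten // scalerA.
Qed.
Lemma blift_linear f : semilin f -> linear (blift f).
Proof. by move=> h a x y; rewrite bliftD // bliftZ. Qed.
Lemma eq_blift f g : f =1 g -> blift f =1 blift g.
Proof. by move=> /funext ->. Qed.
Lemma blift_ext (f g : bext M R -> N) :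
  linear f -> linear g -> (forall m, f (bten m 1) = g (bten m 1)) -> f =1 g.
Proof.
move=> fl gl fg; apply: bext_ext; [exact: linD | exact: linD |] => m r.
by rewrite -[r]mulr1 -scale_bten (linZ fl) (linZ gl) fg.
Qed.
Lemma linear_semilin f (h : bext M R -> N) :
  linear h -> (forall m, f m = h (bten m 1)) -> semilin f.
Proof.
move=> hl fh a x y; rewrite !fh btenDl btenZl -(linZ hl) -(linD hl) scale_bten.
by rewrite mulr1.
Qed.
End BaseLift.

Section BaseOps.
Variables (F : comNzRingType) (M N : lmodType F).

(* m (x) r |-> m (x) phi r. *)
Definition bmap (R R' : comAlgType F) (phi : {lrmorphism R -> R'})
  (t : bext M R) : bext M R' := tlift (fun m r => tens m (phi r) : tensor M R') t.

Lemma bmap_bilin (R R' : comAlgType F) (phi : {lrmorphism R -> R'}) :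
  bilin (fun m r => tens m (phi r) : tensor M R').
Proof.
split=> [s | m] a x y; first exact: (tens_bilin M R').1.
by rewrite linearP (tens_bilin M R').2.
Qed.
Lemma bmap_bten (R R' : comAlgType F) (phi : {lrmorphism R -> R'}) m r :
  bmap phi (bten m r) = bten m (phi r).
Proof. by rewrite /bmap tlift_tens //; apply: bmap_bilin. Qed.
Lemma bmapD (R R' : comAlgType F) (phi : {lrmorphism R -> R'}) :
  {morph bmap phi : x y / x + y}.
Proof. by move=> x y; apply: (linD (tlift_linear (bmap_bilin phi))). Qed.
Lemma bmapZ (R R' : comAlgType F) (phi : {lrmorphism R -> R'}) r x :
  bmap phi (r *: x) = phi r *: bmap phi x.
Proof.
apply: (bext_ext (f := fun x => bmap phi (r *: x)) (g := fun x => phi r *: bmap phi x)) x.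
- by move=> x y; rewrite scalerDr bmapD.
- by move=> x y; rewrite bmapD scalerDr.
- by move=> m s; rewrite scale_bten !bmap_bten scale_bten rmorphM.
Qed.

(* The extension f_R : M_R -> N_R of a linear map f : M -> N. *)
Definition blin (f : M -> N) (R : comAlgType F) : bext M R -> bext N R :=
  blift (fun m => bten (f m) 1 : bext N R).

Lemma blin_semilin (f : M -> N) (R : comAlgType F) :
  linear f -> semilin (fun m => bten (f m) 1 : bext N R).
Proof. by move=> fl a x y; rewrite fl btenDl btenZl scale_bten mulr1. Qed.
Lemma blin_bten (f : M -> N) (R : comAlgType F) m (r : R) :
  linear f -> blin f (bten m r) = bten (f m) r.
Proof. by move=> fl; rewrite /blin blift_bten ?scale_bten ?mulr1 //; apply: blin_semilin. Qed.

End BaseOps.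

Section BaseBilinear.
Variables (F : comNzRingType) (M N : lmodType F).

(* The R-bilinear extension M_R -> N_R -> P_R of a bilinear map M -> N -> P. *)
Definition bbil (P : lmodType F) (B : M -> N -> P) (R : comAlgType F)
    (x : bext M R) (y : bext N R) : bext P R :=
  blift (fun m => blift (fun n => bten (B m n) 1 : bext P R) y) x.
Arguments bbil {P} B {R} x y.

Section Bbil.
Variables (P : lmodType F) (B : M -> N -> P) (R : comAlgType F).
Hypothesis Bb : bilin B.
Let in_semi m : semilin (fun n => bten (B m n) 1 : bext P R).
Proof. exact: (blin_semilin R (Bb.2 m)). Qed.
Let out_semi y : semilin (fun m => blift (fun n => bten (B m n) 1 : bext P R) y).
Proof.
move=> a m m'.
apply: (blift_ext (f := blift _)
  (g := fun y => (a%:A : R) *: blift (fun n => bten (B m n) 1 : bext P R) y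
                 + blift (fun n => bten (B m' n) 1 : bext P R) y)) y.
- exact: blift_linear.
- move=> r y y'; rewrite !(bliftD (in_semi _)) !(bliftZ (in_semi _)) !scalerDr !scalerA.
  by rewrite addrACA [a%:A * r]mulrC.
- move=> n; rewrite !blift_bten //= !scale1r (Bb.1 n) btenDl btenZl scale_bten.
  by rewrite mulr1.
Qed.
Lemma bbil_bten m n r s : bbil B (bten m r) (bten n s) = bten (B m n) (r * s) :> bext P R.
Proof.
rewrite /bbil blift_bten; last exact: out_semi.
by rewrite blift_bten // !scale_bten mulr1.
Qed.
Lemma bbil_linl (y : bext N R) : linear (fun x => bbil B x y : bext P R).
Proof. exact: blift_linear (out_semi y). Qed.
Lemma bbil_linr (x : bext M R) : linear (fun y => bbil B x y : bext P R).
Proof.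
move=> r y y'.
apply: (blift_ext (f := fun x => bbil B x (r *: y + y'))
  (g := fun x => r *: bbil B x y + bbil B x y')) x.
- exact: bbil_linl.
- move=> a x x'; rewrite !(bbil_linl _ a x x') !scalerDr !scalerA.
  by rewrite addrACA [r * a]mulrC.
- move=> m; rewrite /bbil !blift_bten ?scale1r //.
  exact: blift_linear.
Qed.
End Bbil.
End BaseBilinear.
Arguments bbil {F M N P} B {R} x y.

HB.mixin Record Lmodule_isLie (F : fieldType) L of GRing.Lmodule F L := {
  lie : L -> L -> L;
  lie_bilin : bilin lie;
  liexx : forall x, lie x x = 0;
  jacobi : forall x y z, lie x (lie y z) + lie y (lie z x) + lie z (lie x y) = 0
}.
#[short(type="lieAlgType")]
HB.structure Definition LieAlgebra (F : fieldType) :=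
  {L of Lmodule_isLie F L & GRing.Lmodule F L}.

Definition lie_hom (F : fieldType) (L M : lieAlgType F) (f : L -> M) : Prop :=
  linear f /\ forall x y, f (lie x y) = lie (f x) (f y).

Section ProdLie.
Variables (F : fieldType) (L M : lieAlgType F).
Definition prod_lie (x y : L * M) : L * M := (lie x.1 y.1, lie x.2 y.2).
Fact prod_lie_bilin : bilin prod_lie.
Proof.
by split=> [[z z'] | [z z']] a [x x'] [y y'];
  rewrite /prod_lie /= ?((@lie_bilin _ L).1 z) ?((@lie_bilin _ M).1 z')
     ?((@lie_bilin _ L).2 z) ?((@lie_bilin _ M).2 z').
Qed.
Fact prod_liexx x : prod_lie x x = 0.
Proof. by rewrite /prod_lie !liexx. Qed.
Fact prod_jacobi x y z :
  prod_lie x (prod_lie y z) + prod_lie y (prod_lie z x) + prod_lie z (prod_lie x y) = 0.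
Proof.
by rewrite /prod_lie /=; congr pair; rewrite jacobi.
Qed.
HB.instance Definition _ :=
  Lmodule_isLie.Build F (L * M)%type prod_lie_bilin prod_liexx prod_jacobi.
End ProdLie.

Definition traceless (F : fieldType) : {pred 'M[F]_2} := [pred A | \tr A == 0].
Arguments traceless F : clear implicits.
Record sl2 (F : fieldType) := Sl2 { sl2val :> 'M[F]_2; _ : sl2val \in traceless F }.

Section Sl2.
Variable F : fieldType.
HB.instance Definition _ := [isSub for @sl2val F].
HB.instance Definition _ := [Choice of sl2 F by <:].
Fact traceless_submod : submod_closed (traceless F).
Proof.
split=> [|a x y]; rewrite !inE ?mxtrace0 // => /eqP hx /eqP hy.
by rewrite mxtraceD mxtraceZ hx hy mulr0 addr0.
Qed.
HB.instance Definition _ := GRing.isSubmodClosed.Build F _ (traceless F) traceless_submod.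
HB.instance Definition _ := [SubChoice_isSubLmodule of sl2 F by <:].

Lemma sl2_tr (x : sl2 F) : \tr (sl2val x) = 0.
Proof. by case: x => ? /= /[!inE] /eqP. Qed.
Lemma sl2P (x y : sl2 F) : sl2val x = sl2val y -> x = y.
Proof. exact: val_inj. Qed.
Lemma sl2val_linear : linear (@sl2val F).
Proof. by []. Qed.

Fact sl2_lie_tr (x y : sl2 F) :
  sl2val x *m sl2val y - sl2val y *m sl2val x \in traceless F.
Proof. by rewrite inE linearB /= mxtrace_mulC subrr. Qed.
Definition sl2_lie (x y : sl2 F) : sl2 F := Sl2 (sl2_lie_tr x y).
Lemma sl2_lieE x y : sl2val (sl2_lie x y) = x *m y - y *m x.
Proof. by []. Qed.
Lemma sl2valD x y : sl2val (x + y) = sl2val x + sl2val y.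
Proof. exact: linD sl2val_linear x y. Qed.
Lemma sl2valZ a x : sl2val (a *: x) = a *: sl2val x.
Proof. exact: linZ sl2val_linear a x. Qed.
Fact sl2_lie_bilin : bilin sl2_lie.
Proof.
split=> z a x y; apply: sl2P; rewrite sl2valD sl2valZ !sl2_lieE sl2valD sl2valZ.
  by rewrite mulmxDl mulmxDr -scalemxAl -scalemxAr scalerBr opprD addrACA.
by rewrite mulmxDl mulmxDr -scalemxAl -scalemxAr scalerBr opprD addrACA.
Qed.
Fact sl2_liexx x : sl2_lie x x = 0.
Proof. by apply: sl2P; rewrite sl2_lieE subrr (lin0 sl2val_linear). Qed.
Fact sl2_jacobi x y z :
  sl2_lie x (sl2_lie y z) + sl2_lie y (sl2_lie z x) + sl2_lie z (sl2_lie x y) = 0.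
Proof.
apply: sl2P; rewrite !sl2valD !sl2_lieE (lin0 sl2val_linear).
rewrite !mulmxE !(mulrBr, mulrBl, opprB) !mulrA.
set a := sl2val x; set b := sl2val y; set c := sl2val z.
move: (a * b * c) (a * c * b) (c * b * a) (b * c * a) (b * a * c) (c * a * b).
by move=> p q r s t u; apply/matrixP => i j; rewrite !mxE; ring.
Qed.
HB.instance Definition _ :=
  Lmodule_isLie.Build F (sl2 F) sl2_lie_bilin sl2_liexx sl2_jacobi.

End Sl2.

(* F[eps]/(eps^2); (a, b) stands for a + b eps. *)
Definition dual (F : fieldType) : Type := (F^o * F^o)%type.

Section Dual.
Variable F : fieldType.
HB.instance Definition _ := GRing.Lmodule.copy (dual F) (F^o * F^o)%type.
Definition dual_mul (x y : dual F) : dual F := (x.1 * y.1, x.1 * y.2 + x.2 * y.1).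
Definition dual_one : dual F := (1, 0).
Definition eps : dual F := (0, 1).
Fact dual_mulA : associative dual_mul.
Proof.
case=> [a a'] [b b'] [c c']; rewrite /dual_mul /=; congr pair; first by rewrite mulrA.
by rewrite mulrDr mulrDl !mulrA addrA.
Qed.
Fact dual_mulC : commutative dual_mul.
Proof.
case=> [a a'] [b b']; rewrite /dual_mul /=; congr pair; first by rewrite mulrC.
by rewrite addrC [b * _]mulrC [b' * _]mulrC.
Qed.
Fact dual_mul1 : left_id dual_one dual_mul.
Proof. by case=> a b; rewrite /dual_mul /= !mul1r mul0r addr0. Qed.
Fact dual_mulD : left_distributive dual_mul +%R.
Proof.
case=> [a a'] [b b'] [c c']; rewrite /dual_mul /=; congr pair; first by rewrite mulrDl.
by rewrite /= !mulrDl addrACA.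
Qed.
Fact dual_10 : dual_one != 0.
Proof. by apply/eqP => -[/eqP]; rewrite oner_eq0. Qed.
HB.instance Definition _ := GRing.Zmodule_isComNzRing.Build (dual F)
  dual_mulA dual_mulC dual_mul1 dual_mulD dual_10.
Lemma dual_ext (x y : dual F) : x.1 = y.1 -> x.2 = y.2 -> x = y.
Proof. by case: x y => [? ?] [? ?] /= -> ->. Qed.
Lemma dmul1 (x y : dual F) : (x * y).1 = x.1 * y.1.
Proof. by []. Qed.
Lemma dmul2 (x y : dual F) : (x * y).2 = x.1 * y.2 + x.2 * y.1.
Proof. by []. Qed.
Lemma dual_sub1 (x y : dual F) : (x - y).1 = x.1 - y.1.
Proof. by []. Qed.
Lemma dual_sub2 (x y : dual F) : (x - y).2 = x.2 - y.2.
Proof. by []. Qed.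
Lemma dscale1 (a : F) (x : dual F) : (a *: x).1 = a * x.1.
Proof. by []. Qed.
Lemma dscale2 (a : F) (x : dual F) : (a *: x).2 = a * x.2.
Proof. by []. Qed.
Fact dual_scaleAl (a : F) (x y : dual F) : a *: (x * y) = (a *: x : dual F) * y.
Proof.
apply: dual_ext; rewrite ?(dscale1, dscale2, dmul1, dmul2) //= .
  exact: mulrA.
have e (u u' v v' : F) : a * (u * v' + u' * v) = (a * u) * v' + (a * u') * v by ring.
exact: e.
Qed.
HB.instance Definition _ := GRing.Lmodule_isLalgebra.Build F (dual F) dual_scaleAl.
HB.instance Definition _ := GRing.Lalgebra_isComAlgebra.Build F (dual F).

(* a + b eps |-> a. *)
Definition aug (x : dual F) : F^o := x.1.
Fact aug_linear : linear aug. Proof. by []. Qed.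
HB.instance Definition _ := GRing.isLinear.Build F (dual F) F^o _ aug aug_linear.
Fact aug_monoid : monoid_morphism aug. Proof. by split. Qed.
HB.instance Definition _ := GRing.isMonoidMorphism.Build (dual F) F^o aug aug_monoid.
End Dual.




Lemma eps2 (F : fieldType) : eps F * eps F = 0.
Proof. by apply: dual_ext; rewrite ?(dmul1, dmul2) /= ?(mul0r, mulr0, addr0). Qed.

Record SL2 (R : comNzRingType) :=
  MkSL2 { SL2val :> 'M[R]_2; SL2_det : \det SL2val == 1 }.

Section SL2group.
Variable R : comNzRingType.
HB.instance Definition _ := [isSub for @SL2val R].
HB.instance Definition _ := [Choice of SL2 R by <:].
Implicit Types g h : SL2 R.

Lemma SL2P g h : SL2val g = SL2val h -> g = h.
Proof. exact: val_inj. Qed.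

Fact SL2_mul_det g h : \det (SL2val g *m SL2val h) == 1.
Proof. by rewrite det_mulmx (eqP (SL2_det g)) (eqP (SL2_det h)) mulr1. Qed.
Definition SL2_mul g h := MkSL2 (SL2_mul_det g h).
Fact SL2_one_det : \det (1%:M : 'M[R]_2) == 1.
Proof. by rewrite det1. Qed.
Definition SL2_one := MkSL2 SL2_one_det.
Lemma SL2_adjM g : \adj (SL2val g) *m SL2val g = 1%:M.
Proof. by rewrite mul_adj_mx (eqP (SL2_det g)). Qed.
Lemma SL2_Madj g : SL2val g *m \adj (SL2val g) = 1%:M.
Proof. by rewrite mul_mx_adj (eqP (SL2_det g)). Qed.
Fact SL2_inv_det g : \det (\adj (SL2val g)) == 1.
Proof.
by have /(congr1 determinant) := SL2_adjM g;
   rewrite det_mulmx det1 (eqP (SL2_det g)) mulr1 => ->.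
Qed.
Definition SL2_inv g := MkSL2 (SL2_inv_det g).

Fact SL2_mulA : associative SL2_mul.
Proof. by move=> f g h; apply: SL2P; rewrite /= mulmxA. Qed.
Fact SL2_mul1 : left_id SL2_one SL2_mul.
Proof. by move=> g; apply: SL2P; rewrite /= mul1mx. Qed.
Fact SL2_1mul : right_id SL2_one SL2_mul.
Proof. by move=> g; apply: SL2P; rewrite /= mulmx1. Qed.
Fact SL2_mulV : left_inverse SL2_one SL2_inv SL2_mul.
Proof. by move=> g; apply: SL2P; rewrite /= SL2_adjM. Qed.
Fact SL2_Vmul : right_inverse SL2_one SL2_inv SL2_mul.
Proof. by move=> g; apply: SL2P; rewrite /= SL2_Madj. Qed.
HB.instance Definition _ :=
  isGroup.Build (SL2 R) SL2_mulA SL2_mul1 SL2_1mul SL2_mulV SL2_Vmul.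
End SL2group.

Definition prodgrp (G H : groupType) : Type := (G * H)%type.
Section ProdGroup.
Variables G H : groupType.
HB.instance Definition _ := Choice.copy (prodgrp G H) (G * H)%type.
Definition pg_mul (x y : prodgrp G H) : prodgrp G H := (x.1 * y.1, x.2 * y.2)%g.
Definition pg_one : prodgrp G H := (1, 1)%g.
Definition pg_inv (x : prodgrp G H) : prodgrp G H := (x.1^-1, x.2^-1)%g.
Fact pg_mulA : associative pg_mul.
Proof. by move=> x y z; rewrite /pg_mul /= !mulgA. Qed.
Fact pg_mul1 : left_id pg_one pg_mul.
Proof. by case=> x y; rewrite /pg_mul /= !mul1g. Qed.
Fact pg_1mul : right_id pg_one pg_mul.
Proof. by case=> x y; rewrite /pg_mul /= !mulg1. Qed.
Fact pg_mulV : left_inverse pg_one pg_inv pg_mul.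
Proof. by case=> x y; rewrite /pg_mul /= !mulVg. Qed.
Fact pg_Vmul : right_inverse pg_one pg_inv pg_mul.
Proof. by case=> x y; rewrite /pg_mul /= !mulgV. Qed.
HB.instance Definition _ :=
  isGroup.Build (prodgrp G H) pg_mulA pg_mul1 pg_1mul pg_mulV pg_Vmul.
End ProdGroup.

(* A group functor on commutative F-algebras together with a Lie algebra,
   identified with the kernel of S(F[eps]) -> S(F) through
   [gf_eps X] = 1 + eps X.  The bracket of [gf_lie] is not derived from the
   functor.  No point is taken over the zero algebra, which is not a comAlgType
   and over which every functor below is trivial. *)
Record groupFunctor (F : fieldType) := GroupFunctor {
  gf_pt :> comAlgType F -> groupType;
  gf_map : forall R R' : comAlgType F, {lrmorphism R -> R'} -> gf_pt R -> gf_pt R';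
  gf_mapM : forall (R R' : comAlgType F) (phi : {lrmorphism R -> R'}) g h,
    gf_map phi (g * h)%g = (gf_map phi g * gf_map phi h)%g;
  gf_map_id : forall (R : comAlgType F) (phi : {lrmorphism R -> R}) g,
    phi =1 id -> gf_map phi g = g;
  gf_map_comp : forall (R R' R'' : comAlgType F) (phi : {lrmorphism R -> R'})
      (psi : {lrmorphism R' -> R''}) (chi : {lrmorphism R -> R''}) g,
    chi =1 psi \o phi -> gf_map chi g = gf_map psi (gf_map phi g);
  gf_lie : lieAlgType F;
  gf_eps : gf_lie -> gf_pt (dual F);
  gf_eps_inj : injective gf_eps;
  gf_eps_ker : forall g, gf_map (@aug F) g = 1%g <-> exists X, g = gf_eps X
}.

Record gfHom (F : fieldType) (S S' : groupFunctor F) := GfHom {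
  gh_fun :> forall R : comAlgType F, S R -> S' R;
  gh_mul : forall (R : comAlgType F) (g h : S R),
    gh_fun (g * h)%g = (gh_fun g * gh_fun h)%g;
  gh_nat : forall (R R' : comAlgType F) (phi : {lrmorphism R -> R'}) (g : S R),
    gf_map phi (gh_fun g) = gh_fun (gf_map phi g)
}.

Lemma ord2P (i : 'I_2) : {i = ord0} + {i = ord_max}.
Proof. by case: i => [[|[|k]] p] //; [left | right]; apply/val_inj. Qed.

Lemma det2 (R : comNzRingType) (A : 'M[R]_2) :
  \det A = A ord0 ord0 * A ord_max ord_max - A ord0 ord_max * A ord_max ord0.
Proof.
rewrite (expand_det_row _ ord0) !big_ord_recl big_ord0 /cofactor !det_mx11 !mxE /=.
rewrite addr0 /bump /= expr0 expr1 mul1r mulN1r mulrN.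
by congr (A _ _ * A _ _ - A _ _ * A _ _); apply/val_inj.
Qed.
Lemma tr2 (R : nmodType) (A : 'M[R]_2) : \tr A = A ord0 ord0 + A ord_max ord_max.
Proof.
rewrite /mxtrace !big_ord_recl big_ord0 addr0.
by congr (_ + A _ _); apply/val_inj.
Qed.

Section SL2functor.
Variable F : fieldType.

Fact SL2_map_det (R R' : comAlgType F) (phi : {lrmorphism R -> R'}) (g : SL2 R) :
  \det (map_mx phi (SL2val g)) == 1.
Proof. by rewrite det_map_mx (eqP (SL2_det g)) rmorph1. Qed.
Definition SL2_map (R R' : comAlgType F) (phi : {lrmorphism R -> R'}) (g : SL2 R) :=
  MkSL2 (SL2_map_det phi g).

Definition SL2_eps_mx (X : sl2 F) : 'M[dual F]_2 :=
  1%:M + eps F *: map_mx (in_alg (dual F)) (sl2val X).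
Lemma SL2_eps_mxE1 (X : sl2 F) i j : (SL2_eps_mx X i j).1 = (i == j)%:R.
Proof.
rewrite !mxE /= mul0r; case: (i == j) => /=; last by rewrite mulr0n /= addr0.
by rewrite mulr1n /= addr0.
Qed.
Lemma SL2_eps_mxE2 (X : sl2 F) i j : (SL2_eps_mx X i j).2 = sl2val X i j.
Proof.
rewrite !mxE /= mul0r add0r mul1r [_ *: _]mulr1.
by case: (i == j); rewrite ?mulr1n ?mulr0n /= add0r.
Qed.
Lemma SL2_eps_mxP (X : sl2 F) (A : 'M[dual F]_2) :
  (forall i j, (A i j).1 = (i == j)%:R) -> (forall i j, (A i j).2 = sl2val X i j) ->
  A = SL2_eps_mx X.
Proof.
move=> h1 h2; apply/matrixP => i j; apply: dual_ext.
  by rewrite h1 SL2_eps_mxE1.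
by rewrite h2 SL2_eps_mxE2.
Qed.
Fact SL2_eps_det (X : sl2 F) : \det (SL2_eps_mx X) == 1.
Proof.
apply/eqP; rewrite det2; apply: dual_ext.
  by rewrite dual_sub1 !dmul1 !SL2_eps_mxE1 /= mul0r mul1r subr0.
rewrite dual_sub2 !dmul2 !SL2_eps_mxE1 !SL2_eps_mxE2 /= !mul0r mul1r !mulr0 mulr1.
by rewrite addr0 subr0; have := sl2_tr X; rewrite tr2 addrC.
Qed.
Definition SL2_eps (X : sl2 F) : SL2 (dual F) := MkSL2 (SL2_eps_det X).

Fact SL2_mapM (R R' : comAlgType F) (phi : {lrmorphism R -> R'}) (g h : SL2 R) :
  SL2_map phi (g * h)%g = (SL2_map phi g * SL2_map phi h)%g.
Proof. by apply: SL2P; rewrite /= map_mxM. Qed.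
Fact SL2_map_id (R : comAlgType F) (phi : {lrmorphism R -> R}) g :
  phi =1 id -> SL2_map phi g = g.
Proof. by move=> h; apply: SL2P; apply/matrixP => i j; rewrite !mxE h. Qed.
Fact SL2_map_comp (R R' R'' : comAlgType F) (phi : {lrmorphism R -> R'})
    (psi : {lrmorphism R' -> R''}) (chi : {lrmorphism R -> R''}) g :
  chi =1 psi \o phi -> SL2_map chi g = SL2_map psi (SL2_map phi g).
Proof. by move=> h; apply: SL2P; apply/matrixP => i j; rewrite !mxE h. Qed.
Fact SL2_eps_inj : injective SL2_eps.
Proof.
move=> X Y /(congr1 (@SL2val _)) e; apply: sl2P; apply/matrixP => i j.
by rewrite -!SL2_eps_mxE2; move: e => /= ->.
Qed.
Fact SL2_eps_ker g : SL2_map (@aug F) g = 1%g <-> exists X, g = SL2_eps X.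
Proof.
split=> [/(congr1 (@SL2val _)) e | [X ->]]; last first.
  by apply: SL2P; apply/matrixP => i j; rewrite [LHS]mxE [RHS]mxE; apply: SL2_eps_mxE1.
have g1 i j : (SL2val g i j).1 = (i == j)%:R.
  by have /matrixP/(_ i j) := e; rewrite !mxE.
have /eqP/(congr1 snd) := SL2_det g.
rewrite det2 dual_sub2 !dmul2 !g1 /= !mul0r mul1r !mulr0 mulr1 !addr0 subr0.
move=> trg.
have tX : (\matrix_(i, j) (SL2val g i j).2 : 'M[F]_2) \in traceless F.
  by rewrite inE tr2 !mxE addrC; apply/eqP.
exists (Sl2 tX); apply: SL2P; apply: SL2_eps_mxP => // i j; by rewrite /= mxE.
Qed.

Definition SL2f : groupFunctor F :=
  GroupFunctor SL2_mapM SL2_map_id SL2_map_comp SL2_eps_inj SL2_eps_ker.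
End SL2functor.

Section ProdFunctor.
Variables (F : fieldType) (S T : groupFunctor F).
Definition pf_pt (R : comAlgType F) : groupType := prodgrp (S R) (T R).
Definition pf_map (R R' : comAlgType F) (phi : {lrmorphism R -> R'}) (g : pf_pt R) :
  pf_pt R' := (gf_map phi g.1, gf_map phi g.2).
Definition pf_eps (X : gf_lie S * gf_lie T) : pf_pt (dual F) :=
  (gf_eps X.1, gf_eps X.2).
Fact pf_mapM (R R' : comAlgType F) (phi : {lrmorphism R -> R'}) g h :
  pf_map phi (g * h)%g = (pf_map phi g * pf_map phi h)%g.
Proof. by rewrite /pf_map /= !gf_mapM. Qed.
Fact pf_map_id (R : comAlgType F) (phi : {lrmorphism R -> R}) g :
  phi =1 id -> pf_map phi g = g.
Proof. by move=> h; case: g => x y; rewrite /pf_map /= !gf_map_id. Qed.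
Fact pf_map_comp (R R' R'' : comAlgType F) (phi : {lrmorphism R -> R'})
    (psi : {lrmorphism R' -> R''}) (chi : {lrmorphism R -> R''}) g :
  chi =1 psi \o phi -> pf_map chi g = pf_map psi (pf_map phi g).
Proof. by move=> h; rewrite /pf_map /= !(gf_map_comp _ h). Qed.
Fact pf_eps_inj : injective pf_eps.
Proof. by case=> [x y] [z t] [] /gf_eps_inj /= -> /gf_eps_inj /= ->. Qed.
Fact pf_eps_ker g : pf_map (@aug F) g = 1%g <-> exists X, g = pf_eps X.
Proof.
case: g => x y; split => [[] /gf_eps_ker [X ->] /gf_eps_ker [Y ->]|[[X Y]] [] -> ->].
  by exists (X, Y).
by congr pair; apply/gf_eps_ker; eexists.
Qed.
Definition prodf : groupFunctor F :=
  GroupFunctor pf_mapM pf_map_id pf_map_comp pf_eps_inj pf_eps_ker.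

Definition pr1f : gfHom prodf S :=
  @GfHom F prodf S (fun R g => g.1) (fun _ _ _ => erefl) (fun _ _ _ _ => erefl).
Definition pr2f : gfHom prodf T :=
  @GfHom F prodf T (fun R g => g.2) (fun _ _ _ => erefl) (fun _ _ _ _ => erefl).
End ProdFunctor.

Definition diagf (F : fieldType) (S : groupFunctor F) : gfHom S (prodf S S) :=
  @GfHom F S (prodf S S) (fun R g => (g, g)) (fun _ _ _ => erefl) (fun _ _ _ _ => erefl).

(* Homomorphisms S(R) -> GL_R(M_R), natural in R; bijectivity comes from the
   group laws. *)
Record rep (F : fieldType) (S : groupFunctor F) (M : lmodType F) := Rep {
  ract :> forall R : comAlgType F, S R -> bext M R -> bext M R;
  ract_lin : forall (R : comAlgType F) (g : S R), linear (ract g);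
  ract1 : forall (R : comAlgType F) (x : bext M R), ract (1%g : S R) x = x;
  ractM : forall (R : comAlgType F) (g h : S R) x,
    ract (g * h)%g x = ract g (ract h x);
  ract_nat : forall (R R' : comAlgType F) (phi : {lrmorphism R -> R'}) (g : S R) x,
    bmap phi (ract g x) = ract (gf_map phi g) (bmap phi x)
}.
Arguments ract {F S M} r {R} g x.

Definition rep_hom (F : fieldType) (S : groupFunctor F) (M N : lmodType F)
    (rho : rep S M) (sigma : rep S N) (f : M -> N) : Prop :=
  linear f /\ forall (R : comAlgType F) (g : S R) (x : bext M R),
    blin f (rho R g x) = sigma R g (blin f x).

Lemma ract_semi (F : fieldType) (S : groupFunctor F) (M : lmodType F) (rho : rep S M)
    (R : comAlgType F) (g : S R) : semilin (fun m => rho R g (bten m 1)).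
Proof. exact: (linear_semilin (ract_lin rho g)). Qed.

Section BuildRep.
Variables (F : fieldType) (S : groupFunctor F) (M : lmodType F).
Variable c : forall R : comAlgType F, S R -> M -> bext M R.
Hypothesis c_semi : forall (R : comAlgType F) (g : S R), semilin (c g).
Hypothesis c1 : forall (R : comAlgType F) m, c (1%g : S R) m = bten m 1.
Hypothesis cM : forall (R : comAlgType F) (g h : S R) m,
  c (g * h)%g m = blift (c g) (c h m).
Hypothesis c_nat : forall (R R' : comAlgType F) (phi : {lrmorphism R -> R'}) (g : S R) m,
  bmap phi (c g m) = c (gf_map phi g) m.

Definition bact (R : comAlgType F) (g : S R) : bext M R -> bext M R := blift (c g).
Fact bact_lin (R : comAlgType F) (g : S R) : linear (bact g).
Proof. exact: blift_linear. Qed.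
Fact bact1 (R : comAlgType F) (x : bext M R) : bact (1%g : S R) x = x.
Proof.
apply: (blift_ext (f := bact 1%g) (g := id)) x => //; first exact: bact_lin.
by move=> m; rewrite /bact blift_bten // c1 scale1r.
Qed.
Fact bactM (R : comAlgType F) (g h : S R) x : bact (g * h)%g x = bact g (bact h x).
Proof.
apply: (blift_ext (f := bact (g * h)%g) (g := bact g \o bact h)) x.
- exact: bact_lin.
- by move=> a x y; rewrite /= !bact_lin.
- by move=> m; rewrite /= /bact !blift_bten // !scale1r cM.
Qed.
Fact bact_nat (R R' : comAlgType F) (phi : {lrmorphism R -> R'}) (g : S R) x :
  bmap phi (bact g x) = bact (gf_map phi g) (bmap phi x).
Proof.
apply: (bext_ext (f := fun x => bmap phi (bact g x))
                 (g := fun x => bact (gf_map phi g) (bmap phi x))) x.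
- by move=> x y; rewrite (linD (bact_lin g)) bmapD.
- by move=> x y; rewrite bmapD (linD (bact_lin _)).
- by move=> m r; rewrite bmap_bten /bact !blift_bten // bmapZ c_nat.
Qed.
Definition build_rep : rep S M := Rep bact_lin bact1 bactM bact_nat.
End BuildRep.

Definition triv_rep (F : fieldType) (S : groupFunctor F) (M : lmodType F) : rep S M :=
  @Rep F S M (fun R g x => x) (fun _ _ _ _ _ => erefl) (fun _ _ => erefl)
    (fun _ _ _ _ => erefl) (fun _ _ _ _ _ => erefl).

Section Pull.
Variables (F : fieldType) (S S' : groupFunctor F) (h : gfHom S S') (M : lmodType F).
Variable rho : rep S' M.
Fact pull1 (R : comAlgType F) (x : bext M R) : rho R (h R 1%g) x = x.
Proof.
have -> : h R 1%g = 1%g; last exact: ract1.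
by apply: (mulgI (h R 1%g)); rewrite -gh_mul !mulg1.
Qed.
Fact pullM (R : comAlgType F) (g k : S R) x :
  rho R (h R (g * k)%g) x = rho R (h R g) (rho R (h R k) x).
Proof. by rewrite gh_mul ractM. Qed.
Fact pull_nat (R R' : comAlgType F) (phi : {lrmorphism R -> R'}) (g : S R) x :
  bmap phi (rho R (h R g) x) = rho R' (h R' (gf_map phi g)) (bmap phi x).
Proof. by rewrite ract_nat gh_nat. Qed.
Definition pull_rep : rep S M :=
  @Rep F S M (fun R g => rho R (h R g)) (fun R g => ract_lin rho (h R g))
    pull1 pullM pull_nat.
End Pull.

Section TensorRep.
Variables (F : fieldType) (S : groupFunctor F) (M N : lmodType F).
Variables (rho : rep S M) (sigma : rep S N).

(* g (m (x) n) = (g m) (x) (g n), under M_R (x)_R N_R = (M (x) N)_R. *)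
Definition tens_act (R : comAlgType F) (g : S R) (t : tensor M N) : bext (tensor M N) R :=
  tlift (fun m n => bbil (@tens F M N) (rho R g (bten m 1)) (sigma R g (bten n 1))
           : rsc (bext (tensor M N) R)) t.
Let tb := @tens_bilin F M N.
Fact tens_act_bilin (R : comAlgType F) (g : S R) :
  bilin (fun m n => bbil (@tens F M N) (rho R g (bten m 1)) (sigma R g (bten n 1))
           : rsc (bext (tensor M N) R)).
Proof.
split=> [n | m] a x y; rewrite rscZ ract_semi.
  by rewrite (bbil_linl tb).
by rewrite (bbil_linr tb).
Qed.
Fact tens_act_semi (R : comAlgType F) (g : S R) : semilin (tens_act g).
Proof. by move=> a x y; rewrite /tens_act (tlift_linear (tens_act_bilin g)) rscZ. Qed.
Lemma tens_actE (R : comAlgType F) (g : S R) m n :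
  tens_act g (tens m n) = bbil (@tens F M N) (rho R g (bten m 1)) (sigma R g (bten n 1)).
Proof. by rewrite /tens_act tlift_tens //; apply: tens_act_bilin. Qed.
Lemma tens_ext (R : comAlgType F) (f g : tensor M N -> bext (tensor M N) R) :
  semilin f -> semilin g -> (forall m n, f (tens m n) = g (tens m n)) -> f =1 g.
Proof.
by move=> fs gs; apply: tensor_ext => x y;
   [have := fs 1 x y | have := gs 1 x y]; rewrite !scale1r.
Qed.
Fact tens_act1 (R : comAlgType F) t : tens_act (1%g : S R) t = bten t 1.
Proof.
apply: (tens_ext (g := fun t => bten t 1)) t => [||m n]; first exact: tens_act_semi.
  by move=> a x y; rewrite btenDl btenZl scale_bten mulr1.
by rewrite tens_actE !ract1 bbil_bten ?mulr1.
Qed.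
Lemma tens_act_bbil (R : comAlgType F) (g : S R) x y :
  blift (tens_act g) (bbil (@tens F M N) x y)
  = bbil (@tens F M N) (rho R g x) (sigma R g y).
Proof.
have bl := blift_linear (tens_act_semi g).
apply: (blift_ext (f := fun x => blift (tens_act g) (bbil (@tens F M N) x y))
  (g := fun x => bbil (@tens F M N) (rho R g x) (sigma R g y))) x => [a x x'|a x x'|m].
- by rewrite (bbil_linl tb) bl.
- by rewrite ract_lin (bbil_linl tb).
apply: (blift_ext (f := fun y => blift (tens_act g) (bbil (@tens F M N) (bten m 1) y))
  (g := fun y => bbil (@tens F M N) (rho R g (bten m 1)) (sigma R g y))) y
  => [a y y'|a y y'|n].
- by rewrite (bbil_linr tb) bl.
- by rewrite ract_lin (bbil_linr tb).
rewrite (bbil_bten tb) mulr1 blift_bten ?scale1r ?tens_actE //.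
exact: tens_act_semi.
Qed.
Fact tens_actM (R : comAlgType F) (g h : S R) t :
  tens_act (g * h)%g t = blift (tens_act g) (tens_act h t).
Proof.
apply: (tens_ext (g := fun t => blift (tens_act g) (tens_act h t))) t => [||m n].
- exact: tens_act_semi.
- move=> a x y; rewrite tens_act_semi.
  by rewrite (blift_linear (tens_act_semi g)).
- by rewrite !tens_actE tens_act_bbil !ractM.
Qed.
Lemma bmap_bbil (R R' : comAlgType F) (phi : {lrmorphism R -> R'}) (x : bext M R)
    (y : bext N R) :
  bmap phi (bbil (@tens F M N) x y) = bbil (@tens F M N) (bmap phi x) (bmap phi y).
Proof.
apply: (bext_ext (f := fun x => bmap phi (bbil (@tens F M N) x y))
  (g := fun x => bbil (@tens F M N) (bmap phi x) (bmap phi y))) x => [x x'|x x'|m r].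
- by rewrite (linD (bbil_linl tb y)) bmapD.
- by rewrite bmapD (linD (bbil_linl tb _)).
apply: (bext_ext (f := fun y => bmap phi (bbil (@tens F M N) (bten m r) y))
  (g := fun y => bbil (@tens F M N) (bmap phi (bten m r)) (bmap phi y))) y
  => [y y'|y y'|n s].
- by rewrite (linD (bbil_linr tb _)) bmapD.
- by rewrite bmapD (linD (bbil_linr tb _)).
by rewrite (bbil_bten tb) !bmap_bten (bbil_bten tb) rmorphM.
Qed.
Fact tens_act_nat (R R' : comAlgType F) (phi : {lrmorphism R -> R'}) (g : S R) t :
  bmap phi (tens_act g t) = tens_act (gf_map phi g) t.
Proof.
have h0 (R1 : comAlgType F) (g1 : S R1) : {morph tens_act g1 : x y / x + y}.
  by move=> x y; have := tens_act_semi g1 1 x y; rewrite !scale1r.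
apply: (tensor_ext (f := fun t => bmap phi (tens_act g t)) (g := tens_act _)) t
  => [x y|x y|m n].
- by rewrite h0 bmapD.
- exact: h0.
- by rewrite !tens_actE bmap_bbil !ract_nat !bmap_bten rmorph1.
Qed.
Definition tens_rep : rep S (tensor M N) :=
  build_rep tens_act_semi tens_act1 tens_actM tens_act_nat.
End TensorRep.

Section StandardReps.
Variable F : fieldType.
Implicit Types R : comAlgType F.

Lemma lrmorph_in_alg R (R' : comAlgType F) (phi : {lrmorphism R -> R'}) a :
  phi (in_alg R a) = in_alg R' a.
Proof. by rewrite /= linearZ rmorph1. Qed.

Definition natmod : lmodType F := 'cV[F]_2.

(* The identification R^2 = V_R. *)
Definition natmod_of R (w : 'cV[R]_2) : bext natmod R :=
  \sum_(i < 2) bten (delta_mx i ord0 : natmod) (w i ord0).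
Definition natmod_ext R (v : natmod) : 'cV[R]_2 := map_mx (in_alg R) v.
Definition natmod_act R (g : SL2f F R) (v : natmod) : bext natmod R :=
  natmod_of (SL2val g *m natmod_ext R v).

Lemma natmod_of_lin R : linear (@natmod_of R).
Proof.
move=> a x y; rewrite /natmod_of scaler_sumr -big_split /=; apply: eq_bigr => i _.
by rewrite !mxE btenDr scale_bten.
Qed.
Lemma natmod_ext_semi R a x y :
  natmod_ext R (a *: x + y) = (a%:A : R) *: natmod_ext R x + natmod_ext R y.
Proof. by apply/matrixP => i j; rewrite !mxE rmorphD rmorphM. Qed.
Fact natmod_act_semi R (g : SL2f F R) : semilin (natmod_act g).
Proof.
move=> a x y.
by rewrite /natmod_act natmod_ext_semi mulmxDr -scalemxAr natmod_of_lin.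
Qed.
Lemma natmod_of_ext R v : natmod_of (natmod_ext R v) = bten v 1.
Proof.
rewrite [in RHS](matrix_sum_delta v) bten_suml; apply: eq_bigr => i _.
by rewrite big_ord1 mxE btenZl; congr (bten _ (v _ _ *: _)); apply/val_inj; case: (0 : 'I_1) => -[].
Qed.
Fact natmod_act1 R v : natmod_act (1%g : SL2f F R) v = bten v 1.
Proof. by rewrite /natmod_act mul1mx natmod_of_ext. Qed.
Lemma natmod_act_of R (g : SL2f F R) w :
  blift (natmod_act g) (natmod_of w) = natmod_of (SL2val g *m w).
Proof.
have bl := blift_linear (natmod_act_semi g).
rewrite /natmod_of (lin_sum bl) -/(natmod_of _).
transitivity (\sum_(i < 2) w i ord0 *: natmod_act g (delta_mx i ord0)).
  by apply: eq_bigr => i _; rewrite blift_bten //; apply: natmod_act_semi.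
rewrite /natmod_act.
transitivity (natmod_of (\sum_(i < 2) w i ord0 *: (SL2val g *m natmod_ext R (delta_mx i ord0)))).
  by rewrite (lin_sum (@natmod_of_lin R)); apply: eq_bigr => i _;
     rewrite (linZ (@natmod_of_lin R)).
congr natmod_of; rewrite [in RHS](matrix_sum_delta w) mulmx_sumr.
apply: eq_bigr => i _; rewrite big_ord1 -scalemxAr; congr (w _ _ *: (_ *m _)).
apply/matrixP => k l; rewrite !mxE /=.
by case: (_ && _); rewrite ?scale1r ?scale0r.
Qed.
Fact natmod_actM R (g h : SL2f F R) v :
  natmod_act (g * h)%g v = blift (natmod_act g) (natmod_act h v).
Proof. by rewrite natmod_act_of mulmxA. Qed.
Fact natmod_act_nat R (R' : comAlgType F) (phi : {lrmorphism R -> R'}) (g : SL2f F R) v :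
  bmap phi (natmod_act g v) = natmod_act (gf_map phi g) v.
Proof.
rewrite /natmod_act.
transitivity (natmod_of (map_mx phi (SL2val g *m natmod_ext R v))).
  rewrite /natmod_of (big_morph _ (bmapD phi) (id1 := 0)); last first.
    by apply: (addrI (bmap phi 0)); rewrite -bmapD !addr0.
  by apply: eq_bigr => i _; rewrite bmap_bten [in RHS]mxE.
congr natmod_of; rewrite map_mxM; congr (_ *m _).
by apply/matrixP => i j; rewrite !mxE; apply: lrmorph_in_alg.
Qed.
Definition nat_rep : rep (SL2f F) natmod :=
  build_rep natmod_act_semi natmod_act1 natmod_actM natmod_act_nat.

Fact sl2H_tr : (delta_mx ord0 ord0 - delta_mx ord_max ord_max : 'M[F]_2) \in traceless F.
Proof. by rewrite inE tr2 !mxE /= subr0 sub0r subrr. Qed.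
Fact sl2E_tr : (delta_mx ord0 ord_max : 'M[F]_2) \in traceless F.
Proof. by rewrite inE tr2 !mxE /= addr0. Qed.
Fact sl2F_tr : (delta_mx ord_max ord0 : 'M[F]_2) \in traceless F.
Proof. by rewrite inE tr2 !mxE /= addr0. Qed.
Definition sl2H : sl2 F := Sl2 sl2H_tr.
Definition sl2E : sl2 F := Sl2 sl2E_tr.
Definition sl2F : sl2 F := Sl2 sl2F_tr.

(* The element of sl_2 (x) R with matrix A, for a traceless A. *)
Definition sl2_of R (A : 'M[R]_2) : bext (sl2 F) R :=
  bten sl2H (A ord0 ord0) + bten sl2E (A ord0 ord_max) + bten sl2F (A ord_max ord0).
Definition sl2_ext R (f : sl2 F) : 'M[R]_2 := map_mx (in_alg R) (sl2val f).
Definition ad_act R (g : SL2f F R) (f : sl2 F) : bext (sl2 F) R :=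
  sl2_of (SL2val g *m sl2_ext R f *m SL2val g^-1%g).

Lemma sl2_of_lin R : linear (@sl2_of R).
Proof.
move=> a x y; rewrite /sl2_of !mxE !btenDr -!scale_bten !scalerDr.
by rewrite [_ + (a *: bten sl2E _ + _)]addrACA; apply: addrACA.
Qed.
Lemma sl2_ext_semi R a x y :
  sl2_ext R (a *: x + y) = (a%:A : R) *: sl2_ext R x + sl2_ext R y.
Proof.
by apply/matrixP => i j; rewrite /sl2_ext sl2val_linear !mxE rmorphD rmorphM.
Qed.
Fact ad_act_semi R (g : SL2f F R) : semilin (ad_act g).
Proof.
move=> a x y.
by rewrite /ad_act sl2_ext_semi mulmxDr mulmxDl -scalemxAr -scalemxAl sl2_of_lin.
Qed.
Lemma sl2_eta (f : sl2 F) :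
  f = f ord0 ord0 *: sl2H + f ord0 ord_max *: sl2E + f ord_max ord0 *: sl2F.
Proof.
apply: sl2P; rewrite !sl2valD !sl2valZ /=; apply/matrixP => i j.
have t : f ord_max ord_max = - f ord0 ord0.
  by apply/eqP; rewrite -addr_eq0 addrC -tr2 sl2_tr.
by case: (ord2P i) => ->; case: (ord2P j) => ->; rewrite !mxE /= ?t; ring.
Qed.
Lemma sl2_of_ext R f : sl2_of (sl2_ext R f) = bten f 1.
Proof. by rewrite [in RHS](sl2_eta f) !btenDl !btenZl /sl2_of !mxE. Qed.
Fact ad_act1 R f : ad_act (1%g : SL2f F R) f = bten f 1.
Proof. by rewrite /ad_act invg1 mul1mx mulmx1 sl2_of_ext. Qed.
Lemma ad_act_of R (g : SL2f F R) A : \tr A = 0 ->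
  blift (ad_act g) (sl2_of A) = sl2_of (SL2val g *m A *m SL2val g^-1%g).
Proof.
move=> tA; have bl := blift_linear (ad_act_semi g).
rewrite {1}/sl2_of !(linD bl) !(blift_bten _ _ (ad_act_semi g)).
rewrite /ad_act -!(linZ (@sl2_of_lin R)) -!(linD (@sl2_of_lin R)).
have e (r : R) X : r *: (SL2val g *m X *m SL2val g^-1%g)
    = SL2val g *m (r *: X) *m SL2val g^-1%g by rewrite -scalemxAr -scalemxAl.
congr sl2_of; rewrite !e -!mulmxDl -!mulmxDr.
congr (_ *m _ *m _).
have t : A ord_max ord_max = - A ord0 ord0.
  by apply/eqP; rewrite -addr_eq0 addrC -tr2 tA.
by apply/matrixP => i j; case: (ord2P i) => ->; case: (ord2P j) => ->;
   rewrite !mxE /= ?t ?subr0 ?sub0r ?scale0r ?scale1r ?scaleN1r; ring.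
Qed.
Fact ad_actM R (g h : SL2f F R) f :
  ad_act (g * h)%g f = blift (ad_act g) (ad_act h f).
Proof.
rewrite ad_act_of; first by rewrite /ad_act invgM /= !mulmxA.
rewrite mxtrace_mulC mulmxA SL2_adjM mul1mx.
have -> : \tr (sl2_ext R f) = in_alg R (\tr (sl2val f)) by rewrite !tr2 !mxE /= scalerDl.
by rewrite sl2_tr rmorph0.
Qed.
Fact ad_act_nat R (R' : comAlgType F) (phi : {lrmorphism R -> R'}) (g : SL2f F R) f :
  bmap phi (ad_act g f) = ad_act (gf_map phi g) f.
Proof.
rewrite /ad_act.
transitivity (sl2_of (map_mx phi (SL2val g *m sl2_ext R f *m SL2val g^-1%g))).
  by rewrite /sl2_of !bmapD !bmap_bten ![map_mx _ _ _ _]mxE.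
congr sl2_of; rewrite !map_mxM; congr (_ *m _ *m _); last by rewrite /= map_mx_adj.
by apply/matrixP => i j; rewrite !mxE; apply: lrmorph_in_alg.
Qed.
Definition ad_rep : rep (SL2f F) (sl2 F) :=
  build_rep ad_act_semi ad_act1 ad_actM ad_act_nat.
End StandardReps.

Section Submodules.
Variables (F : fieldType) (S : groupFunctor F) (N : lmodType F) (rho : rep S N).

Definition lspan (A : set N) : set N :=
  [set x | exists s : seq (F * N),
     (forall p, p \in s -> A p.2) /\ x = \sum_(p <- s) p.1 *: p.2].

(* W is the internal direct sum of the subspaces in the list As. *)
Definition is_dsum (As : seq (set N)) (W : set N) : Prop :=
  W = [set x | exists2 a : 'I_(size As) -> N,
         (forall i : 'I_(size As), nth set0 As i (a i)) & x = \sum_i a i]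
  /\ forall a b : 'I_(size As) -> N,
       (forall i : 'I_(size As), nth set0 As i (a i)) -> (forall i : 'I_(size As), nth set0 As i (b i)) ->
       \sum_i a i = \sum_i b i -> a =1 b.

Definition fixed : set N :=
  [set x | forall (R : comAlgType F) (g : S R), rho R g (bten x 1) = bten x 1].

(* W is a submodule isomorphic to M. *)
Definition is_copy (M : lmodType F) (sigma : rep S M) (W : set N) : Prop :=
  exists f : M -> N, [/\ rep_hom sigma rho f, injective f & W = range f].

Definition isotypic (M : lmodType F) (sigma : rep S M) : set N :=
  lspan [set x | exists2 W, is_copy sigma W & W x].

(* rho is a direct sum of copies of the modules (M k); the copies are the
   ranges of the maps (f i). *)
Definition sum_of_copies (K : Type) (M : K -> lmodType F)
    (sigma : forall k, rep S (M k)) : Prop :=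
  exists (I : choiceType) (k : I -> K) (f : forall i, M (k i) -> N),
    [/\ forall i, rep_hom (sigma (k i)) rho (f i),
        forall x, exists (s : seq I) (m : forall i, M (k i)),
          x = \sum_(i <- s) f i (m i)
      & forall (s : seq I) (m : forall i, M (k i)), uniq s ->
          \sum_(i <- s) f i (m i) = 0 -> forall i, i \in s -> m i = 0].
End Submodules.

Definition blie (F : fieldType) (L : lieAlgType F) (R : comAlgType F) :
  bext L R -> bext L R -> bext L R := bbil (@lie F L).

Record sstruct (F : fieldType) (S : groupFunctor F) (L : lieAlgType F) := SStruct {
  ss_rep :> rep S L;
  ss_lie : forall (R : comAlgType F) (g : S R) x y,
    ss_rep R g (blie x y) = blie (ss_rep R g x) (ss_rep R g y)
}.

Definition ss_pull (F : fieldType) (S S' : groupFunctor F) (h : gfHom S S')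
    (L : lieAlgType F) (Phi : sstruct S' L) : sstruct S L :=
  @SStruct F S L (pull_rep h Phi) (fun R g => ss_lie Phi (h R g)).

(* The action of 1 + eps X is 1 + eps (d X). *)
Definition is_differential (F : fieldType) (S : groupFunctor F) (M : lmodType F)
    (rho : rep S M) (d : gf_lie S -> M -> M) : Prop :=
  forall X m, rho (dual F) (gf_eps X) (bten m 1) = bten m 1 + bten (d X m) (eps F).

Definition inner_by (F : fieldType) (S : groupFunctor F) (L : lieAlgType F)
    (Phi : sstruct S L) (iota : gf_lie S -> L) : Prop :=
  [/\ lie_hom iota, injective iota & is_differential Phi (fun X => lie (iota X))].

Definition is_inner (F : fieldType) (S : groupFunctor F) (L : lieAlgType F)
    (Phi : sstruct S L) : Prop := exists iota, inner_by Phi iota.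

Section ShortSL2SL2.
Variable F : fieldType.
Definition SL2SL2f : groupFunctor F := prodf (SL2f F) (SL2f F).
Definition fst_rep (M : lmodType F) (rho : rep (SL2f F) M) : rep SL2SL2f M :=
  pull_rep (pr1f (SL2f F) (SL2f F)) rho.
Definition snd_rep (M : lmodType F) (rho : rep (SL2f F) M) : rep SL2SL2f M :=
  pull_rep (pr2f (SL2f F) (SL2f F)) rho.

(* The indices 1 and 0 stand for the first and the second factor. *)
Definition ad1_rep := fst_rep (ad_rep F).
Definition ad0_rep := snd_rep (ad_rep F).
Definition nat1_rep := fst_rep (nat_rep F).
Definition nat0_rep := snd_rep (nat_rep F).
Definition nat10_rep := tens_rep nat1_rep nat0_rep.

Inductive short_kind := Ad1 | Ad0 | Nat1 | Nat0 | Nat10 | Triv.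
Definition short_mod (k : short_kind) : lmodType F :=
  match k with
  | Ad1 | Ad0 => sl2 F
  | Nat1 | Nat0 => natmod F
  | Nat10 => tensor (natmod F) (natmod F)
  | Triv => F^o
  end.
Definition short_rep (k : short_kind) : rep SL2SL2f (short_mod k) :=
  match k with
  | Ad1 => ad1_rep
  | Ad0 => ad0_rep
  | Nat1 => nat1_rep
  | Nat0 => nat0_rep
  | Nat10 => nat10_rep
  | Triv => triv_rep SL2SL2f F^o
  end.

Definition is_short (L : lieAlgType F) (Phi : sstruct SL2SL2f L) : Prop :=
  sum_of_copies Phi short_rep.
End ShortSL2SL2.

(* L = (sl(V) (x) J) (+) (V (x) T) (+) D as a module for SL_2. *)
Record isotypic_dec (F : fieldType) (L : lieAlgType F) (Psi : sstruct (SL2f F) L)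
    (J T D : lmodType F) := IsotypicDec {
  id_J : tensor (sl2 F) J -> L;
  id_T : tensor (natmod F) T -> L;
  id_D : D -> L;
  id_J_hom : rep_hom (tens_rep (ad_rep F) (triv_rep (SL2f F) J)) Psi id_J;
  id_T_hom : rep_hom (tens_rep (nat_rep F) (triv_rep (SL2f F) T)) Psi id_T;
  id_D_hom : rep_hom (triv_rep (SL2f F) D) Psi id_D;
  id_bij : bijective (fun p : tensor (sl2 F) J * tensor (natmod F) T * D =>
                        id_J p.1.1 + id_T p.1.2 + id_D p.2)
}.

Section Elements.
Variables (F : fieldType) (L : lieAlgType F) (Psi : sstruct (SL2f F) L).
Variables (J T D : lmodType F) (dec : isotypic_dec Psi J T D).
Definition elJ (f : sl2 F) (a : J) : L := id_J dec (tens f a).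
Definition elT (u : natmod F) (x : T) : L := id_T dec (tens u x).
(* sl(V) (x) a, sl(V) (x) A, V (x) x and V (x) B as subspaces of L. *)
Definition slx (a : J) : set L := range (elJ^~ a).
Definition slA (A : set J) : set L := lspan [set elJ f a | f in setT & a in A].
Definition Vx (x : T) : set L := range (elT^~ x).
Definition VA (B : set T) : set L := lspan [set elT u x | u in setT & x in B].
End Elements.

Record skew_form (F : fieldType) := SkewForm {
  sf :> natmod F -> natmod F -> F;
  sf_bilin : bilin (sf : natmod F -> natmod F -> F^o);
  sf_skew : forall u v, sf u v = - sf v u;
  sf_neq0 : exists u v, sf u v != 0
}.

Section Gamma.
Variables (F : fieldType) (beta : skew_form F).
Let bl := sf_bilin beta.
Definition gamma_fun (u v w : natmod F) : natmod F := beta u w *: v + beta v w *: u.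
Definition gamma_mx (u v : natmod F) : 'M[F]_2 :=
  \matrix_(i, j) gamma_fun u v (delta_mx j ord0) i ord0.
Lemma natmod_eta (w : natmod F) :
  w = \sum_(j < 2) w j ord0 *: (delta_mx j ord0 : natmod F).
Proof. by rewrite [LHS](matrix_sum_delta w); apply: eq_bigr => i _; rewrite big_ord1. Qed.
Lemma sf_sumr (u w : natmod F) :
  beta u w = \sum_(j < 2) w j ord0 * beta u (delta_mx j ord0).
Proof.
rewrite [in LHS](natmod_eta w) (lin_sum (bl.2 u)).
by apply: eq_bigr => j _; rewrite (linZ (bl.2 u)).
Qed.
Fact gamma_tr u v : gamma_mx u v \in traceless F.
Proof.
rewrite inE /mxtrace.
have -> : \sum_i gamma_mx u v i i = beta u v + beta v u.
  rewrite (sf_sumr u v) (sf_sumr v u) -big_split; apply: eq_bigr => i _.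
  by rewrite mxE /gamma_fun !mxE /= mulrC [_ * u _ _]mulrC.
by rewrite sf_skew addNr eqxx.
Qed.
Definition gamma (u v : natmod F) : sl2 F := Sl2 (gamma_tr u v).
Lemma gammaE u v w : sl2val (gamma u v) *m w = gamma_fun u v w.
Proof.
apply/matrixP => i k; rewrite [k]ord1 !mxE (sf_sumr u w) (sf_sumr v w).
rewrite !mulr_suml -big_split; apply: eq_bigr => j _ /=.
by rewrite mxE /gamma_fun !mxE mulrDl mulrAC [w _ _ * _]mulrC [X in _ + X = _]mulrAC
  [w _ _ * _]mulrC.
Qed.
End Gamma.

Record jordan_alg (F : fieldType) (J : lmodType F) := JordanAlg {
  jmul : J -> J -> J;
  jone : J;
  jmul_bilin : bilin jmul;
  jmulC : commutative jmul;
  jmul1 : left_id jone jmul;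
  jmul_jordan : forall a b, jmul (jmul a b) (jmul a a) = jmul a (jmul b (jmul a a))
}.

(* The operations a . b, a * x (bullet), <x | y> and (x, y, z) of a J-ternary
   algebra are [jmul], [jact], [jt_form] and [jt_prod]; [jordan_mod] is the
   notion of special unital module. *)
Record jordan_mod (F : fieldType) (J T : lmodType F) (A : jordan_alg J) := JordanMod {
  jact : J -> T -> T;
  jact_bilin : bilin jact;
  jact1 : forall x, jact (jone A) x = x;
  jactM : forall a b x,
    jact (jmul A a b) x = 2^-1 *: (jact a (jact b x) + jact b (jact a x))
}.

Record jternary (F : fieldType) (J T : lmodType F) := JTernary {
  jt_alg :> jordan_alg J;
  jt_mod : jordan_mod T jt_alg;
  jt_form : T -> T -> J;
  jt_prod : T -> T -> T -> T;
  jt_form_bilin : bilin jt_form;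
  jt_form_skew : forall x y, jt_form x y = - jt_form y x;
  jt_prod_lin1 : forall y z, linear (fun x => jt_prod x y z);
  jt_prod_lin2 : forall x z, linear (fun y => jt_prod x y z);
  jt_prod_lin3 : forall x y, linear (fun z => jt_prod x y z);
  jt1 : forall a x y, jmul jt_alg a (jt_form x y) =
    2^-1 *: (jt_form (jact jt_mod a x) y + jt_form x (jact jt_mod a y));
  jt2 : forall a x y z, jact jt_mod a (jt_prod x y z) =
    jt_prod (jact jt_mod a x) y z - jt_prod x (jact jt_mod a y) z
    + jt_prod x y (jact jt_mod a z);
  jt3 : forall x y z, jt_prod x y z = jt_prod z y x - jact jt_mod (jt_form x z) y;
  jt4 : forall x y z, jt_prod x y z = jt_prod y x z + jact jt_mod (jt_form x y) z;
  jt5 : forall x y z w, jt_form (jt_prod x y z) w + jt_form z (jt_prod x y w) =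
    jt_form x (jact jt_mod (jt_form z w) y);
  jt6 : forall x y z w v, jt_prod x y (jt_prod z w v) =
    jt_prod (jt_prod x y z) w v + jt_prod z (jt_prod y x w) v
    + jt_prod z w (jt_prod x y v)
}.

(* The J-ternary algebra co_jt coordinatizes Psi; iota f = f (x) 1 ties its unity
   to the homomorphism iota making Psi inner. *)
Record coordinatization (F : fieldType) (beta : skew_form F) (L : lieAlgType F)
    (Psi : sstruct (SL2f F) L) (iota : sl2 F -> L) (J T D : lmodType F)
    (dec : isotypic_dec Psi J T D) := Coordinatization {
  co_jt :> jternary J T;
  co_D : J -> J -> D;
  co_d : T -> T -> D;
  co_DJ : D -> J -> J;
  co_DT : D -> T -> T;
  co_D_bilin : bilin co_D;
  co_D_skew : forall a b, co_D a b = - co_D b a;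
  co_d_bilin : bilin co_d;
  co_d_sym : forall x y, co_d x y = co_d y x;
  co_DJ_bilin : bilin co_DJ;
  co_DT_bilin : bilin co_DT;
  co_lieJJ : forall f g a b, lie (elJ dec f a) (elJ dec g b) =
    elJ dec (lie f g) (jmul co_jt a b)
    + (2 * \tr (sl2val f *m sl2val g)) *: id_D dec (co_D a b);
  co_lieJT : forall f u a x, lie (elJ dec f a) (elT dec u x) =
    elT dec (sl2val f *m u) (jact (jt_mod co_jt) a x);
  co_lieTT : forall u v x y, lie (elT dec u x) (elT dec v y) =
    elJ dec (gamma beta u v) (jt_form co_jt x y) + beta u v *: id_D dec (co_d x y);
  co_lieDJ : forall d f a, lie (id_D dec d) (elJ dec f a) = elJ dec f (co_DJ d a);
  co_lieDT : forall d u x, lie (id_D dec d) (elT dec u x) = elT dec u (co_DT d x);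
  co_unit : forall f, iota f = elJ dec f (jone co_jt);
  co_prod : forall x y z, jt_prod co_jt x y z =
    2^-1 *: (- co_DT (co_d x y) z + jact (jt_mod co_jt) (jt_form co_jt x y) z)
}.

Section Peirce.
Variables (F : fieldType) (J T : lmodType F) (A : jternary J T) (e : J).
Definition peirceJ1 : set J := [set a | jmul A e a = a].
Definition peirceJh : set J := [set a | jmul A e a = 2^-1 *: a].
Definition peirceJ0 : set J := [set a | jmul A e a = 0].
Definition peirceT1 : set T := [set x | jact (jt_mod A) e x = x].
Definition peirceT0 : set T := [set x | jact (jt_mod A) e x = 0].
End Peirce.

(* Main.v *)
From HB Require Import structures.
Require Import Defs.
From mathcomp Require Import all_boot all_algebra ring.
From mathcomp Require Import boolp classical_sets.

Set Implicit Arguments.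
Unset Strict Implicit.
Unset Printing Implicit Defensive.

Import GRing.Theory.
Local Open Scope classical_set_scope.
Local Open Scope ring_scope.

(** Why the theorem holds.

    The algebra behind both parts comes out of the Jacobi identity for [E (x) a],
    [F (x) b] and [H (x) c]: it gives [D_{a,b}(c) = a.(b.c) - b.(a.c)] and
    [D_{a.b,c} = D_{a,b.c} + D_{b,a.c}] ([jacobi_EFH]).  For an idempotent [e] this yields
    [D_{e,a} = 2 D_{e,e.a}].  So [D_{e,a}] vanishes for [a] in [J1] or [J0], and evaluation
    at [e] gives the Peirce decomposition ([peirce_cubic]) and [4 D_{e,a}(e) = - a] for [a]
    in [Jh] ([DDe_e]).

    For the first part, [iota (E, 0)] has weight 2 for [iota (H, H) = H (x) 1].  In
    characteristic other than 2 and 3 the vectors of weight 2 are those of the form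
    [E (x) e] ([weight_two]).  Bracketing with the diagonal copy gives
    [iota (f, 0) = f (x) e] for all [f], and then [iota (0, f) = f (x) (1 - e)], and the
    bracket of [iota (E, 0)] and [iota (F, 0)] shows that [e] is idempotent ([iota_split]).

    For the second part, let [theta a X] be the traceless part of the matrix [X] tensor
    [a], plus [2 tr X] times [D_{e,a}].  The bracket with [f (x) e] sends [theta a X] to
    [theta a (f X - X f)] if [a] is in [J1], to [theta a (f X)] if [a] is in [Jh], to [0] if
    [a] is in [J0]; it sends [u (x) x] to [f u (x) x] if [x] is in [T1], to [0] if [x] is in
    [T0]; and it kills the [d] in [D] with [d(e) = 0].  These vectors span [L]
    ([generators_sum]).  So [g] in SL2 should act by [g X g^-1], [g X] and [g u]
    ([idem_rep]).  The actions attached to [e] and [1 - e] commute and make up [Phi]; on the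
    diagonal they conjugate [X] in all [theta a X], as [Psi] does ([Psi_Phi]).

    The crux is that [g] acts by Lie automorphisms for [g] in SL2(R), over every R.  The
    exponentials of [ad (E (x) e)] and [ad (F (x) e)] do: these derivations have cube zero
    and 2 and 3 are invertible ([texp_similitude]).  Elementary matrices do not generate
    SL2(R), but [g] is a product of them once the corner entry [a] of [g] is invertible.
    Clearing the denominators in this factorization shows that a power of [a] kills the
    failure of [g] to be an automorphism ([defect_torsion]).  The same holds for the other
    entry [c] of the first column, and [a] and [c] are coprime, so the failure is zero
    ([defect_eq0]).

    The decomposition of [L] is then read off the generators: there are six kinds of
    modules, each with a subspace of parameters ([kin], [kmap]), and a basis of each
    parameter space, which exists by Zorn's lemma, decomposes [L] into irreducible modules
    ([Phi_short]).  That no other copies occur is a matter of weights.  Over the dual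
    numbers, a homomorphism into [L] is seen to commute with [f (x) e] and [f (x) (1 - e)],
    and nonzero weights of [H (x) e] and [H (x) (1 - e)] determine the kind ([ksq_inj]).
    The vectors of weight zero are handled by brackets with [E] and [F] ([hom_comp],
    [fixedE]). *)

(** * Direct sums and bases *)

(** Complementary projections [p i] give both the existence and the uniqueness of the
    components. *)
Lemma is_dsum_proj (F : fieldType) (N : lmodType F) (As : seq (set N)) (W : set N)
    (p : 'I_(size As) -> N -> N) :
  (forall i, linear (p i)) ->
  (forall (i : 'I_(size As)) x, W x -> nth set0 As i (p i x)) ->
  (forall x, W x -> x = \sum_i p i x) ->
  (forall a : 'I_(size As) -> N, (forall i : 'I_(size As), nth set0 As i (a i)) -> W (\sum_i a i)) ->
  (forall (i j : 'I_(size As)) x, nth set0 As j x -> p i x = if i == j then x else 0) ->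
  is_dsum As W.
Proof.
move=> pl pA ps sW pd.
have pa a : (forall i : 'I_(size As), nth set0 As i (a i)) -> forall i, p i (\sum_i a i) = a i.
  move=> aA i; rewrite (lin_sum (pl i)) (bigD1 i) //= (pd i i) // eqxx big1 ?addr0 //.
  by move=> j ji; rewrite (pd i j) // eq_sym (negPf ji).
split=> [|a b aA bA ab i]; last by rewrite -(pa a) // ab pa.
apply/seteqP; split=> [x Wx | _ [a aA ->]]; last exact: sW.
by exists (p^~ x) => [i|]; [exact: pA | exact: ps].
Qed.

Section Span.
Variables (F : fieldType) (N : lmodType F).
Implicit Types A B : set N.

Lemma lspan_lin A (W : set N) : A `<=` W -> W 0 ->
  (forall c x y, W x -> W y -> W (c *: x + y)) -> lspan A `<=` W.
Proof.
move=> AW W0 Wl _ [s [sA ->]]; elim: s sA => [|p s IH] sA; first by rewrite big_nil.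
rewrite big_cons; apply: Wl; first by apply/AW/sA; rewrite mem_head.
by apply: IH => q qs; apply: sA; rewrite in_cons qs orbT.
Qed.

Lemma lspan0 A : lspan A 0.
Proof. by exists [::]; rewrite big_nil. Qed.

Lemma lspan_sub A x : A x -> lspan A x.
Proof.
by move=> Ax; exists [:: (1, x)]; rewrite big_seq1 scale1r; split=> // p /[!inE] /eqP ->.
Qed.

Lemma lspanP A c x y : lspan A x -> lspan A y -> lspan A (c *: x + y).
Proof.
move=> [s [sA ->]] [t [tA ->]]; exists ([seq (c * p.1, p.2) | p <- s] ++ t); split.
  by move=> p; rewrite mem_cat => /orP[/mapP[q qs ->]|/tA //]; apply: sA qs.
rewrite big_cat big_map scaler_sumr; congr (_ + _).
by apply: eq_bigr => q _; rewrite scalerA.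
Qed.

Lemma lspan_sum A (I : Type) (r : seq I) (E : I -> N) :
  (forall i, lspan A (E i)) -> lspan A (\sum_(i <- r) E i).
Proof.
move=> h; elim: r => [|i r IH]; rewrite ?big_nil ?big_cons; first exact: lspan0.
by rewrite -[E i]scale1r; apply: lspanP.
Qed.

Definition lin_indep B : Prop := forall (s : seq N) (c : N -> F), uniq s ->
  (forall b, b \in s -> B b) -> \sum_(b <- s) c b *: b = 0 -> forall b, b \in s -> c b = 0.

(** Zorn's lemma gives a maximal independent subset of [A], and it spans [A]. *)
Lemma exists_basis A : exists B, [/\ B `<=` A, lin_indep B & A `<=` lspan B].
Proof.
pose P B := B `<=` A /\ lin_indep B.
have [| B [[BA Bi] Bm]] := @Zorn_bigcup _ P.
  move=> C CP tC; split=> [x [B /CP [BA _]] | s c us sC s0]; first exact: BA.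
  suff [E [EP sE]] : exists E, P E /\ forall b, b \in s -> E b.
    by case: EP => _ /(_ s c us sE s0).
  (* A finite list lies in one member of the chain, or in the empty set. *)
  have [E [EC sE]] : exists E, (E = set0 \/ C E) /\ forall b, b \in s -> E b.
    elim: s sC {us s0} => [|b s IH] sC; first by exists set0; split; [left|].
    have [|E [EC sE]] := IH; first by move=> x xs; apply: sC; rewrite in_cons xs orbT.
    have [B CB Bb] := sC b (mem_head _ _).
    have [EB | BE] : E `<=` B \/ B `<=` E.
      by case: EC => [-> | EC]; [left | exact: tC].
      exists B; split; [by right|] => x; rewrite in_cons => /predU1P[-> //|/sE]; exact: EB.
    exists E; split=> // x; rewrite in_cons => /predU1P[->|/sE //]; exact: BE.
  exists E; split=> //; case: EC => [->|/CP //]; split=> // s' c' _ h _ b /h //.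
exists B; split=> // a Aa; apply: contrapT => nB.
have aB : ~ B a by move=> Ba; apply/nB/lspan_sub.
have /Bm : B `<` B `|` [set a].
  by split=> [x|BaB]; [left | apply/aB/BaB; right].
(* If [a] is not spanned by [B] then adding it to [B] preserves independence. *)
apply; split=> [x [/BA //|-> //] | s c us sB s0 b bs].
have [as_|as_] := boolP (a \in s); last first.
  apply: (Bi s c) => // x xs; case: (sB x xs) => // xa.
  by move: as_; rewrite -xa xs.
have ca : c a = 0.
  apply: contrapT => /eqP ca; apply: nB.
  move: s0; rewrite (bigD1_seq a) //= => /eqP; rewrite addr_eq0 => /eqP s0.
  have -> : a = \sum_(i <- s | i != a) (- (c a)^-1 * c i) *: i.
    rewrite -[LHS]scale1r -(mulVf ca) -scalerA s0 scalerN -scaleNr scaler_sumr.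
    by apply: eq_bigr => i _; rewrite scalerA.
  exists [seq (- (c a)^-1 * c i, i) | i <- s & i != a]; split.
    move=> p /mapP[i]; rewrite mem_filter => /andP[ia /sB [Bi' -> //|/= ia']].
    by rewrite ia' eqxx in ia.
  by rewrite big_map big_filter.
have [-> //|ba] := eqVneq b a.
apply: (Bi [seq i <- s | i != a] c); rewrite ?filter_uniq ?mem_filter ?ba //.
  by move=> x; rewrite mem_filter => /andP[xa /sB [//|/= e]]; rewrite e eqxx in xa.
by move: s0; rewrite (bigD1_seq a) //= ca scale0r add0r big_filter.
Qed.
End Span.

(** * Base change of maps out of matrix spaces *)

Section MatrixExtension.
Variables (F : fieldType) (R : comAlgType F).

Definition mxR m n (X : 'M[F]_(m, n)) : 'M[R]_(m, n) := map_mx (in_alg R) X.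

Lemma mxR_delta m n (i : 'I_m) (j : 'I_n) : mxR (delta_mx i j) = delta_mx i j.
Proof.
by apply/matrixP => k l; rewrite !mxE; case: (_ && _); rewrite /= ?scale1r ?scale0r.
Qed.

Lemma mxRD m n (X Y : 'M[F]_(m, n)) : mxR (X + Y) = mxR X + mxR Y.
Proof. exact: map_mxD. Qed.

Lemma mxRZ m n c (X : 'M[F]_(m, n)) : mxR (c *: X) = c%:A *: mxR X.
Proof. exact: map_mxZ. Qed.

Lemma mxRM m n p (X : 'M[F]_(m, n)) (Y : 'M[F]_(n, p)) : mxR (X *m Y) = mxR X *m mxR Y.
Proof. exact: map_mxM. Qed.

Lemma mxR_scalar n c : mxR (c%:M : 'M[F]_n) = (c%:A)%:M.
Proof. exact: map_scalar_mx. Qed.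

(** The R-linear extension of [B], when matrices over R are seen as the base change
    of the space of matrices over F. *)
Definition mext m n (L : lmodType F) (B : 'M[F]_(m, n) -> L) (A : 'M[R]_(m, n)) : bext L R :=
  \sum_i \sum_j bten (B (delta_mx i j)) (A i j).

Variables (m n : nat) (L : lmodType F).
Implicit Types (B : 'M[F]_(m, n) -> L) (A : 'M[R]_(m, n)).

Lemma mext_lin B : linear (mext B).
Proof.
move=> r A A'; rewrite /mext scaler_sumr -big_split; apply: eq_bigr => i _ /=.
rewrite scaler_sumr -big_split; apply: eq_bigr => j _ /=.
by rewrite !mxE btenDr scale_bten.
Qed.

Lemma eq_mext B B' A : B =1 B' -> mext B A = mext B' A.
Proof. by move=> /funext ->. Qed.

Lemma mext_mxR B X : linear B -> mext B (mxR X) = bten (B X) 1.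
Proof.
move=> Bl; rewrite [in RHS](matrix_sum_delta X) (lin_sum Bl) bten_suml.
apply: eq_bigr => i _; rewrite (lin_sum Bl) bten_suml; apply: eq_bigr => j _.
by rewrite (linZ Bl) btenZl mxE.
Qed.

(** The vectors [B X (x) 1] span the image of [mext B] over R, so that the effect of an
    operator on [mext B] can be computed on them. *)
Lemma mext_morph m' n' (M : lmodType F) (B : 'M[F]_(m', n') -> M) B'
    (Xi : bext M R -> bext L R) (T : 'M[R]_(m', n') -> 'M[R]_(m, n)) :
  linear B -> linear Xi -> linear T ->
  (forall X, Xi (bten (B X) 1) = mext B' (T (mxR X))) ->
  forall A : 'M[R]_(m', n'), Xi (mext B A) = mext B' (T A).
Proof.
move=> Bl Xl Tl h A; rewrite [in RHS](matrix_sum_delta A) [mext B A]/mext (lin_sum Xl).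
rewrite (lin_sum Tl) (lin_sum (mext_lin B')); apply: eq_bigr => i _.
rewrite (lin_sum Xl) (lin_sum Tl) (lin_sum (mext_lin B')); apply: eq_bigr => j _.
by rewrite (linZ Tl) (linZ (mext_lin B')) -mxR_delta -h -(linZ Xl) scale_bten mulr1.
Qed.

Lemma mext_fixed B A (Xi : bext L R -> bext L R) : linear Xi ->
  (forall X, Xi (bten (B X) 1) = bten (B X) 1) -> Xi (mext B A) = mext B A.
Proof.
move=> Xl h; rewrite /mext (lin_sum Xl); apply: eq_bigr => i _.
rewrite (lin_sum Xl); apply: eq_bigr => j _.
by rewrite -[A i j]mulr1 -scale_bten (linZ Xl) h.
Qed.

Lemma mext_semi (M : lmodType F) (B : M -> 'M[F]_(m, n) -> L) A :
  (forall X, linear (B^~ X)) -> semilin (fun a => mext (B a) A).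
Proof.
move=> Bl c a b; rewrite /mext scaler_sumr -big_split; apply: eq_bigr => i _ /=.
rewrite scaler_sumr -big_split; apply: eq_bigr => j _ /=.
by rewrite Bl btenDl btenZl scale_bten mulr_algl.
Qed.

Lemma semiD (M : lmodType F) (f g : M -> bext L R) :
  semilin f -> semilin g -> semilin (fun a => f a + g a).
Proof. by move=> fs gs c a b; rewrite fs gs scalerDr addrACA. Qed.

Lemma semi_sum (M : lmodType F) (I : Type) (r : seq I) (f : I -> M -> bext L R) :
  (forall i, semilin (f i)) -> semilin (fun a => \sum_(i <- r) f i a).
Proof.
move=> fs c a b; rewrite scaler_sumr -big_split; apply: eq_bigr => i _; exact: fs.
Qed.

Lemma semi_comp (M N : lmodType F) (h : M -> N) (f : N -> bext L R) :
  linear h -> semilin f -> semilin (fun a => f (h a)).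
Proof. by move=> hl fs c a b; rewrite hl fs. Qed.

Lemma semi_bten (M : lmodType F) : semilin (fun a : M => bten a 1 : bext M R).
Proof. by move=> c a b; rewrite btenDl btenZl scale_bten mulr1. Qed.

End MatrixExtension.

Lemma bmap_mext (F : fieldType) (R R' : comAlgType F) (phi : {lrmorphism R -> R'}) m n
    (L : lmodType F) (B : 'M[F]_(m, n) -> L) (A : 'M[R]_(m, n)) :
  bmap phi (mext B A) = mext B (map_mx phi A).
Proof.
have b0 : bmap phi (0 : bext L R) = 0.
  by apply: (addrI (bmap phi 0)); rewrite -bmapD !addr0.
rewrite (big_morph _ (bmapD phi) b0); apply: eq_bigr => i _.
rewrite (big_morph _ (bmapD phi) b0); apply: eq_bigr => j _.
by rewrite bmap_bten mxE.
Qed.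

Lemma blin_mext (F : fieldType) (R : comAlgType F) m n (L M : lmodType F)
    (B : 'M[F]_(m, n) -> L) (h : L -> M) (A : 'M[R]_(m, n)) :
  linear h -> blin h (mext B A) = mext (h \o B) A.
Proof.
move=> hl; have bl := blift_linear (blin_semilin R hl).
rewrite /blin (lin_sum bl); apply: eq_bigr => i _; rewrite (lin_sum bl).
by apply: eq_bigr => j _; apply: blin_bten.
Qed.

Lemma map_mxR (F : fieldType) (R R' : comAlgType F) (phi : {lrmorphism R -> R'}) m n
    (X : 'M[F]_(m, n)) : map_mx phi (mxR R X) = mxR R' X.
Proof. by apply/matrixP => i j; rewrite !mxE; apply: lrmorph_in_alg. Qed.

Lemma blin_lin (F : fieldType) (M N : lmodType F) (R : comAlgType F) (f : M -> N) :
  linear f -> linear (@blin F M N f R).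
Proof. by move=> fl; apply/blift_linear/blin_semilin. Qed.

Lemma blieE (F : fieldType) (L : lieAlgType F) (R : comAlgType F) (x y : L) (r s : R) :
  blie (bten x r) (bten y s) = bten (lie x y) (r * s).
Proof. exact/bbil_bten/lie_bilin. Qed.

Lemma blie_linl (F : fieldType) (L : lieAlgType F) (R : comAlgType F) (y : bext L R) :
  linear (fun x => blie x y).
Proof. exact/bbil_linl/lie_bilin. Qed.

Lemma blie_linr (F : fieldType) (L : lieAlgType F) (R : comAlgType F) (x : bext L R) :
  linear (fun y => blie x y).
Proof. exact/bbil_linr/lie_bilin. Qed.

(** * Exponentials of derivations of cube zero *)

Section Similitudes.
Variables (F : fieldType) (L : lieAlgType F) (R : comAlgType F).
Implicit Types (Xi : bext L R -> bext L R) (k : R).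

(** Maps that preserve the bracket up to the factor [k]: they allow denominators
    to be cleared instead of inverted. *)
Definition similitude Xi k : Prop :=
  forall x y, blie (Xi x) (Xi y) = k *: Xi (blie x y).

Lemma similitude_comp Xi Xi' k k' : linear Xi ->
  similitude Xi k -> similitude Xi' k' -> similitude (Xi \o Xi') (k * k').
Proof. by move=> Xl h h' x y; rewrite /= h h' (linZ Xl) scalerA. Qed.

Lemma similitude_bten Xi k : linear Xi ->
  (forall x y, blie (Xi (bten x 1)) (Xi (bten y 1)) = k *: Xi (bten (lie x y) 1)) ->
  similitude Xi k.
Proof.
move=> Xl h x y.
apply: (blift_ext (f := fun x => blie (Xi x) (Xi y)) (g := fun x => k *: Xi (blie x y))).
- by move=> c u v; rewrite Xl (blie_linl (Xi y)).
- by move=> c u v; rewrite (blie_linl y) Xl scalerDr !scalerA mulrC.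
move=> m.
apply: (blift_ext (f := fun y => blie (Xi (bten m 1)) (Xi y))
                  (g := fun y => k *: Xi (blie (bten m 1) y))).
- by move=> c u v; rewrite Xl (blie_linr (Xi _)).
- by move=> c u v; rewrite (blie_linr (bten m 1)) Xl scalerDr !scalerA mulrC.
by move=> n; rewrite h blieE mulr1.
Qed.
End Similitudes.

Section TruncatedExponential.
Variables (F : fieldType) (L : lieAlgType F) (R : comAlgType F) (d : L -> L).
Hypotheses (F2 : (2%:R : F) != 0) (F3 : (3%:R : F) != 0).
Hypothesis dl : linear d.
Hypothesis dder : forall x y, d (lie x y) = lie (d x) y + lie x (d y).
Hypothesis d3 : forall x, d (d (d x)) = 0.

(** [q^2 exp ((p/q) d)], a polynomial in [p] and [q] since [d^3 = 0]. *)
Definition texp (p q : R) : bext L R -> bext L R := blift (fun x =>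
  bten x (q ^+ 2) + bten (d x) (p * q) + bten (d (d x)) (2^-1 *: p ^+ 2)).

Lemma texp_semi (p q : R) : semilin (fun x =>
  bten x (q ^+ 2) + bten (d x) (p * q) + bten (d (d x)) (2^-1 *: p ^+ 2)).
Proof.
do ?apply: semiD; move=> c x y; rewrite ?dl ?(linD dl) btenDl btenZl scale_bten mulr_algl //.
Qed.

Lemma texp_lin (p q : R) : linear (texp p q).
Proof. exact/blift_linear/texp_semi. Qed.

Lemma texpE (p q : R) x : texp p q (bten x 1) =
  bten x (q ^+ 2) + bten (d x) (p * q) + bten (d (d x)) (2^-1 *: p ^+ 2).
Proof. by rewrite /texp blift_bten ?scale1r //; apply: texp_semi. Qed.

(** The bracket of two exponentials has terms of degree 3 and 4 in [p].  They
    vanish since [d^3] and [d^4] of a bracket are [3] and [6] times them. *)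
Lemma texp_similitude (p q : R) : similitude (texp p q) (q ^+ 2).
Proof.
have ll (x : L) : linear (fun y => lie y x) := (@lie_bilin _ L).1 x.
have lr (x : L) : linear (lie x) := (@lie_bilin _ L).2 x.
have d0 : d 0 = 0 := lin0 dl.
apply: similitude_bten => [|x y]; first exact: texp_lin.
have deg3 : lie (d (d x)) (d y) + lie (d x) (d (d y)) = 0.
  apply: (scalerI F3); rewrite scaler0 -(d3 (lie x y)) !(dder, linD dl) !d3.
  rewrite (lin0 (ll y)) (lin0 (lr x)) add0r addr0.
  have -> : (3%:R : F) = 1 + 1 + 1 by ring.
  rewrite !scalerDl !scale1r.
  set u := lie (d (d x)) (d y); set v := lie (d x) (d (d y)).
  by rewrite !addrA [RHS](ACl (1*3*2*5*4*6)).
have deg4 : lie (d (d x)) (d (d y)) = 0.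
  apply: (scalerI F2); rewrite scaler0 -[2%:R]/(1 + 1 : F) scalerDl scale1r.
  rewrite -d0 -deg3 (linD dl) !dder !d3.
  by rewrite (lin0 (ll _)) (lin0 (lr _)) add0r addr0.
have deg2 : d (d (lie x y)) =
    lie (d (d x)) y + 2%:R *: lie (d x) (d y) + lie x (d (d y)).
  by rewrite !(dder, linD dl) -[2%:R]/(1 + 1 : F) scalerDl scale1r !addrA.
rewrite !texpE !(linD (blie_linl _), linD (blie_linr _)) !blieE.
rewrite deg2 dder !(scalerDr, btenDl, btenZl) !scale_bten deg4 bten0l addr0.
have -> : bten (lie (d (d x)) (d y)) (2^-1 *: p ^+ 2 * (p * q)) =
    - bten (lie (d x) (d (d y))) (p * q * (2^-1 *: p ^+ 2)) :> bext L R.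
  by apply/eqP; rewrite -addr_eq0 [2^-1 *: _ * _]mulrC -btenDl deg3 bten0l.
have -> : q ^+ 2 * (2%:R *: (2^-1 *: p ^+ 2)) = p * q * (p * q) :> R.
  by rewrite scalerA mulfV // scale1r; ring.
rewrite [p * q * q ^+ 2]mulrC ![2^-1 *: _ * _]mulrC.
by rewrite !addrA [LHS](ACl (1*4*2*7*5*3*6*8)) /= addrK.
Qed.
End TruncatedExponential.

(** * Two by two matrices *)

Section TwoByTwo.

Lemma mx2P (R : Type) n (A B : 'M[R]_(2, n)) :
  (forall j, A ord0 j = B ord0 j) -> (forall j, A ord_max j = B ord_max j) -> A = B.
Proof. by move=> h0 h1; apply/matrixP => i j; case: (ord2P i) => ->. Qed.

Lemma mx22P (R : Type) (A B : 'M[R]_2) :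
  A ord0 ord0 = B ord0 ord0 -> A ord0 ord_max = B ord0 ord_max ->
  A ord_max ord0 = B ord_max ord0 -> A ord_max ord_max = B ord_max ord_max -> A = B.
Proof. by move=> *; apply: mx2P => j; case: (ord2P j) => ->. Qed.

Lemma sum2 (V : nmodType) (E : 'I_2 -> V) : \sum_i E i = E ord0 + E ord_max.
Proof. by rewrite !big_ord_recl big_ord0 addr0; congr (_ + E _); apply/val_inj. Qed.

Variable R : comNzRingType.
Implicit Types A B : 'M[R]_2.

Lemma adj2 A : \adj A = (\tr A)%:M - A.
Proof.
apply/matrixP => i j; rewrite !mxE /cofactor det_mx11 !mxE tr2.
by case: (ord2P i) => ->; case: (ord2P j) => ->; rewrite /= ?mulr1n ?mulr0n ?expr0 ?expr1;
  rewrite ?mul1r ?mulN1r ?add0r ?addrK ?[_ + A ord_max _]addrC ?addrK ?expr2 ?mulrN1 ?opprK ?mul1r;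
  do 2?congr (- _); congr (A _ _); apply/val_inj.
Qed.

Lemma adj2_lin : linear (fun A => \adj A).
Proof.
move=> c A B; rewrite !adj2 linearP raddfD /= -scale_scalar_mx scalerBr opprD.
by rewrite addrACA.
Qed.

Lemma adj2M A B : \adj (A *m B) = \adj B *m \adj A.
Proof. 
rewrite !adj2 !tr2; apply: mx22P; rewrite !mxE !sum2 !mxE /= ?mulr1n ?mulr0n; ring.
Qed.

Lemma adj2K A : \adj (\adj A) = A.
Proof.
rewrite adj2; have -> : \tr (\adj A) = \tr A.
  by rewrite adj2 raddfB /= mxtrace_scalar mulr2n addrK.
by rewrite adj2 subKr.
Qed.
End TwoByTwo.

(** * Differentials of representations *)

(** The coefficient of [eps] is a linear function on the base change to the dual
    numbers. *)
Lemma bten_dual_inj (F : fieldType) (M : lmodType F) (x x' y y' : M) :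
  bten x 1 + bten y (eps F) = bten x' 1 + bten y' (eps F) -> y = y'.
Proof.
have b : bilin (fun (m : M) (r : dual F) => r.2 *: m).
  split=> [r | m] c u v; first by rewrite scalerDr !scalerA mulrC.
  by rewrite scalerDl scalerA.
move=> /(congr1 (tlift (fun (m : M) (r : dual F) => r.2 *: m))).
by rewrite !(linD (tlift_linear b)) !tlift_tens //= !scale0r !scale1r !add0r.
Qed.

Section Differentials.
Variable F : fieldType.

(** The derivative of the action at a single vector: [1 + eps X] sends [m] to
    [m + eps m']. *)
Definition has_diff (S : groupFunctor F) (M : lmodType F) (rho : rep S M)
    (X : gf_lie S) (m m' : M) : Prop :=
  rho (dual F) (gf_eps X) (bten m 1) = bten m 1 + bten m' (eps F).

Lemma rep_hom_diff (S : groupFunctor F) (M N : lmodType F) (rho : rep S M)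
    (sigma : rep S N) (f : M -> N) X m m' n' : rep_hom rho sigma f ->
  has_diff rho X m m' -> has_diff sigma X (f m) n' -> f m' = n'.
Proof.
move=> [fl fh] hm; rewrite /has_diff -blin_bten // -fh hm.
by rewrite (linD (blin_lin fl)) !blin_bten // => /bten_dual_inj.
Qed.

Lemma nat_diff (X : sl2 F) (v : natmod F) : has_diff (nat_rep F) X v (sl2val X *m v).
Proof.
rewrite /has_diff /= /bact blift_bten; last exact: natmod_act_semi.
rewrite scale1r /natmod_act /= /SL2_eps_mx mulmxDl mul1mx -scalemxAl.
rewrite (linD (@natmod_of_lin _ _)) natmod_of_ext (linZ (@natmod_of_lin _ _)).
by rewrite -[_ *m _](map_mxM (in_alg (dual F))) natmod_of_ext scale_bten mulr1.
Qed.

Lemma adj_eps (X : sl2 F) :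
  \adj (SL2_eps_mx X) = 1%:M - eps F *: map_mx (in_alg (dual F)) (sl2val X).
Proof.
rewrite /SL2_eps_mx; set Y := map_mx _ _.
have trY : \tr (1%:M + eps F *: Y) = 2%:R.
  have -> : Y = mxR (dual F) (sl2val X) by [].
  rewrite mxtraceD mxtrace1 mxtraceZ /mxR /mxtrace.
  under [X in _ * X]eq_bigr do rewrite mxE.
  by rewrite -rmorph_sum -/(mxtrace _) sl2_tr rmorph0 mulr0 addr0.
by rewrite adj2 trY raddfMn /= mulr2n opprD addrA addrK.
Qed.

Lemma ad_diff (X f : sl2 F) : has_diff (ad_rep F) X f (lie X f).
Proof.
rewrite /has_diff /= /bact blift_bten; last exact: ad_act_semi.
rewrite scale1r /ad_act /= adj_eps /SL2_eps_mx; set Y := map_mx _ (sl2val X); set f' := sl2_ext _ f.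
rewrite mulmxBr !mulmxDl mulmx1 mul1mx -!scalemxAl -!scalemxAr scalerA eps2 scale0r addr0.
rewrite -addrA -scalerBr (linD (@sl2_of_lin _ _)) sl2_of_ext (linZ (@sl2_of_lin _ _)).
have -> : Y *m f' *m 1%:M - f' *m Y = sl2_ext (dual F) (lie X f).
  by rewrite mulmx1 /sl2_ext sl2_lieE map_mxB !map_mxM.
by rewrite sl2_of_ext scale_bten mulr1.
Qed.

Lemma pull1_diff (S T : groupFunctor F) (M : lmodType F) (rho : rep S M) X m m' :
  has_diff rho X.1 m m' -> has_diff (pull_rep (pr1f S T) rho) X m m'.
Proof. by []. Qed.

Lemma pull2_diff (S T : groupFunctor F) (M : lmodType F) (rho : rep T M) X m m' :
  has_diff rho X.2 m m' -> has_diff (pull_rep (pr2f S T) rho) X m m'.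
Proof. by []. Qed.

End Differentials.

(** * Identities in modules *)

(** The ring [F (+) V] in which [V] has square zero: there a linear identity between
    vectors is an identity between elements of a commutative ring. *)
Definition trivext (F : comNzRingType) (V : lmodType F) : Type := (F^o * V)%type.

Section TrivialExtension.
Variables (F : comNzRingType) (V : lmodType F).
HB.instance Definition _ := GRing.Lmodule.copy (trivext V) (F^o * V)%type.
Definition te_mul (x y : trivext V) : trivext V := (x.1 * y.1, x.1 *: y.2 + y.1 *: x.2).
Fact te_mulA : associative te_mul.
Proof.
case=> [a u] [b v] [c w]; rewrite /te_mul /=; congr pair; first exact: mulrA.
by rewrite !scalerDr !scalerA addrA [c * a]mulrC [c * b]mulrC.
Qed.
Fact te_mulC : commutative te_mul.
Proof. by case=> [a u] [b v]; rewrite /te_mul /= mulrC addrC. Qed.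
Fact te_mul1 : left_id ((1, 0) : trivext V) te_mul.
Proof. by case=> a u; rewrite /te_mul /= mul1r scale1r scaler0 addr0. Qed.
Fact te_mulD : left_distributive te_mul +%R.
Proof.
case=> [a u] [b v] [c w]; rewrite /te_mul /=; congr pair; first exact: mulrDl.
by rewrite /= scalerDl scalerDr addrACA.
Qed.
Fact te_10 : (1, 0) != 0 :> trivext V.
Proof. by apply/eqP => -[/eqP]; rewrite oner_eq0. Qed.
HB.instance Definition _ := GRing.Zmodule_isComNzRing.Build (trivext V)
  te_mulA te_mulC te_mul1 te_mulD te_10.

Definition te_vec (u : V) : trivext V := (0, u).
Definition te_scal (a : F) : trivext V := (a, 0).
Lemma te_inj u v : te_vec u = te_vec v -> u = v.
Proof. by case. Qed.
Lemma te_vecD u v : te_vec (u + v) = te_vec u + te_vec v.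
Proof. by congr pair; rewrite /= addr0. Qed.
Lemma te_vecN u : te_vec (- u) = - te_vec u.
Proof. by congr pair; rewrite /= oppr0. Qed.
Lemma te_vec0 : te_vec 0 = 0.
Proof. by []. Qed.
Lemma te_vecZ a u : te_vec (a *: u) = te_scal a * te_vec u.
Proof. by congr pair; rewrite /= ?mulr0 // scale0r addr0. Qed.
Lemma te_vecMn u n : te_vec (u *+ n) = te_vec u *+ n.
Proof. by elim: n => // n IH; rewrite !mulrS te_vecD IH. Qed.
Fact te_scal_zmod : zmod_morphism te_scal.
Proof. by move=> a b; congr pair; rewrite /= subr0. Qed.
Fact te_scal_monoid : monoid_morphism te_scal.
Proof. by split=> // a b; congr pair; rewrite /= !scaler0 addr0. Qed.
HB.instance Definition _ := GRing.isZmodMorphism.Build F (trivext V) te_scal te_scal_zmod.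
HB.instance Definition _ := GRing.isMonoidMorphism.Build F (trivext V) te_scal te_scal_monoid.
End TrivialExtension.

Ltac module :=
  apply: te_inj; rewrite ?(te_vecD, te_vecN, te_vecZ, te_vecMn, te_vec0); ring.

Lemma eq_from_lin (F : fieldType) (V : lmodType F) (k : F) (l r l' r' : V) :
  l' = r' -> k != 0 -> k *: (l - r) = l' - r' -> l = r.
Proof.
move=> -> k0; rewrite subrr => e; apply/eqP; rewrite -subr_eq0.
by apply/eqP/(scalerI k0); rewrite e scaler0.
Qed.

Lemma eq_from_mul (F : fieldType) (V : lmodType F) (k : F) (l r l' r' : V) :
  l' = r' -> l - r = k *: (l' - r') -> l = r.
Proof. by move=> ->; rewrite subrr scaler0 => /eqP; rewrite subr_eq0 => /eqP. Qed.

(** * Coordinates on a coordinatized Lie algebra *)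

Section Matrices.
Variables (F : fieldType) (F2 : (2%:R : F) != 0).

Lemma halfD (x : F) : (2^-1 * x) *+ 2 = x.
Proof. by rewrite -mulr_natl mulrA mulfV // mul1r. Qed.

Fact dev_tr (X : 'M[F]_2) : X - (2^-1 * \tr X)%:M \in traceless F.
Proof.
by rewrite inE raddfB /= mxtrace_scalar halfD subrr.
Qed.
(** The deviator: the traceless part of [X]. *)
Definition dev X : sl2 F := Sl2 (dev_tr X).

Lemma dev_lin : linear dev.
Proof.
move=> c X Y; apply: sl2P; rewrite sl2valD sl2valZ /=; apply/matrixP => i j.
by rewrite raddfD /= mxtraceZ !mxE; case: (i == j); rewrite /= ?mulr1n ?mulr0n; ring.
Qed.

Lemma dev_sl2 (f : sl2 F) : dev (sl2val f) = f.
Proof. by apply: sl2P; rewrite /= sl2_tr mulr0 raddf0 subr0. Qed.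

Lemma dev_scalar c : dev c%:M = 0.
Proof.
apply: sl2P; rewrite /= mxtrace_scalar.
by rewrite mulrnAr halfD subrr.
Qed.

Lemma devE (X : 'M[F]_2) : X = sl2val (dev X) + (2^-1 * \tr X)%:M.
Proof. by rewrite /= subrK. Qed.

Lemma sl2_dev_sum (f : sl2 F) : f = \sum_i \sum_j sl2val f i j *: dev (delta_mx i j).
Proof.
rewrite -[LHS]dev_sl2 {1}[sl2val f]matrix_sum_delta (lin_sum dev_lin).
by apply: eq_bigr => i _; rewrite (lin_sum dev_lin); apply: eq_bigr => j _; rewrite (linZ dev_lin).
Qed.
End Matrices.

Lemma subr1N_neq0 (F : fieldType) : (2%:R : F) != 0 -> (1 - -1 : F) != 0.
Proof. by rewrite opprK. Qed.
Lemma subrN1_neq0 (F : fieldType) : (2%:R : F) != 0 -> (-1 - 1 : F) != 0.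
Proof. by rewrite -opprD oppr_eq0. Qed.

Section Coordinates.
Variables (F : fieldType) (L : lieAlgType F) (Psi : sstruct (SL2f F) L).
Variables (J T D : lmodType F) (dec : isotypic_dec Psi J T D).

Definition assemble (p : tensor (sl2 F) J * tensor (natmod F) T * D) : L :=
  id_J dec p.1.1 + id_T dec p.1.2 + id_D dec p.2.

Lemma id_J_lin : linear (id_J dec). Proof. exact: (id_J_hom dec).1. Qed.
Lemma id_T_lin : linear (id_T dec). Proof. exact: (id_T_hom dec).1. Qed.
Lemma id_D_lin : linear (id_D dec). Proof. exact: (id_D_hom dec).1. Qed.

Lemma assemble_lin : linear assemble.
Proof.
move=> c x y; rewrite /assemble /= id_J_lin id_T_lin id_D_lin.
by rewrite !scalerDr [RHS]addrACA; congr (_ + _); rewrite addrACA.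
Qed.

Lemma assemble_surj x : exists p, assemble p = x.
Proof. by case: (id_bij dec) => g _ gK; exists (g x); apply: gK. Qed.

Lemma assemble_inj : injective assemble.
Proof. exact: bij_inj (id_bij dec). Qed.

Definition parts (x : L) := sval (cid (assemble_surj x)).

Lemma partsK x : assemble (parts x) = x.
Proof. by rewrite /parts; case: cid. Qed.

Lemma parts_lin : linear parts.
Proof. by move=> c x y; apply: assemble_inj; rewrite assemble_lin !partsK. Qed.

Lemma parts_assemble p : parts (assemble p) = p.
Proof. by apply: assemble_inj; rewrite partsK. Qed.

(** The [J]-part of [x] is a traceless matrix with entries [cJ i j x] in [J], the
    [T]-part a column with entries [cT i x] in [T]. *)
Definition cJ i j (x : L) : J := tlift (fun (f : sl2 F) a => sl2val f i j *: a) (parts x).1.1.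
Definition cT i (x : L) : T := tlift (fun (u : natmod F) y => u i ord0 *: y) (parts x).1.2.
Definition cD (x : L) : D := (parts x).2.

Lemma cJ_bilin i j : bilin (fun (f : sl2 F) (a : J) => sl2val f i j *: a).
Proof.
split=> [a | f] c x y; last by rewrite scalerDr !scalerA mulrC.
by rewrite sl2valD sl2valZ !mxE scalerDl scalerA.
Qed.

Lemma cT_bilin i : bilin (fun (u : natmod F) (y : T) => u i ord0 *: y).
Proof.
split=> [a | f] c x y; last by rewrite scalerDr !scalerA mulrC.
by rewrite !mxE scalerDl scalerA.
Qed.

Lemma cJ_lin i j : linear (cJ i j).
Proof. by move=> c x y; rewrite /cJ parts_lin (tlift_linear (cJ_bilin i j)). Qed.
Lemma cT_lin i : linear (cT i).
Proof. by move=> c x y; rewrite /cT parts_lin (tlift_linear (cT_bilin i)). Qed.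
Lemma cD_lin : linear cD.
Proof. by move=> c x y; rewrite /cD parts_lin. Qed.

Lemma elJ_bilin : bilin (elJ dec).
Proof. by split=> z c x y; rewrite /elJ -id_J_lin; congr id_J; apply: (tens_bilin _ _).1 || apply: (tens_bilin _ _).2. Qed.
Lemma elT_bilin : bilin (elT dec).
Proof. by split=> z c x y; rewrite /elT -id_T_lin; congr id_T; apply: (tens_bilin _ _).1 || apply: (tens_bilin _ _).2. Qed.

Lemma parts_elJ f a : parts (elJ dec f a) = (tens f a, 0, 0).
Proof.
rewrite -[RHS]parts_assemble /assemble /= (lin0 id_T_lin) (lin0 id_D_lin).
by rewrite !addr0.
Qed.
Lemma parts_elT u x : parts (elT dec u x) = (0, tens u x, 0).
Proof.
rewrite -[RHS]parts_assemble /assemble /= (lin0 id_J_lin) (lin0 id_D_lin).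
by rewrite add0r !addr0.
Qed.
Lemma parts_D d : parts (id_D dec d) = (0, 0, d).
Proof.
rewrite -[RHS]parts_assemble /assemble /= (lin0 id_J_lin) (lin0 id_T_lin).
by rewrite !add0r.
Qed.

Lemma cJ_elJ i j f a : cJ i j (elJ dec f a) = sl2val f i j *: a.
Proof. by rewrite /cJ parts_elJ tlift_tens //; apply: cJ_bilin. Qed.
Lemma cJ_elT i j u x : cJ i j (elT dec u x) = 0.
Proof. by rewrite /cJ parts_elT (lin0 (tlift_linear (cJ_bilin i j))). Qed.
Lemma cJ_D i j d : cJ i j (id_D dec d) = 0.
Proof. by rewrite /cJ parts_D (lin0 (tlift_linear (cJ_bilin i j))). Qed.
Lemma cT_elJ i f a : cT i (elJ dec f a) = 0.
Proof. by rewrite /cT parts_elJ (lin0 (tlift_linear (cT_bilin i))). Qed.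
Lemma cT_elT i u x : cT i (elT dec u x) = u i ord0 *: x.
Proof. by rewrite /cT parts_elT tlift_tens //; apply: cT_bilin. Qed.
Lemma cT_D i d : cT i (id_D dec d) = 0.
Proof. by rewrite /cT parts_D (lin0 (tlift_linear (cT_bilin i))). Qed.
Lemma cD_elJ f a : cD (elJ dec f a) = 0.
Proof. by rewrite /cD parts_elJ. Qed.
Lemma cD_elT u x : cD (elT dec u x) = 0.
Proof. by rewrite /cD parts_elT. Qed.
Lemma cD_D d : cD (id_D dec d) = d.
Proof. by rewrite /cD parts_D. Qed.

Lemma coordinates_sum (F2 : (2%:R : F) != 0) x :
  x = \sum_i \sum_j elJ dec (dev F2 (delta_mx i j)) (cJ i j x)
      + \sum_i elT dec (delta_mx i ord0 : natmod F) (cT i x) + id_D dec (cD x).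
Proof.
rewrite -{1}(partsK x) /assemble; congr (_ + _ + _).
  rewrite /cJ; have [s ->] := tensor_sum (parts x).1.1.
  rewrite (lin_sum id_J_lin).
  transitivity (\sum_(p <- s) \sum_i \sum_j elJ dec (dev F2 (delta_mx i j)) (sl2val p.1 i j *: p.2)).
    apply: eq_bigr => p _; rewrite -/(elJ dec p.1 p.2) {1}(sl2_dev_sum F2 p.1).
    rewrite (lin_sum (elJ_bilin.1 _)); apply: eq_bigr => i _.
    rewrite (lin_sum (elJ_bilin.1 _)); apply: eq_bigr => j _.
    by rewrite (linZ (elJ_bilin.1 _)) (linZ (elJ_bilin.2 _)).
  rewrite exchange_big; apply: eq_bigr => i _ /=.
  rewrite exchange_big; apply: eq_bigr => j _ /=.
  rewrite (lin_sum (tlift_linear (cJ_bilin i j))) (lin_sum (elJ_bilin.2 _)).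
  by apply: eq_bigr => p _; rewrite tlift_tens //; apply: cJ_bilin.
rewrite /cT; have [s ->] := tensor_sum (parts x).1.2.
rewrite (lin_sum id_T_lin).
transitivity (\sum_(p <- s) \sum_i elT dec (delta_mx i ord0 : natmod F) (p.1 i ord0 *: p.2)).
  apply: eq_bigr => p _; rewrite -/(elT dec p.1 p.2) {1}(natmod_eta p.1).
  rewrite (lin_sum (elT_bilin.1 _)); apply: eq_bigr => i _.
  by rewrite (linZ (elT_bilin.1 _)) (linZ (elT_bilin.2 _)).
rewrite exchange_big; apply: eq_bigr => i _ /=.
rewrite (lin_sum (tlift_linear (cT_bilin i))) (lin_sum (elT_bilin.2 _)).
by apply: eq_bigr => p _; rewrite tlift_tens //; apply: cT_bilin.
Qed.
End Coordinates.

(** * Consequences of the Jacobi identity *)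

Section LieFacts.
Variables (F : fieldType) (L : lieAlgType F).

Lemma lie_linl (y : L) : linear (fun x => lie x y). Proof. exact: (@lie_bilin _ L).1. Qed.
Lemma lie_linr (x : L) : linear (lie x). Proof. exact: (@lie_bilin _ L).2. Qed.

Lemma lieC (x y : L) : lie x y = - lie y x.
Proof.
apply/eqP; rewrite -addr_eq0; apply/eqP.
have := liexx (x + y); rewrite (linD (lie_linl _)) !(linD (lie_linr _)) !liexx.
by rewrite add0r addr0.
Qed.

Lemma lie_der (x y z : L) : lie x (lie y z) = lie (lie x y) z + lie y (lie x z).
Proof.
have /eqP := jacobi x y z; rewrite -addrA addr_eq0 => /eqP ->.
by rewrite [lie (lie x y) z]lieC [lie x z]lieC (linN (lie_linr y)) opprD addrC.
Qed.
End LieFacts.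

Section Sl2Facts.
Variable F : fieldType.
Local Notation E := (sl2E F). Local Notation H := (sl2H F). Local Notation Y := (sl2F F).

Ltac sl2_compute := rewrite ?sl2valZ; apply: mx22P; rewrite !mxE !sum2 !mxE /=; ring.

Lemma lie_EF : lie E Y = H. Proof. apply: sl2P; rewrite sl2_lieE; sl2_compute. Qed.
Lemma lie_HE : lie H E = 2%:R *: E. Proof. apply: sl2P; rewrite sl2_lieE; sl2_compute. Qed.
Lemma lie_FH : lie Y H = 2%:R *: Y. Proof. apply: sl2P; rewrite sl2_lieE; sl2_compute. Qed.
Lemma lie_EH : lie E H = - 2%:R *: E. Proof. by rewrite lieC lie_HE scaleNr. Qed.

Lemma trM2 (R : nzRingType) (A B : 'M[R]_2) : \tr (A *m B) =
  A ord0 ord0 * B ord0 ord0 + A ord0 ord_max * B ord_max ord0 +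
  (A ord_max ord0 * B ord0 ord_max + A ord_max ord_max * B ord_max ord_max).
Proof. by rewrite tr2 !mxE !sum2. Qed.

Lemma tr_EF : \tr (sl2val E *m sl2val Y) = 1. Proof. rewrite trM2 !mxE /=; ring. Qed.
Lemma tr_EH : \tr (sl2val E *m sl2val H) = 0. Proof. rewrite trM2 !mxE /=; ring. Qed.
Lemma tr_FH : \tr (sl2val Y *m sl2val H) = 0. Proof. rewrite trM2 !mxE /=; ring. Qed.
Lemma tr_HH : \tr (sl2val H *m sl2val H) = 2%:R. Proof. rewrite trM2 !mxE /=; ring. Qed.
End Sl2Facts.

Section JordanFacts.
Variables (F : fieldType) (F2 : (2%:R : F) != 0) (beta : skew_form F).
Variables (L : lieAlgType F) (Psi : sstruct (SL2f F) L) (iota : sl2 F -> L).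
Variables (J T D : lmodType F) (dec : isotypic_dec Psi J T D).
Variable JT : coordinatization beta iota dec.
Local Notation jm := (jmul JT).
Local Notation act := (jact (jt_mod JT)).
Local Notation DD := (co_D JT).
Local Notation DJ := (co_DJ JT).
Local Notation E := (sl2E F). Local Notation H := (sl2H F). Local Notation Y := (sl2F F).

Lemma jm_linl b : linear (fun a => jm a b). Proof. exact: (jmul_bilin JT).1. Qed.
Lemma jm_linr a : linear (jm a). Proof. exact: (jmul_bilin JT).2. Qed.
Lemma DD_linl b : linear (fun a => DD a b). Proof. exact: (co_D_bilin JT).1. Qed.
Lemma DD_linr a : linear (DD a). Proof. exact: (co_D_bilin JT).2. Qed.
Lemma DJ_linl b : linear (fun a => DJ a b). Proof. exact: (co_DJ_bilin JT).1. Qed.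
Lemma DJ_linr a : linear (DJ a). Proof. exact: (co_DJ_bilin JT).2. Qed.
Lemma act_linl b : linear (fun a => act a b). Proof. exact: (jact_bilin (jt_mod JT)).1. Qed.
Lemma act_linr a : linear (act a). Proof. exact: (jact_bilin (jt_mod JT)).2. Qed.

Lemma DD_self a : DD a a = 0.
Proof.
apply: (scalerI F2); rewrite scaler0; have := co_D_skew JT a a.
by move/eqP; rewrite -addr_eq0 -mulr2n -scaler_nat => /eqP.
Qed.

Lemma elJ_inj f a b : f != 0 -> elJ dec f a = elJ dec f b -> a = b.
Proof.
move=> f0 ab; have [i [j fij]] : exists i j, sl2val f i j != 0.
  apply: contrapT => h; move/negP: f0; apply; apply/eqP/sl2P/matrixP => i j.
  rewrite (lin0 (@sl2val_linear F)) mxE.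
  by apply: contrapT => /eqP fij; apply: h; exists i, j.
by apply: (scalerI fij); rewrite -!(cJ_elJ dec) ab.
Qed.

Lemma E_neq0 : E != 0.
Proof.
apply/eqP => /(congr1 (fun f => sl2val f ord0 ord_max)).
by rewrite (lin0 (@sl2val_linear F)) !mxE /= => /eqP; rewrite oner_eq0.
Qed.
Lemma H_neq0 : H != 0.
Proof.
apply/eqP => /(congr1 (fun f => sl2val f ord0 ord0)).
by rewrite (lin0 (@sl2val_linear F)) !mxE /= subr0 => /eqP; rewrite oner_eq0.
Qed.

(** The bracket with [d] is a derivation of [L]; as [E H] has trace 0, the bracket of
    [E (x) a] and [H (x) b] has no component in [D]. *)
Lemma DJ_der d a b : DJ d (jm a b) = jm (DJ d a) b + jm a (DJ d b).
Proof.
have := lie_der (id_D dec d) (elJ dec E a) (elJ dec H b).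
rewrite !(co_lieDJ JT) !(co_lieJJ JT) tr_EH mulr0 !scale0r !addr0 (co_lieDJ JT) lie_EH.
rewrite -(linD ((elJ_bilin dec).2 _)); apply: elJ_inj.
by rewrite scaler_eq0 negb_or oppr_eq0 F2 E_neq0.
Qed.

(** These are the components along [H] and in [D] of the Jacobi identity for
    [E (x) a], [F (x) b] and [H (x) c]. *)
Lemma jacobi_EFH a b c :
  DJ (DD a b) c = jm a (jm b c) - jm b (jm a c)
  /\ DD (jm a b) c = DD a (jm b c) + DD b (jm a c).
Proof.
have := lie_der (elJ dec E a) (elJ dec Y b) (elJ dec H c).
rewrite !(co_lieJJ JT) tr_EF tr_EH tr_FH mulr0 mulr1 !scale0r !addr0 lie_EF lie_FH lie_EH.
rewrite (linD (lie_linl _)) (linZ (lie_linl _)) (co_lieDJ JT) !(co_lieJJ JT) liexx tr_HH.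
rewrite !sl2valZ -!scalemxAr !mxtraceZ tr_EF mxtrace_mulC tr_EF !mulr1.
rewrite !(linZ (lie_linr _)) lie_EF [lie Y E]lieC lie_EF.
rewrite (lin0 ((elJ_bilin dec).1 _)) add0r.
rewrite !(linZ ((elJ_bilin dec).1 _)) (linN ((elJ_bilin dec).1 _)).
move=> e; split; last first.
  move/(congr1 (cD dec)): e.
  rewrite !(linD (cD_lin dec), linZ (cD_lin dec), linN (cD_lin dec)) !cD_elJ !cD_D.
  rewrite oppr0 !scaler0 !add0r addr0.
  by move=> e; apply: (eq_from_lin (esym e) (mulf_neq0 F2 F2)); module.
move/(congr1 (cJ dec ord0 ord0)): e; set c00 := cJ dec ord0 ord0.
have cl : linear c00 by apply: cJ_lin.
rewrite !(linD cl, linZ cl, linN cl) /c00 !cJ_elJ !cJ_D !mxE /= subr0 !scale1r !scaler0 !(add0r, addr0).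
by move=> e; apply: (eq_from_lin (esym e) F2); module.
Qed.

Lemma DJ_DD a b c : DJ (DD a b) c = jm a (jm b c) - jm b (jm a c).
Proof. exact: (jacobi_EFH a b c).1. Qed.

Lemma DD_jm a b c : DD (jm a b) c = DD a (jm b c) + DD b (jm a c).
Proof. exact: (jacobi_EFH a b c).2. Qed.

Lemma jmr1 a : jm a (jone JT) = a. Proof. by rewrite jmulC jmul1. Qed.

Lemma DD_1l a : DD (jone JT) a = 0.
Proof.
have := DD_jm (jone JT) (jone JT) a; rewrite !jmul1 => /eqP.
by rewrite eq_sym -subr_eq0 addrK => /eqP.
Qed.
End JordanFacts.

(** * The Peirce decomposition *)

Section MatrixIdentities.
Variables (F : fieldType) (F2 : (2%:R : F) != 0).

Lemma sl2_11 (f : sl2 F) : sl2val f ord_max ord_max = - sl2val f ord0 ord0.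
Proof. by apply/eqP; rewrite -addr_eq0 addrC -tr2 sl2_tr. Qed.

Lemma dev_bracket (f : sl2 F) X : dev F2 (sl2val f *m X - X *m sl2val f) = lie f (dev F2 X).
Proof.
apply: sl2P; rewrite sl2_lieE /= raddfB /= mxtrace_mulC subrr mulr0 raddf0 subr0.
by rewrite mulmxBr mulmxBl scalar_mxC opprB addrA subrK.
Qed.

(** Polarizing the Cayley-Hamilton identity, [f X + X f = tr X f + tr (f X)] for
    traceless [f]. *)
Lemma dev_mul (f : sl2 F) X :
  dev F2 (sl2val f *m X) = 2^-1 *: (lie f (dev F2 X) + \tr X *: f).
Proof.
apply: sl2P; rewrite -dev_bracket sl2valZ sl2valD sl2valZ /= [\tr (_ - _)]raddfB /=.
rewrite [\tr (X *m _)]mxtrace_mulC subrr mulr0 raddf0 subr0.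
rewrite trM2 tr2; have h : 2 * 2^-1 = 1 :> F by rewrite mulfV.
apply: (scalerI F2); rewrite scalerA mulfV // scale1r scalerBr scale_scalar_mx mulrA h mul1r.
apply: mx22P; rewrite !mxE !sum2 /= !sl2_11 ?mulr1n ?mulr0n; ring.
Qed.

Lemma tr_mul_dev (f : sl2 F) X : \tr (sl2val f *m sl2val (dev F2 X)) = \tr (sl2val f *m X).
Proof. by rewrite /= mulmxBr raddfB /= mul_mx_scalar mxtraceZ sl2_tr mulr0 subr0. Qed.
End MatrixIdentities.

Section Peirce.
Variables (F : fieldType) (F2 : (2%:R : F) != 0) (beta : skew_form F).
Variables (L : lieAlgType F) (Psi : sstruct (SL2f F) L) (iota : sl2 F -> L).
Variables (J T D : lmodType F) (dec : isotypic_dec Psi J T D).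
Variable JT : coordinatization beta iota dec.
Local Notation jm := (jmul JT).
Local Notation act := (jact (jt_mod JT)).
Local Notation DD := (co_D JT).
Local Notation DJ := (co_DJ JT).
Variable e : J.
Local Notation J1 := (peirceJ1 JT e).
Local Notation Jh := (peirceJh JT e).
Local Notation J0 := (peirceJ0 JT e).
Local Notation T1 := (peirceT1 JT e).
Local Notation T0 := (peirceT0 JT e).

(** The Lagrange interpolation polynomials in the multiplication by [e], whose
    eigenvalues are [1], [1/2] and [0] by [peirce_cubic]. *)
Definition proj1 a := 2 *: jm e (jm e a) - jm e a.
Definition projh a := 4 *: jm e a - 4 *: jm e (jm e a).
Definition proj0 a := a - 3 *: jm e a + 2 *: jm e (jm e a).
(** The projection of the derivations onto those killing [e], along the [D_{e,a}]. *)
Definition projS d := d + 4 *: DD e (DJ d e).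

Hypothesis ee : jm e e = e.

Lemma JhE a : Jh a <-> 2 *: jm e a = a.
Proof.
rewrite /peirceJh /=; split=> [->|h]; first by rewrite scalerA mulfV // scale1r.
by rewrite -{2}h scalerA mulVf // scale1r.
Qed.

(** In terms of [c = e (e a)], the vectors [a] and [e a] are [4 c] and [2 c]: no
    division is left. *)
Lemma Jh_quarter a : Jh a -> a = 4 *: jm e (jm e a) /\ jm e a = 2 *: jm e (jm e a).
Proof.
move=> /JhE h; have h2 : jm e a = 2 *: jm e (jm e a) by rewrite -{1}h (linZ (jm_linr JT e)).
by split=> //; rewrite -{1}h {1}h2; module.
Qed.

Lemma DDe_jm a : DD e a = 2 *: DD e (jm e a).
Proof. by rewrite -{1}ee DD_jm //; module. Qed.

(** The two sides of [D_{e,a} = 2 D_{e,ea}] are evaluated at [e]. *)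
Lemma peirce_cubic a : 2 *: jm e (jm e (jm e a)) = 3 *: jm e (jm e a) - jm e a.
Proof.
have := congr1 (fun d => DJ d e) (DDe_jm a); rewrite (linZ (DJ_linl JT e)) !DJ_DD // ee.
rewrite ![jm _ e]jmulC => h; apply: (eq_from_lin (esym h) (oner_neq0 F)).
module.
Qed.

Lemma proj1_lin : linear proj1.
Proof. by move=> c a b; rewrite /proj1 !jm_linr; module. Qed.
Lemma projh_lin : linear projh.
Proof. by move=> c a b; rewrite /projh !jm_linr; module. Qed.
Lemma proj0_lin : linear proj0.
Proof. by move=> c a b; rewrite /proj0 !jm_linr; module. Qed.
Lemma projS_lin : linear projS.
Proof. by move=> c a b; rewrite /projS DJ_linl DD_linr; module. Qed.

Lemma proj1_in a : J1 (proj1 a).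
Proof.
rewrite /peirceJ1 /= /proj1 (linD (jm_linr JT e)) (linN (jm_linr JT e)) (linZ (jm_linr JT e)).
by rewrite peirce_cubic; module.
Qed.
Lemma projh_in a : Jh (projh a).
Proof.
apply/JhE; rewrite /projh (linD (jm_linr JT e)) (linN (jm_linr JT e)) !(linZ (jm_linr JT e)).
by apply: (eq_from_mul (k := - 4) (peirce_cubic a)); module.
Qed.
Lemma proj0_in a : J0 (proj0 a).
Proof.
rewrite /peirceJ0 /= /proj0 !(linD (jm_linr JT e)) (linN (jm_linr JT e)) !(linZ (jm_linr JT e)).
by rewrite peirce_cubic; module.
Qed.

Lemma peirce_sum a : a = proj1 a + projh a + proj0 a.
Proof. by rewrite /proj1 /projh /proj0; module. Qed.

Lemma proj_J1 a : J1 a -> [/\ proj1 a = a, projh a = 0 & proj0 a = 0].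
Proof. by rewrite /peirceJ1 /= /proj1 /projh /proj0 => h; rewrite !h; split; module. Qed.
Lemma proj_Jh a : Jh a -> [/\ proj1 a = 0, projh a = a & proj0 a = 0].
Proof.
move=> /Jh_quarter; rewrite /proj1 /projh /proj0.
by move: (jm e a) (jm e (jm e a)) => b c [-> ->]; split; module.
Qed.
Lemma proj_J0 a : J0 a -> [/\ proj1 a = 0, projh a = 0 & proj0 a = a].
Proof.
rewrite /peirceJ0 /= /proj1 /projh /proj0 => h.
by rewrite !h (lin0 (jm_linr JT e)); split; module.
Qed.

Lemma DDe_J1 a : J1 a -> DD e a = 0.
Proof.
rewrite /peirceJ1 /= => h; have := DDe_jm a; rewrite h => h2.
by apply: (eq_from_lin (esym h2) (oner_neq0 F)); module.
Qed.
Lemma DDe_J0 a : J0 a -> DD e a = 0.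
Proof. by rewrite /peirceJ0 /= DDe_jm => ->; rewrite (lin0 (DD_linr JT e)) scaler0. Qed.

Lemma DDe_e a : Jh a -> 4 *: DJ (DD e a) e = - a.
Proof.
move=> /Jh_quarter; rewrite DJ_DD // ee [jm a e]jmulC.
by move: (jm e a) (jm e (jm e a)) => b c [-> ->]; module.
Qed.

Lemma DJ_e_Jh d : Jh (DJ d e).
Proof.
by apply/JhE; rewrite -[in RHS]ee DJ_der // [jm _ e]jmulC; module.
Qed.

Lemma projS_in d : DJ (projS d) e = 0.
Proof.
rewrite /projS (linD (DJ_linl JT e)) (linZ (DJ_linl JT e)) DDe_e ?subrr //.
exact: DJ_e_Jh.
Qed.
Lemma projS_id d : DJ d e = 0 -> projS d = d.
Proof. by rewrite /projS => ->; rewrite (lin0 (DD_linr JT e)) scaler0 addr0. Qed.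
Lemma projS_DDe a : projS (DD e a) = 0.
Proof.
have [[i j] k] := (proj1_in a, projh_in a, proj0_in a).
rewrite [a]peirce_sum 2!(linD (DD_linr JT e)) (DDe_J1 i) (DDe_J0 k) add0r addr0.
by rewrite /projS -(linZ (DD_linr JT e)) DDe_e // (linN (DD_linr JT e)) subrr.
Qed.

Lemma act_ee x : act e (act e x) = act e x.
Proof.
by rewrite -{3}ee jactM -mulr2n -scaler_nat scalerA mulVf // scale1r.
Qed.

Lemma T1_act x : T1 (act e x).
Proof. exact: act_ee. Qed.
Lemma T0_act x : T0 (x - act e x).
Proof. by rewrite /peirceT0 /= (linD (act_linr JT e)) (linN (act_linr JT e)) act_ee subrr. Qed.
End Peirce.

(** * Generators adapted to an idempotent *)

Section Generators.
Variables (F : fieldType) (F2 : (2%:R : F) != 0) (beta : skew_form F).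
Variables (L : lieAlgType F) (Psi : sstruct (SL2f F) L) (iota : sl2 F -> L).
Variables (J T D : lmodType F) (dec : isotypic_dec Psi J T D).
Variable JT : coordinatization beta iota dec.
Local Notation jm := (jmul JT).
Local Notation act := (jact (jt_mod JT)).
Local Notation DD := (co_D JT).
Local Notation DJ := (co_DJ JT).
Variable e : J.
Local Notation J1 := (peirceJ1 JT e).
Local Notation Jh := (peirceJh JT e).
Local Notation J0 := (peirceJ0 JT e).
Local Notation T1 := (peirceT1 JT e).
Local Notation T0 := (peirceT0 JT e).

(** For [a] in [J1] or [J0] this is the traceless part of [X] tensor [a], as
    [D_{e,a} = 0]; for [a] in [Jh] the coefficient of [D_{e,a}] is the one for which
    bracketing with [f (x) e] is left multiplication by [f]. *)
Definition theta a (X : 'M[F]_2) : L :=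
  elJ dec (dev F2 X) a + (2 * \tr X) *: id_D dec (DD e a).

Local Notation th := theta.

Lemma th_linr a : linear (th a).
Proof.
move=> c X Y; rewrite /theta (dev_lin F2) ((elJ_bilin dec).1 a) raddfD /= mxtraceZ.
by module.
Qed.

Lemma th_linl X : linear (th^~ X).
Proof.
by move=> c a b; rewrite /theta ((elJ_bilin dec).2 _) (DD_linr JT) (id_D_lin dec); module.
Qed.

(** On [theta a X] with [a] in [Jh] the correction puts back the trace of [X], which
    the [J]-part has lost: [cA] gives the entries of [X] times [a]. *)
Definition cA i j (x : L) : J := cJ dec i j x - (i == j)%:R *: DJ (cD dec x) e.
Definition cS (x : L) : D := projS JT e (cD dec x).

Lemma cA_lin i j : linear (cA i j).
Proof.
by move=> c x y; rewrite /cA (cJ_lin dec) (cD_lin dec) (DJ_linl JT); module.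
Qed.
Lemma cS_lin : linear cS.
Proof. by move=> c x y; rewrite /cS (cD_lin dec) projS_lin. Qed.

Hypothesis ee : jm e e = e.

Lemma cT_th i a X : cT dec i (th a X) = 0.
Proof.
by rewrite /theta (linD (cT_lin dec i)) (linZ (cT_lin dec i)) cT_elJ cT_D scaler0 addr0.
Qed.

Lemma cS_th a X : cS (th a X) = 0.
Proof.
rewrite /theta (linD cS_lin) (linZ cS_lin) /cS cD_elJ cD_D projS_DDe //.
by rewrite (lin0 (projS_lin JT e)) scaler0 addr0.
Qed.

Lemma cA_th_diag i j a X : J1 a \/ J0 a -> cA i j (th a X) = sl2val (dev F2 X) i j *: a.
Proof.
move=> ha; have D0 : DD e a = 0 by case: ha; [exact: DDe_J1 | exact: DDe_J0].
rewrite /theta D0 (lin0 (id_D_lin dec)) scaler0 addr0 /cA cJ_elJ cD_elJ.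
by rewrite (lin0 (DJ_linl JT e)) scaler0 subr0.
Qed.

Lemma th_scalar a c : J1 a \/ J0 a -> th a c%:M = 0.
Proof.
move=> ha; have D0 : DD e a = 0 by case: ha; [exact: DDe_J1 | exact: DDe_J0].
by rewrite /theta D0 (lin0 (id_D_lin dec)) scaler0 addr0 dev_scalar (lin0 ((elJ_bilin dec).1 _)).
Qed.

Lemma th_dev a X : J1 a \/ J0 a -> th a (sl2val (dev F2 X)) = th a X.
Proof.
by move=> ha; rewrite -[LHS]addr0 -(th_scalar (2^-1 * \tr X) ha) -(linD (th_linr a)) -devE.
Qed.

Lemma cA_th_half i j a X : Jh a -> cA i j (th a X) = X i j *: a.
Proof.
move=> ha; rewrite /theta (linD (cA_lin i j)) (linZ (cA_lin i j)) /cA cJ_elJ cD_elJ cJ_D cD_D.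
rewrite (lin0 (DJ_linl JT e)) scaler0 subr0 sub0r scalerN scalerA.
have De : a = - 4 *: DJ (DD e a) e by rewrite scaleNr DDe_e ?opprK.
have Xe : X i j = sl2val (dev F2 X) i j + (i == j)%:R * (2^-1 * \tr X).
  by rewrite {1}(devE F2 X) [LHS]mxE [X in _ + X]mxE mulr_natl.
have tX : \tr X = 2 * (2^-1 * \tr X) by rewrite mulrA mulfV ?mul1r.
move: (2^-1 * \tr X) tX Xe => c -> ->; move: (DJ (DD e a) e) De => b ->.
by module.
Qed.

Lemma cA_elT i j u x : cA i j (elT dec u x) = 0.
Proof. by rewrite /cA cJ_elT cD_elT (lin0 (DJ_linl JT e)) scaler0 subr0. Qed.
Lemma cS_elT u x : cS (elT dec u x) = 0.
Proof. by rewrite /cS cD_elT (lin0 (projS_lin JT e)). Qed.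
Lemma cA_S i j d : DJ d e = 0 -> cA i j (id_D dec d) = 0.
Proof. by rewrite /cA cJ_D cD_D => ->; rewrite scaler0 subr0. Qed.
Lemma cS_S d : DJ d e = 0 -> cS (id_D dec d) = d.
Proof. by rewrite /cS cD_D; apply: projS_id. Qed.
Lemma cS_in x : DJ (cS x) e = 0.
Proof. exact: projS_in. Qed.

Lemma cJ_trace x : cJ dec ord0 ord0 x + cJ dec ord_max ord_max x = 0.
Proof.
rewrite /cJ; have [s ->] := tensor_sum (parts dec x).1.1.
rewrite !(lin_sum (tlift_linear (cJ_bilin J _ _))) -big_split big1 //= => p _.
by rewrite !tlift_tens -?scalerDl -?tr2 ?sl2_tr ?scale0r //; apply: cJ_bilin.
Qed.

Lemma generators_sum x :
  x = \sum_i \sum_j th (cA i j x) (delta_mx i j)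
      + \sum_i elT dec (delta_mx i ord0 : natmod F) (cT dec i x) + id_D dec (cS x).
Proof.
rewrite [LHS](coordinates_sum dec F2 x); set t := \sum_i elT dec _ _.
rewrite /cS /projS (linD (id_D_lin dec)) (linZ (id_D_lin dec)).
rewrite !sum2 /theta /cA /= !tr2 !mxE /= !(scale0r, scale1r, subr0, addr0, add0r, mulr0, mulr1).
rewrite !(linD (DD_linr JT e)) !(linN (DD_linr JT e)).
have -> : cJ dec ord_max ord_max x = - cJ dec ord0 ord0 x.
  by apply/eqP; rewrite -addr_eq0 addrC cJ_trace.
rewrite !(linD ((elJ_bilin dec).2 _), linN ((elJ_bilin dec).2 _)) !(linN (DD_linr JT e)).
rewrite !(linD (id_D_lin dec)) !(linN (id_D_lin dec)).
have -> : dev F2 (delta_mx ord_max ord_max) = - dev F2 (delta_mx ord0 ord0).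
  apply/eqP; rewrite -addr_eq0 -(linD (dev_lin F2)).
  have -> : delta_mx ord_max ord_max + delta_mx ord0 ord0 = 1%:M :> 'M[F]_2.
    by apply: mx22P; rewrite !mxE /= ?addr0 ?add0r.
  by rewrite dev_scalar.
rewrite !(linN ((elJ_bilin dec).1 _)); module.
Qed.

(** By [generators_sum] and the Peirce decompositions, additive properties need only
    be checked on six kinds of generators. *)
Lemma peirce_ind (P : L -> Prop) :
  (forall x y, P x -> P y -> P (x + y)) ->
  (forall a X, J1 a -> P (th a X)) -> (forall a X, J0 a -> P (th a X)) ->
  (forall a X, Jh a -> P (th a X)) ->
  (forall u x, T1 x -> P (elT dec u x)) -> (forall u x, T0 x -> P (elT dec u x)) ->
  (forall d, DJ d e = 0 -> P (id_D dec d)) -> forall x, P x.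
Proof.
move=> PD p1 p0 ph pt1 pt0 ps x.
have P0 : P 0.
  by rewrite -(lin0 (id_D_lin dec)); apply: ps; rewrite (lin0 (DJ_linl JT e)).
rewrite (generators_sum x); apply: (PD); [apply: (PD) | exact/ps/cS_in].
  apply: (big_ind P) => // i _; apply: (big_ind P) => // j _.
  rewrite (peirce_sum JT e (cA i j x)) 2!(linD (th_linl _)).
  apply: (PD); [apply: (PD)|]; first exact/p1/proj1_in.
    exact/ph/projh_in.
  exact/p0/proj0_in.
apply: (big_ind P) => // i _; rewrite -[cT _ i x](subrK (act e (cT dec i x))).
rewrite (linD ((elT_bilin dec).2 _)).
by apply: (PD); [exact/pt0/T0_act | exact/pt1/T1_act].
Qed.

Lemma ad_th_1 f a X : J1 a ->
  lie (elJ dec f e) (th a X) = th a (sl2val f *m X - X *m sl2val f).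
Proof.
move=> ha; rewrite /theta (DDe_J1 F2 ee ha) (lin0 (id_D_lin dec)) !scaler0 !addr0.
by rewrite (co_lieJJ JT) (DDe_J1 F2 ee ha) ha (lin0 (id_D_lin dec)) scaler0 addr0 dev_bracket.
Qed.

Lemma ad_th_0 f a X : J0 a -> lie (elJ dec f e) (th a X) = 0.
Proof.
move=> ha; rewrite /theta (DDe_J0 F2 ee ha) (lin0 (id_D_lin dec)) !scaler0 !addr0.
rewrite (co_lieJJ JT) (DDe_J0 F2 ee ha) ha (lin0 (id_D_lin dec)) scaler0 addr0.
by rewrite (lin0 ((elJ_bilin dec).2 _)).
Qed.

(** Left multiplication by [f] instead of the commutator: this is why the [Jh]-part
    is a sum of natural modules for the copy of SL2 given by [e]. *)
Lemma ad_th_h f a X : Jh a -> lie (elJ dec f e) (th a X) = th a (sl2val f *m X).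
Proof.
move=> ha; rewrite /theta (linD (lie_linr _)) (linZ (lie_linr _)) (co_lieJJ JT).
rewrite [lie _ (id_D dec _)]lieC (co_lieDJ JT) tr_mul_dev.
have -> : 2 * \tr X *: - elJ dec f (DJ (DD e a) e) = 2^-1 * \tr X *: elJ dec f a.
  have De : a = - 4 *: DJ (DD e a) e by rewrite scaleNr DDe_e ?opprK.
  have tX : \tr X = 2 * (2^-1 * \tr X) by rewrite mulrA mulfV ?mul1r.
  rewrite {1}tX; move: (2^-1 * \tr X) => c; move: (DJ (DD e a) e) De => b ->.
  by rewrite (linZ ((elJ_bilin dec).2 _)); module.
rewrite ha (linZ ((elJ_bilin dec).2 _)) dev_mul (linZ ((elJ_bilin dec).1 _)).
rewrite (linD ((elJ_bilin dec).1 _)) (linZ ((elJ_bilin dec).1 _)).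
by module.
Qed.

Lemma ad_elT_1 f u x : T1 x -> lie (elJ dec f e) (elT dec u x) = elT dec (sl2val f *m u) x.
Proof. by move=> h; rewrite (co_lieJT JT) h. Qed.
Lemma ad_elT_0 f u x : T0 x -> lie (elJ dec f e) (elT dec u x) = 0.
Proof. by move=> h; rewrite (co_lieJT JT) h (lin0 ((elT_bilin dec).2 _)). Qed.
Lemma ad_S f d : DJ d e = 0 -> lie (elJ dec f e) (id_D dec d) = 0.
Proof. by move=> h; rewrite lieC (co_lieDJ JT) h (lin0 ((elJ_bilin dec).2 _)) oppr0. Qed.

End Generators.

(** * The action of SL2 attached to an idempotent *)

Section Action.
Variables (F : fieldType) (F2 : (2%:R : F) != 0) (beta : skew_form F).
Variables (L : lieAlgType F) (Psi : sstruct (SL2f F) L) (iota : sl2 F -> L).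
Variables (J T D : lmodType F) (dec : isotypic_dec Psi J T D).
Variable JT : coordinatization beta iota dec.
Local Notation jm := (jmul JT).
Local Notation act := (jact (jt_mod JT)).
Local Notation DD := (co_D JT).
Local Notation DJ := (co_DJ JT).
Variable e : J.
Local Notation J1 := (peirceJ1 JT e).
Local Notation Jh := (peirceJh JT e).
Local Notation J0 := (peirceJ0 JT e).
Local Notation T1 := (peirceT1 JT e).
Local Notation T0 := (peirceT0 JT e).
Hypothesis ee : jm e e = e.
Local Notation th := (theta F2 JT e).
Local Notation cA := (cA JT e).
Local Notation cS := (cS JT e).

Section Points.
Variable R : comAlgType F.
Implicit Types (g : SL2 R) (Xi : bext L R -> bext L R).

Definition elTx (x : T) (u : natmod F) : L := elT dec u x.

Lemma elTx_linr x : linear (elTx x). Proof. exact: (elT_bilin dec).1. Qed.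
Lemma elTx_linl u : linear (elTx^~ u). Proof. exact: (elT_bilin dec).2. Qed.

(** The integrated form of the brackets with [f (x) e]: conjugation by [g] on the
    [J1]-part, left multiplication by [g] on the [Jh]-part and the [T1]-part, and the
    identity elsewhere. *)
Definition idem_coact g (x : L) : bext L R :=
  \sum_i \sum_j (mext (th (proj1 JT e (cA i j x))) (SL2val g *m delta_mx i j *m \adj (SL2val g))
     + mext (th (proj0 JT e (cA i j x))) (delta_mx i j)
     + mext (th (projh JT e (cA i j x))) (SL2val g *m delta_mx i j))
  + \sum_i (mext (elTx (act e (cT dec i x))) (SL2val g *m delta_mx i ord0)
     + mext (elTx (cT dec i x - act e (cT dec i x))) (delta_mx i ord0 : 'cV[R]_2))
  + bten (id_D dec (cS x)) 1.

Lemma idem_coact_semi g : semilin (idem_coact g).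
Proof.
have lT i : linear (fun x => act e (cT dec i x)).
  by move=> c x y; rewrite (cT_lin dec) (act_linr JT).
have lT' i : linear (fun x => cT dec i x - act e (cT dec i x)).
  by move=> c x y; rewrite lT (cT_lin dec); module.
have l1 i j : linear (fun x => proj1 JT e (cA i j x)).
  by move=> c x y; rewrite (cA_lin JT) proj1_lin.
have l0 i j : linear (fun x => proj0 JT e (cA i j x)).
  by move=> c x y; rewrite (cA_lin JT) proj0_lin.
have lh i j : linear (fun x => projh JT e (cA i j x)).
  by move=> c x y; rewrite (cA_lin JT) projh_lin.
have lS : linear (fun x => id_D dec (cS x)).
  by move=> c x y; rewrite (cS_lin JT) (id_D_lin dec).
apply: semiD; [apply: semiD | exact: semi_comp lS (@semi_bten F R L)].
  apply: semi_sum => i; apply: semi_sum => j; do ?apply: semiD.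
  - exact: semi_comp (l1 i j) (mext_semi _ (th_linl F2 JT e)).
  - exact: semi_comp (l0 i j) (mext_semi _ (th_linl F2 JT e)).
  - exact: semi_comp (lh i j) (mext_semi _ (th_linl F2 JT e)).
apply: semi_sum => i; apply: semiD.
- exact: semi_comp (lT i) (mext_semi _ elTx_linl).
- exact: semi_comp (lT' i) (mext_semi _ elTx_linl).
Qed.

Lemma mext_zero m n (B : 'M[F]_(m, n) -> L) (A : 'M[R]_(m, n)) :
  (forall X, B X = 0) -> mext B A = 0.
Proof. by move=> B0; rewrite /mext !big1 // => i _; rewrite big1 // => j _; rewrite B0 bten0l. Qed.

Lemma mext_scaled m n (M : lmodType F) (B : M -> 'M[F]_(m, n) -> L) c a (A : 'M[R]_(m, n)) :
  (forall X, linear (B^~ X)) -> mext (B (c *: a)) A = c%:A *: mext (B a) A.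
Proof.
move=> Bl; rewrite /mext scaler_sumr; apply: eq_bigr => i _.
rewrite scaler_sumr; apply: eq_bigr => j _.
by rewrite (linZ (Bl _)) btenZl scale_bten mulr_algl.
Qed.

(** The coordinates of [X] move from the parameter to the argument by linearity. *)
Lemma sum_mext m n m' n' (M : lmodType F) (B : M -> 'M[F]_(m', n') -> L) a (X : 'M[F]_(m, n))
    (Tl : 'M[R]_(m, n) -> 'M[R]_(m', n')) :
  (forall X, linear (B^~ X)) -> linear Tl ->
  \sum_i \sum_j mext (B (X i j *: a)) (Tl (delta_mx i j)) = mext (B a) (Tl (mxR R X)).
Proof.
move=> Bl Tll; rewrite (matrix_sum_delta (mxR R X)).
rewrite (lin_sum Tll) (lin_sum (mext_lin _)); apply: eq_bigr => i _.
rewrite (lin_sum Tll) (lin_sum (mext_lin _)); apply: eq_bigr => j _.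
by rewrite (linZ Tll) (linZ (mext_lin _)) mext_scaled ?mxE.
Qed.

Lemma conj_lin (m : 'M[R]_2) : linear (fun A => m *m A *m \adj m).
Proof. by move=> c A B; rewrite mulmxDr mulmxDl -scalemxAr -scalemxAl. Qed.
Lemma mulmx_lin n (m : 'M[R]_2) : linear (fun A : 'M[R]_(2, n) => m *m A).
Proof. by move=> c A B; rewrite mulmxDr -scalemxAr. Qed.

Lemma th0 X : th 0 X = 0. Proof. exact: (lin0 (th_linl F2 JT e X)). Qed.
Lemma elTx0 u : elTx 0 u = 0. Proof. exact: (lin0 (elTx_linl u)). Qed.

Lemma mext_th_scalar a c : J1 a \/ J0 a -> mext (th a) (c%:M : 'M[R]_2) = 0.
Proof.
move=> ha; rewrite -scalemx1 (linZ (mext_lin _)).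
have -> : (1%:M : 'M[R]_2) = mxR R 1%:M by rewrite /mxR map_mx1.
rewrite mext_mxR; last exact: th_linr.
by rewrite th_scalar // bten0l scaler0.
Qed.

Lemma conj_scalar g c : SL2val g *m mxR R c%:M *m \adj (SL2val g) = (c%:A)%:M.
Proof. by rewrite mxR_scalar mul_mx_scalar -scalemxAl SL2_Madj scalemx1. Qed.

Lemma idem_coact_1 g a X : J1 a ->
  idem_coact g (th a X) = mext (th a) (SL2val g *m mxR R X *m \adj (SL2val g)).
Proof.
move=> ha; rewrite /idem_coact cS_th // (lin0 (id_D_lin dec)) bten0l addr0.
rewrite [X in _ + X]big1 ?addr0 => [|i _]; last first.
  rewrite cT_th (lin0 (act_linr JT e)) subr0 !mext_zero ?addr0 // => u; exact: elTx0.
have [p1 ph p0] := proj_J1 ha.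
transitivity (\sum_i \sum_j mext (th (sl2val (dev F2 X) i j *: a))
    (SL2val g *m delta_mx i j *m \adj (SL2val g))).
  apply: eq_bigr => i _; apply: eq_bigr => j _; rewrite cA_th_diag //; last by left.
  rewrite (linZ (proj1_lin JT e)) (linZ (proj0_lin JT e)) (linZ (projh_lin JT e)) p1 p0 ph.
  by rewrite !scaler0 [X in _ + X + _]mext_zero ?[X in _ + X]mext_zero ?addr0 // => u; exact: th0.
rewrite (@sum_mext _ _ _ _ _ th a _ (fun A => SL2val g *m A *m \adj (SL2val g)));
  [|exact: th_linl | exact: conj_lin].
rewrite [in RHS](devE F2 X) mxRD (linD (conj_lin _)) (linD (mext_lin _)) conj_scalar.
by rewrite mext_th_scalar ?addr0 //; left.
Qed.

Lemma idem_coact_0 g a X : J0 a -> idem_coact g (th a X) = mext (th a) (mxR R X).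
Proof.
move=> ha; rewrite /idem_coact cS_th // (lin0 (id_D_lin dec)) bten0l addr0.
rewrite [X in _ + X]big1 ?addr0 => [|i _]; last first.
  rewrite cT_th (lin0 (act_linr JT e)) subr0 !mext_zero ?addr0 // => u; exact: elTx0.
have [p1 ph p0] := proj_J0 ha.
transitivity (\sum_i \sum_j mext (th (sl2val (dev F2 X) i j *: a)) (delta_mx i j : 'M[R]_2)).
  apply: eq_bigr => i _; apply: eq_bigr => j _; rewrite cA_th_diag //; last by right.
  rewrite (linZ (proj1_lin JT e)) (linZ (proj0_lin JT e)) (linZ (projh_lin JT e)) p1 p0 ph.
  by rewrite !scaler0 [X in X + _ + _]mext_zero ?[X in _ + X]mext_zero ?addr0 ?add0r // => u; exact: th0.
rewrite (@sum_mext _ _ _ _ _ th a _ id); [|exact: th_linl | by []].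
rewrite [in RHS](devE F2 X) mxRD (linD (mext_lin _)) mxR_scalar.
by rewrite mext_th_scalar ?addr0 //; right.
Qed.

Lemma idem_coact_h g a X : Jh a -> idem_coact g (th a X) = mext (th a) (SL2val g *m mxR R X).
Proof.
move=> ha; rewrite /idem_coact cS_th // (lin0 (id_D_lin dec)) bten0l addr0.
rewrite [X in _ + X]big1 ?addr0 => [|i _]; last first.
  rewrite cT_th (lin0 (act_linr JT e)) subr0 !mext_zero ?addr0 // => u; exact: elTx0.
have [p1 ph p0] := proj_Jh F2 ha.
rewrite -(@sum_mext _ _ _ _ _ th a _ (fun A => SL2val g *m A));
  [|exact: th_linl | exact: mulmx_lin].
apply: eq_bigr => i _; apply: eq_bigr => j _; rewrite cA_th_half //.
rewrite (linZ (proj1_lin JT e)) (linZ (proj0_lin JT e)) (linZ (projh_lin JT e)) p1 p0 ph.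
by rewrite !scaler0 [X in X + _ + _]mext_zero ?[X in _ + X + _]mext_zero ?addr0 ?add0r // => u; exact: th0.
Qed.

Lemma idem_coact_elT g u x : idem_coact g (elTx x u) =
  mext (elTx (act e x)) (SL2val g *m mxR R (u : 'cV[F]_2))
  + mext (elTx (x - act e x)) (mxR R (u : 'cV[F]_2)).
Proof.
rewrite /idem_coact cS_elT (lin0 (id_D_lin dec)) bten0l addr0.
rewrite big1 ?add0r => [|i _]; last first.
  rewrite big1 // => j _; rewrite cA_elT (lin0 (proj1_lin JT e)) (lin0 (proj0_lin JT e)).
  by rewrite (lin0 (projh_lin JT e)) !mext_zero ?addr0 // => v; exact: th0.
rewrite big_split; congr (_ + _) => /=.
  rewrite -(@sum_mext _ _ _ _ _ elTx _ _ (fun A => SL2val g *m A));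
    [|exact: elTx_linl | exact: mulmx_lin].
  by apply: eq_bigr => i _; rewrite big_ord1 cT_elT (linZ (act_linr JT e)).
rewrite -(@sum_mext _ _ _ _ _ elTx _ _ id); [|exact: elTx_linl | by []].
by apply: eq_bigr => i _; rewrite big_ord1 cT_elT (linZ (act_linr JT e)) scalerBr.
Qed.

Lemma idem_coact_S g d : DJ d e = 0 -> idem_coact g (id_D dec d) = bten (id_D dec d) 1.
Proof.
move=> hd; rewrite /idem_coact cS_S // [X in X + _ + _]big1 ?add0r => [|i _]; last first.
  rewrite big1 // => j _; rewrite cA_S // (lin0 (proj1_lin JT e)) (lin0 (proj0_lin JT e)).
  by rewrite (lin0 (projh_lin JT e)) !mext_zero ?addr0 // => v; exact: th0.
rewrite big1 ?add0r // => i _; rewrite cT_D (lin0 (act_linr JT e)) subr0.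
by rewrite !mext_zero ?addr0 // => u; exact: elTx0.
Qed.
End Points.
End Action.

(** * The action is by automorphisms *)

(** The vectors [a *: v] and [c *: v] are killed by smaller powers, and they generate
    [v]. *)
Lemma torsion_coprime (R : comNzRingType) (N : lmodType R) (a c x y : R) (v : N) m n :
  x * a + y * c = 1 -> a ^+ m *: v = 0 -> c ^+ n *: v = 0 -> v = 0.
Proof.
move=> xy; elim: m n v => [|m IHm] n v; first by rewrite expr0 scale1r.
elim: n v => [|n IHn] v am cn; first by move: cn; rewrite expr0 scale1r.
have av : a *: v = 0.
  by apply: (IHm n.+1); rewrite scalerA -?exprSr // mulrC -scalerA cn scaler0.
have cv : c *: v = 0.
  by apply: IHn; rewrite scalerA -?exprSr // mulrC -scalerA am scaler0.
by rewrite -[v]scale1r -xy scalerDl -!scalerA av cv !scaler0 addr0.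
Qed.

Lemma square_zero_bracket (R : comNzRingType) (f X : 'M[R]_2) : f *m f = 0 ->
  f *m (f *m X - X *m f) - (f *m X - X *m f) *m f = - 2 *: (f *m X *m f).
Proof.
move=> ff; rewrite mulmxBr mulmxBl !mulmxA ff mul0mx sub0r -[X *m f *m f]mulmxA ff mulmx0.
by rewrite subr0; module.
Qed.

Section Automorphisms.
Variables (F : fieldType) (F2 : (2%:R : F) != 0) (beta : skew_form F).
Variables (L : lieAlgType F) (Psi : sstruct (SL2f F) L) (iota : sl2 F -> L).
Variables (J T D : lmodType F) (dec : isotypic_dec Psi J T D).
Variable JT : coordinatization beta iota dec.
Local Notation jm := (jmul JT).
Local Notation act := (jact (jt_mod JT)).
Local Notation DD := (co_D JT).
Local Notation DJ := (co_DJ JT).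
Variable e : J.
Local Notation J1 := (peirceJ1 JT e).
Local Notation Jh := (peirceJh JT e).
Local Notation J0 := (peirceJ0 JT e).
Local Notation T1 := (peirceT1 JT e).
Local Notation T0 := (peirceT0 JT e).
Hypothesis ee : jm e e = e.
Local Notation th := (theta F2 JT e).
Local Notation elTx := (elTx dec).

(** When [\det m = q ^+ 2] this says that [Xi] is [q ^+ 2] times the action of the
    matrix [m / q], without mentioning denominators. *)
Record acts_as (R : comAlgType F) (Xi : bext L R -> bext L R) (m : 'M[R]_2) (q : R) : Prop := ActsAs {
  acts_lin : linear Xi;
  acts_1 : forall a X, J1 a -> Xi (bten (th a X) 1) = mext (th a) (m *m mxR R X *m \adj m);
  acts_0 : forall a X, J0 a -> Xi (bten (th a X) 1) = mext (th a) (q ^+ 2 *: mxR R X);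
  acts_h : forall a X, Jh a -> Xi (bten (th a X) 1) = mext (th a) (q *: (m *m mxR R X));
  acts_T1 : forall x u, T1 x -> Xi (bten (elTx x u) 1) = mext (elTx x) (q *: (m *m mxR R (u : 'cV_2)));
  acts_T0 : forall x u, T0 x -> Xi (bten (elTx x u) 1) = mext (elTx x) (q ^+ 2 *: mxR R (u : 'cV_2));
  acts_S : forall d, DJ d e = 0 -> Xi (bten (id_D dec d) 1) = bten (id_D dec d) (q ^+ 2)
}.

Section Points.
Variable R : comAlgType F.
Implicit Types (Xi : bext L R -> bext L R) (m : 'M[R]_2) (q : R).

Lemma acts_as_unique Xi Xi' m q : acts_as Xi m q -> acts_as Xi' m q -> Xi =1 Xi'.
Proof.
move=> [Xl X1 X0 Xh XT1 XT0 XS] [Xl' X1' X0' Xh' XT1' XT0' XS'].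
apply: blift_ext => // x.
elim/(peirce_ind (F2 := F2) ee): x => [x y xx xy|a X h|a X h|a X h|u x h|u x h|d h].
- by rewrite btenDl (linD Xl) (linD Xl') xx xy.
- by rewrite X1 ?X1'.
- by rewrite X0 ?X0'.
- by rewrite Xh ?Xh'.
- exact: etrans (XT1 _ _ h) (esym (XT1' _ _ h)).
- exact: etrans (XT0 _ _ h) (esym (XT0' _ _ h)).
- by rewrite XS ?XS'.
Qed.

Lemma acts_as_comp Xi Xi' m m' q q' :
  acts_as Xi m q -> acts_as Xi' m' q' -> acts_as (Xi \o Xi') (m *m m') (q * q').
Proof.
have scal_lin k p : linear (fun A : 'M[R]_(2, p) => k *: A).
  by move=> c A B; rewrite scalerDr !scalerA mulrC.
have smul_lin k p (mm : 'M[R]_2) : linear (fun A : 'M[R]_(2, p) => k *: (mm *m A)).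
  by move=> c A B; rewrite mulmxDr scalerDr -scalemxAr !scalerA mulrC.
move=> [Xl X1 X0 Xh XT1 XT0 XS] [Xl' X1' X0' Xh' XT1' XT0' XS']; split=> /=.
- by move=> c x y; rewrite /= Xl' Xl.
- move=> a X h; rewrite X1' //.
  rewrite (mext_morph (th_linr F2 JT e a) Xl (conj_lin m) (fun X => X1 a X h)).
  by rewrite adj2M !mulmxA.
- move=> a X h; rewrite X0' //.
  rewrite (mext_morph (th_linr F2 JT e a) Xl (scal_lin (q ^+ 2) 2) (fun X => X0 a X h)).
  by rewrite scalerA exprMn.
- move=> a X h; rewrite Xh' //.
  rewrite (mext_morph (th_linr F2 JT e a) Xl (smul_lin q 2 m) (fun X => Xh a X h)).
  by rewrite -scalemxAr scalerA mulmxA.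
- move=> x u h; rewrite XT1' //.
  rewrite (mext_morph (elTx_linr dec x) Xl (smul_lin q 1 m) (fun u => XT1 x u h)).
  by rewrite -scalemxAr scalerA mulmxA.
- move=> x u h; rewrite XT0' //.
  rewrite (mext_morph (elTx_linr dec x) Xl (scal_lin (q ^+ 2) 1) (fun u => XT0 x u h)).
  by rewrite scalerA exprMn.
- move=> d h; rewrite XS' // -[q' ^+ 2]mulr1 -scale_bten (linZ Xl) XS // scale_bten.
  by rewrite exprMn mulrC.
Qed.

Lemma acts_as_scale Xi m q k :
  acts_as Xi m q -> acts_as (fun x => k ^+ 2 *: Xi x) (k *: m) (k * q).
Proof.
move=> [Xl X1 X0 Xh XT1 XT0 XS]; split=> /=.
- by move=> c x y; rewrite Xl scalerDr !scalerA mulrC.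
- move=> a X h; rewrite X1 // -(linZ (mext_lin _)); congr mext.
  rewrite !adj2 mxtraceZ -scale_scalar_mx -scalerBr -!scalemxAl -scalemxAr scalerA.
  by rewrite expr2.
- by move=> a X h; rewrite X0 // -(linZ (mext_lin _)) scalerA exprMn.
- by move=> a X h; rewrite Xh // -(linZ (mext_lin _)) -scalemxAl !scalerA; congr (mext _ (_ *: _)); ring.
- by move=> x u h; rewrite XT1 // -(linZ (mext_lin _)) -scalemxAl !scalerA; congr (mext _ (_ *: _)); ring.
- by move=> x u h; rewrite XT0 // -(linZ (mext_lin _)) scalerA exprMn.
- by move=> d h; rewrite XS // scale_bten exprMn.
Qed.

Lemma lie_elJ_lin f : linear (lie (elJ dec f e)). Proof. exact: lie_linr. Qed.

Lemma ad_cube f : sl2val f *m sl2val f = 0 -> forall x,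
  lie (elJ dec f e) (lie (elJ dec f e) (lie (elJ dec f e) x)) = 0.
Proof.
move=> ff x; have l0 := lin0 (lie_elJ_lin f).
elim/(peirce_ind (F2 := F2) ee): x => [x y xx xy|a X h|a X h|a X h|u x h|u x h|d h].
- by rewrite !(linD (lie_elJ_lin f)) xx xy addr0.
- rewrite !ad_th_1 // square_zero_bracket // mulmxBr mulmxBl !mulmxA ff !mul0mx.
  by rewrite -[_ *m sl2val f *m sl2val f]mulmxA ff mulmx0 subr0 scaler0 (lin0 (th_linr F2 JT e a)).
- by rewrite ad_th_0 ?l0.
- by rewrite !ad_th_h // !mulmxA ff !mul0mx (lin0 (th_linr F2 JT e a)).
- by rewrite !(ad_elT_1 (JT := JT)) // !mulmxA ff !mul0mx; apply: (lin0 (elTx_linr dec x)).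
- by rewrite (ad_elT_0 (JT := JT)) // !l0.
- by rewrite (ad_S (JT := JT)) // !l0.
Qed.

(** For [f ^ 2 = 0] the exponential of [p/q] times [ad (f (x) e)] is the action of
    the unipotent matrix [1 + (p/q) f]. *)
Lemma acts_as_texp f p q : sl2val f *m sl2val f = 0 ->
  acts_as (texp (lie (elJ dec f e)) p q) (q%:M + p *: mxR R (sl2val f)) q.
Proof.
move=> ff; have dl := lie_elJ_lin f.
have bten_mext (m n : nat) (B : 'M[F]_(m, n) -> L) X r : linear B ->
    bten (B X) r = mext B (r *: mxR R X).
  by move=> Bl; rewrite (linZ (mext_lin B)) mext_mxR // scale_bten mulr1.
set f' := mxR R (sl2val f).
have ff' : f' *m f' = 0 by rewrite /f' -mxRM ff /mxR map_mx0.
have tf' : \tr f' = 0.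
  by have := sl2_tr f; rewrite /f' !tr2 !mxE -rmorphD /= => ->; rewrite scale0r.
have pp : p ^+ 2 = 2^-1 *: p ^+ 2 + 2^-1 *: p ^+ 2.
  by rewrite -scalerDr -mulr2n -scaler_nat scalerA mulVf // scale1r.
split=> [|a X h|a X h|a X h|x u h|x u h|s h].
- exact: texp_lin.
- rewrite texpE // !ad_th_1 // !(bten_mext _ _ _ _ _ (th_linr F2 JT e a)).
  rewrite -!(linD (mext_lin _)); congr mext.
  rewrite adj2 mxtraceD mxtrace_scalar mxtraceZ tf' mulr0 addr0.
  rewrite square_zero_bracket // mxRZ !mxRD /mxR !map_mxN !map_mxM /= -!/(mxR R _) -/f'.
  have -> : (q *+ 2)%:M - (q%:M + p *: f') = q%:M - p *: f'.
    by rewrite raddfMn /= mulr2n opprD addrA addrK.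
  have -> : (2^-1 *: p ^+ 2) *: ((- 2)%:A *: (f' *m mxR R X *m f')) = - (p ^+ 2 *: (f' *m mxR R X *m f')).
    have -> : (- 2)%:A = - 2 :> R by rewrite scaleNr scaler_nat.
    rewrite scalerA -scaleNr; congr (_ *: _).
    by move: pp; move: (2^-1 *: p ^+ 2) => h' ->; ring.
  rewrite mulmxBr !mulmxDl !mul_scalar_mx !mul_mx_scalar -!scalemxAl -!scalemxAr.
  by module.
- rewrite texpE // ad_th_0 // (lin0 dl) !bten0l !addr0.
  exact/bten_mext/th_linr.
- rewrite texpE // !ad_th_h // mulmxA ff mul0mx (lin0 (th_linr F2 JT e a)) bten0l addr0.
  rewrite !(bten_mext _ _ _ _ _ (th_linr F2 JT e a)) -(linD (mext_lin _)); congr mext.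
  by rewrite mxRM mulmxDl mul_scalar_mx -scalemxAl; module.
- rewrite texpE // !(ad_elT_1 (JT := JT)) // mulmxA ff mul0mx.
  rewrite (lin0 ((elT_bilin dec).1 _)) bten0l addr0.
  rewrite !(bten_mext _ _ _ _ _ (elTx_linr dec x)) -(linD (mext_lin _)); congr mext.
  by rewrite mxRM mulmxDl mul_scalar_mx -scalemxAl; module.
- rewrite texpE // (ad_elT_0 (JT := JT)) // (lin0 dl) !bten0l !addr0.
  exact/bten_mext/elTx_linr.
- by rewrite texpE // (ad_S (JT := JT)) // (lin0 dl) !bten0l !addr0.
Qed.
End Points.
End Automorphisms.

Section IdempotentStructure.
Variables (F : fieldType) (F2 : (2%:R : F) != 0) (beta : skew_form F).
Variables (L : lieAlgType F) (Psi : sstruct (SL2f F) L) (iota : sl2 F -> L).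
Variables (J T D : lmodType F) (dec : isotypic_dec Psi J T D).
Variable JT : coordinatization beta iota dec.
Local Notation jm := (jmul JT).
Local Notation act := (jact (jt_mod JT)).
Local Notation DD := (co_D JT).
Local Notation DJ := (co_DJ JT).
Variable e : J.
Local Notation J1 := (peirceJ1 JT e).
Local Notation Jh := (peirceJh JT e).
Local Notation J0 := (peirceJ0 JT e).
Local Notation T1 := (peirceT1 JT e).
Local Notation T0 := (peirceT0 JT e).
Hypothesis ee : jm e e = e.
Hypothesis F3 : (3%:R : F) != 0.
Local Notation th := (theta F2 JT e).
Local Notation elTx := (elTx dec).
Local Notation acts_as := (acts_as F2 JT e).
Local Notation coact := (idem_coact F2 JT e).

Lemma coact_acts (R : comAlgType F) (g : SL2 R) : acts_as (blift (coact g)) (SL2val g) 1.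
Proof.
have s := idem_coact_semi F2 JT e g.
split=> [|a X h|a X h|a X h|x u h|x u h|d h]; rewrite ?blift_bten ?scale1r ?expr1n ?scale1r //.
- exact: blift_linear.
- exact: idem_coact_1.
- exact: idem_coact_0.
- exact: idem_coact_h.
- have z v : elTx (x - act e x) v = 0 by rewrite h subrr; exact: lin0 (elTx_linl dec v).
  by rewrite idem_coact_elT (mext_zero _ z) addr0 h.
- have z v : elTx (act e x) v = 0 by rewrite h; exact: lin0 (elTx_linl dec v).
  by rewrite idem_coact_elT (mext_zero _ z) add0r h subr0.
- exact: idem_coact_S.
Qed.

Lemma id_acts (R : comAlgType F) : acts_as (@id (bext L R)) 1%:M 1.
Proof.
have adj1 : \adj (1%:M : 'M[R]_2) = 1%:M by rewrite adj2 mxtrace1 mulr2n raddfD /= addrK.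
split=> [//|a X h|a X h|a X h|x u h|x u h|d h];
  rewrite ?adj1 ?mulmx1 ?mul1mx ?expr1n ?scale1r ?mext_mxR //;
  by [exact: th_linr | exact: elTx_linr].
Qed.

Fact coact1 (R : comAlgType F) x : coact (1%g : SL2f F R) x = bten x 1.
Proof.
rewrite -[RHS](acts_as_unique ee (coact_acts (1%g : SL2 R)) (id_acts R)).
by rewrite blift_bten ?scale1r //; apply: idem_coact_semi.
Qed.

Fact coactM (R : comAlgType F) (g h : SL2f F R) x :
  coact (g * h)%g x = blift (coact g) (coact h x).
Proof.
have := acts_as_comp (coact_acts g) (coact_acts h); rewrite mulr1 => gh.
have := acts_as_unique ee (coact_acts (g * h)%g) gh (bten x 1).
by rewrite /= !blift_bten ?scale1r //; apply: idem_coact_semi.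
Qed.

Fact coact_nat (R R' : comAlgType F) (phi : {lrmorphism R -> R'}) (g : SL2f F R) x :
  bmap phi (coact g x) = coact (gf_map phi g) x.
Proof.
elim/(peirce_ind (F2 := F2) ee): x => [x y xx xy|a X h|a X h|a X h|u x h|u x h|d h].
- have sD (S : comAlgType F) (k : SL2 S) : coact k (x + y) = coact k x + coact k y.
    by have := idem_coact_semi F2 JT e k 1 x y; rewrite !scale1r.
  by rewrite !sD bmapD xx xy.
- by rewrite !idem_coact_1 // bmap_mext !map_mxM map_mxR map_mx_adj.
- by rewrite !idem_coact_0 // bmap_mext map_mxR.
- by rewrite !idem_coact_h // bmap_mext map_mxM map_mxR.
- have z v : elTx (x - act e x) v = 0 by rewrite h subrr; exact: lin0 (elTx_linl dec v).
  rewrite (idem_coact_elT F2 JT e g u x) (idem_coact_elT F2 JT e (gf_map phi g) u x).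
  by rewrite !(mext_zero _ z) !addr0 bmap_mext map_mxM map_mxR.
- have z v : elTx (act e x) v = 0 by rewrite h; exact: lin0 (elTx_linl dec v).
  rewrite (idem_coact_elT F2 JT e g u x) (idem_coact_elT F2 JT e (gf_map phi g) u x).
  by rewrite !(mext_zero _ z) !add0r h subr0 bmap_mext map_mxR.
- by rewrite !idem_coact_S // bmap_bten rmorph1.
Qed.

Definition idem_rep : rep (SL2f F) L :=
  @build_rep F (SL2f F) L (fun R g => coact g) (idem_coact_semi F2 JT e) coact1 coactM coact_nat.

Lemma idem_rep_acts (R : comAlgType F) (g : SL2 R) : acts_as (idem_rep R g) (SL2val g) 1.
Proof. exact: coact_acts. Qed.

Section Automorphism.
Variable R : comAlgType F.
Implicit Types (p q : R).

Lemma sl2E_square : sl2val (sl2E F) *m sl2val (sl2E F) = 0.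
Proof. by apply: mx22P; rewrite !mxE !sum2 !mxE /=; ring. Qed.
Lemma sl2F_square : sl2val (sl2F F) *m sl2val (sl2F F) = 0.
Proof. by apply: mx22P; rewrite !mxE !sum2 !mxE /=; ring. Qed.

(** What products of exponentials of [ad (E (x) e)] and [ad (F (x) e)] have in common,
    once denominators are cleared. *)
Definition unipotent_product (Xi : bext L R -> bext L R) (m : 'M[R]_2) q : Prop :=
  [/\ acts_as Xi m q, linear Xi & similitude Xi (q ^+ 2)].

Lemma unipotent_comp Xi Xi' m m' q q' : unipotent_product Xi m q ->
  unipotent_product Xi' m' q' -> unipotent_product (Xi \o Xi') (m *m m') (q * q').
Proof.
move=> [X1 X2 X3] [Y1 Y2 Y3]; split; first exact: acts_as_comp.
  exact: acts_lin (acts_as_comp X1 Y1).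
by rewrite exprMn; apply: similitude_comp.
Qed.

Lemma unipotent_texp f p q : sl2val f *m sl2val f = 0 ->
  unipotent_product (texp (lie (elJ dec f e)) p q) (q%:M + p *: mxR R (sl2val f)) q.
Proof.
move=> ff; split; [exact: acts_as_texp | apply: texp_lin; exact: lie_elJ_lin|].
exact: (texp_similitude F2 F3 (lie_linr _) (lie_der _) (ad_cube F2 ee ff)).
Qed.

Definition upper p q : 'M[R]_2 := q%:M + p *: mxR R (sl2val (sl2E F)).
Definition lower p q : 'M[R]_2 := q%:M + p *: mxR R (sl2val (sl2F F)).

Lemma exists_upper p q : exists Xi, unipotent_product Xi (upper p q) q.
Proof. by eexists; apply/unipotent_texp/sl2E_square. Qed.
Lemma exists_lower p q : exists Xi, unipotent_product Xi (lower p q) q.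
Proof. by eexists; apply/unipotent_texp/sl2F_square. Qed.

Lemma exists_comp m m' q q' : (exists Xi, unipotent_product Xi m q) ->
  (exists Xi, unipotent_product Xi m' q') -> exists Xi, unipotent_product Xi (m *m m') (q * q').
Proof. by move=> [Xi X] [Xi' X']; exists (Xi \o Xi'); apply: unipotent_comp. Qed.

Lemma upperE p q : [/\ upper p q ord0 ord0 = q, upper p q ord0 ord_max = p,
  upper p q ord_max ord0 = 0 & upper p q ord_max ord_max = q].
Proof. by rewrite !mxE /= !scale1r !scale0r !mulr1 !mulr0 !mulr1n !mulr0n ?addr0 ?add0r. Qed.
Lemma lowerE p q : [/\ lower p q ord0 ord0 = q, lower p q ord0 ord_max = 0,
  lower p q ord_max ord0 = p & lower p q ord_max ord_max = q].
Proof. by rewrite !mxE /= !scale1r !scale0r !mulr1 !mulr0 !mulr1n !mulr0n ?addr0 ?add0r. Qed.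

(** The matrix with rows [0, -1] and [1, 0], as a product of elementary matrices. *)
Definition weyl : 'M[R]_2 := upper (- 1) 1 *m lower 1 1 *m upper (- 1) 1.

Lemma weylE : [/\ weyl ord0 ord0 = 0, weyl ord0 ord_max = - 1,
  weyl ord_max ord0 = 1 & weyl ord_max ord_max = 0].
Proof.
have [u1 u2 u3 u4] := upperE (- 1) 1; have [l1 l2 l3 l4] := lowerE 1 1.
rewrite /weyl; move: (upper _ _) (lower _ _) u1 u2 u3 u4 l1 l2 l3 l4 => U W u1 u2 u3 u4 l1 l2 l3 l4.
by rewrite !mxE !sum2 !mxE !sum2 u1 u2 u3 u4 l1 l2 l3 l4; split; ring.
Qed.

Lemma exists_weyl : exists Xi, unipotent_product Xi weyl 1.
Proof.
have := exists_comp (exists_comp (exists_upper (-1) 1) (exists_lower 1 1)) (exists_upper (-1) 1).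
by rewrite !mulr1.
Qed.

(** When [a] is invertible, [g] is a product of elementary matrices with
    denominators [a]; clearing them gives [a ^+ 3 *: g]. *)
Lemma exists_factorization (g : SL2 R) (a := SL2val g ord0 ord0) :
  exists Xi, unipotent_product Xi (a ^+ 3 *: SL2val g) (a ^+ 3).
Proof.
set b := SL2val g ord0 ord_max; set c := SL2val g ord_max ord0; set d := SL2val g ord_max ord_max.
have dt : a * d = 1 + b * c.
  by have /eqP := SL2_det g; rewrite det2 -/a -/b -/c -/d => <-; ring.
have := exists_comp (exists_comp (exists_comp (exists_comp (exists_comp (exists_lower c a)
  (exists_upper a 1)) (exists_lower (- 1) a)) (exists_upper a 1)) exists_weyl) (exists_upper b a).
have -> : a * 1 * a * 1 * 1 * a = a ^+ 3 by ring.
suff -> : lower c a *m upper a 1 *m lower (-1) a *m upper a 1 *m weyl *m upper b a = a ^+ 3 *: SL2val g by [].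
have [l1 l2 l3 l4] := lowerE c a; have [m1 m2 m3 m4] := lowerE (- 1) a.
have [u1 u2 u3 u4] := upperE a 1; have [v1 v2 v3 v4] := upperE b a.
have [w1 w2 w3 w4] := weylE.
move: (lower c a) (lower (-1) a) (upper a 1) (upper b a) weyl l1 l2 l3 l4 m1 m2 m3 m4 u1 u2 u3 u4
  v1 v2 v3 v4 w1 w2 w3 w4 => X1 X2 X3 X4 X5 l1 l2 l3 l4 m1 m2 m3 m4 u1 u2 u3 u4 v1 v2 v3 v4 w1 w2 w3 w4.
(* The four factors in the middle multiply to the diagonal matrix of [a ^+ 2] and [1]. *)
have h12 : X2 *m X3 = \matrix_(i, j) if i == ord0 then (if j == ord0 then a else a * a)
                                    else (if j == ord0 then - 1 else 0).
  by apply: mx22P; rewrite !mxE !sum2 ?l1 ?l2 ?l3 ?l4 ?m1 ?m2 ?m3 ?m4 ?u1 ?u2 ?u3 ?u4 /=; ring.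
have h123 : X3 *m (X2 *m X3) *m X5 = \matrix_(i, j) if i == ord0 then (if j == ord0 then a * a else 0)
                                    else (if j == ord0 then 0 else 1).
  by rewrite h12; apply: mx22P; rewrite !mxE !sum2 !mxE !sum2 !mxE ?u1 ?u2 ?u3 ?u4 ?w1 ?w2 ?w3 ?w4 /=; ring.
rewrite -[X1 *m X3 *m X2 *m X3]mulmxA -[X1 *m X3 *m _]mulmxA -[X1 *m _ *m X5]mulmxA h123.
apply: mx22P; rewrite !mxE !sum2 !mxE !sum2 !mxE ?l1 ?l2 ?l3 ?l4 ?v1 ?v2 ?v3 ?v4 /= -?/a -?/b -?/c -?/d.
- ring.
- ring.
- ring.
- by transitivity (a ^+ 2 * (1 + b * c)); [ring | rewrite -dt; ring].
Qed.

(** The failure of [g] to act by an automorphism. *)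
Definition defect (g : SL2 R) x y : bext L R :=
  blie (idem_rep R g x) (idem_rep R g y) - idem_rep R g (blie x y).

(** By the factorization, [a ^+ 6] times the action of [g] multiplies brackets by
    [a ^+ 6]. *)
Lemma defect_torsion (g : SL2 R) x y : SL2val g ord0 ord0 ^+ 12 *: defect g x y = 0.
Proof.
set a := SL2val g ord0 ord0; have [Xi [Xg Xl Xs]] := exists_factorization g.
have XiE : Xi =1 fun x => (a ^+ 3) ^+ 2 *: idem_rep R g x.
  have := acts_as_scale (a ^+ 3) (idem_rep_acts g); rewrite mulr1 => Xa.
  exact: (acts_as_unique ee Xg Xa).
have := Xs x y; rewrite !XiE (linZ (blie_linl _)) (linZ (blie_linr _)) !scalerA.
rewrite -/a -!exprM -!exprD => h.
by rewrite /defect scalerBr h subrr.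
Qed.

Lemma weyl_det : \det weyl == 1.
Proof. by have [w1 w2 w3 w4] := weylE; rewrite det2 w1 w2 w3 w4; apply/eqP; ring. Qed.

Lemma defect_weyl x y : defect (MkSL2 weyl_det) x y = 0.
Proof.
have [Xi [Xw Xl Xs]] := exists_weyl.
have XiE : Xi =1 idem_rep R (MkSL2 weyl_det).
  exact: (acts_as_unique ee Xw (idem_rep_acts (MkSL2 weyl_det))).
by rewrite /defect -!XiE Xs expr1n scale1r subrr.
Qed.

(** Multiplying [g] by the Weyl element brings the other entry [c] of the first column
    to the corner, so the defect is killed by powers of [a] and of [c]; these entries
    are coprime since [g] has determinant 1. *)
Lemma defect_eq0 (g : SL2 R) x y : defect g x y = 0.
Proof.
set w := MkSL2 weyl_det; set a := SL2val g ord0 ord0; set c := SL2val g ord_max ord0.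
have wg : defect (w * g)%g x y = idem_rep R w (defect g x y).
  rewrite /defect !ractM (linD (ract_lin _ _)) (linN (ract_lin _ _)).
  have /eqP := defect_weyl (idem_rep R g x) (idem_rep R g y).
  by rewrite subr_eq0 => /eqP ->.
have cg : c ^+ 12 *: defect g x y = 0.
  have := defect_torsion (w * g)%g x y; rewrite wg.
  have -> : SL2val (w * g)%g ord0 ord0 = - c.
    by have [w1 w2 _ _] := weylE; rewrite [LHS]mxE sum2 /= w1 w2 mul0r add0r mulN1r.
  have -> : (- c) ^+ 12 = c ^+ 12 by ring.
  rewrite -(linZ (ract_lin idem_rep _)) => /(congr1 (idem_rep R w^-1%g)).
  by rewrite -ractM mulVg ract1 (lin0 (ract_lin _ _)).
apply: (torsion_coprime (a := a) (c := c) (x := SL2val g ord_max ord_max) (y := - SL2val g ord0 ord_max)) cg.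
  by have /eqP := SL2_det g; rewrite det2 -/a -/c => <-; ring.
exact: defect_torsion.
Qed.
End Automorphism.

Fact idem_rep_lie (R : comAlgType F) (g : SL2 R) x y :
  idem_rep R g (blie x y) = blie (idem_rep R g x) (idem_rep R g y).
Proof. by have /eqP := defect_eq0 g x y; rewrite subr_eq0 => /eqP. Qed.

End IdempotentStructure.

(** * Two commuting actions *)

Section CommutingActions.
Variables (F : fieldType) (S S' : groupFunctor F) (M : lmodType F).
Variables (rho : rep S M) (sigma : rep S' M).
Hypothesis comm : forall (R : comAlgType F) (g : S R) (h : S' R) x,
  rho R g (sigma R h x) = sigma R h (rho R g x).

Fact prod_act_lin (R : comAlgType F) (g : prodf S S' R) :
  linear (fun x => rho R g.1 (sigma R g.2 x)).
Proof. by move=> c x y; rewrite !ract_lin. Qed.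
Fact prod_act1 (R : comAlgType F) x :
  rho R (1%g : prodf S S' R).1 (sigma R (1%g : prodf S S' R).2 x) = x.
Proof. by rewrite /= !ract1. Qed.
Fact prod_actM (R : comAlgType F) (g h : prodf S S' R) x :
  rho R (g * h)%g.1 (sigma R (g * h)%g.2 x) =
  rho R g.1 (sigma R g.2 (rho R h.1 (sigma R h.2 x))).
Proof. by rewrite /= !ractM -!comm. Qed.
Fact prod_act_nat (R R' : comAlgType F) (phi : {lrmorphism R -> R'}) (g : prodf S S' R) x :
  bmap phi (rho R g.1 (sigma R g.2 x)) =
  rho R' (gf_map phi g).1 (sigma R' (gf_map phi g).2 (bmap phi x)).
Proof. by rewrite !ract_nat. Qed.
Definition prod_rep : rep (prodf S S') M :=
  Rep prod_act_lin prod_act1 prod_actM prod_act_nat.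

Lemma prod_diff (d : gf_lie S -> M -> M) (d' : gf_lie S' -> M -> M) :
  (forall X, linear (d X)) -> is_differential rho d -> is_differential sigma d' ->
  is_differential prod_rep (fun X x => d X.1 x + d' X.2 x).
Proof.
move=> dl dr ds X x /=; rewrite /pf_eps /= ds (linD (ract_lin rho _)) dr.
rewrite -[eps F in X in _ + X]mulr1 -scale_bten (linZ (ract_lin rho _)) dr scalerDr.
by rewrite !scale_bten mulr1 eps2 bten0r addr0 btenDl addrA.
Qed.
End CommutingActions.

Section TwoIdempotents.
Variables (F : fieldType) (F2 : (2%:R : F) != 0) (beta : skew_form F).
Variables (L : lieAlgType F) (Psi : sstruct (SL2f F) L) (iota : sl2 F -> L).
Variables (J T D : lmodType F) (dec : isotypic_dec Psi J T D).
Variable JT : coordinatization beta iota dec.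
Local Notation jm := (jmul JT).
Local Notation act := (jact (jt_mod JT)).
Local Notation DD := (co_D JT).
Local Notation DJ := (co_DJ JT).
Variable e : J.
Local Notation J1 := (peirceJ1 JT e).
Local Notation Jh := (peirceJh JT e).
Local Notation J0 := (peirceJ0 JT e).
Local Notation T1 := (peirceT1 JT e).
Local Notation T0 := (peirceT0 JT e).
Hypothesis ee : jm e e = e.
Hypothesis F3 : (3%:R : F) != 0.
Local Notation th := (theta F2 JT e).
Local Notation elTx := (elTx dec).
Local Notation f := (jone JT - e).

Lemma idem_compl : jm f f = f.
Proof.
rewrite (linD (jm_linl JT f)) (linN (jm_linl JT f)) jmul1 (linD (jm_linr JT e)).
by rewrite (linN (jm_linr JT e)) jmr1 ee subrr subr0.
Qed.

Lemma jm_compl a : jm f a = a - jm e a.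
Proof. by rewrite (linD (jm_linl JT a)) (linN (jm_linl JT a)) jmul1. Qed.

Lemma DD_compl a : DD f a = - DD e a.
Proof. by rewrite (linD (DD_linl JT a)) (linN (DD_linl JT a)) DD_1l ?add0r. Qed.

Lemma DJ_one d : DJ d (jone JT) = 0.
Proof.
have := DJ_der F2 JT d (jone JT) (jone JT); rewrite !jmul1 jmr1 => /eqP.
by rewrite eq_sym -subr_eq0 addrK => /eqP.
Qed.

Lemma DJ_compl d : DJ d f = - DJ d e.
Proof. by rewrite (linD (DJ_linr JT d)) (linN (DJ_linr JT d)) DJ_one add0r. Qed.

Lemma act_compl x : act f x = x - act e x.
Proof. by rewrite (linD (act_linl JT x)) (linN (act_linl JT x)) jact1. Qed.

Lemma J1_compl a : peirceJ1 JT f a <-> J0 a.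
Proof.
rewrite /peirceJ1 /peirceJ0 /= jm_compl; split=> [|->]; last by rewrite subr0.
by move/eqP; rewrite subr_eq addrC -subr_eq subrr => /eqP <-.
Qed.
Lemma J0_compl a : peirceJ0 JT f a <-> J1 a.
Proof.
rewrite /peirceJ1 /peirceJ0 /= jm_compl; split=> [|->]; last by rewrite subrr.
by move/eqP; rewrite subr_eq0 => /eqP <-.
Qed.
Lemma Jh_compl a : peirceJh JT f a <-> Jh a.
Proof.
by rewrite !(JhE F2) jm_compl; split=> h; apply: (eq_from_mul (k := - 1) h); module.
Qed.
Lemma T1_compl x : peirceT1 JT f x <-> T0 x.
Proof.
rewrite /peirceT1 /peirceT0 /= act_compl; split=> [|->]; last by rewrite subr0.
by move/eqP; rewrite subr_eq addrC -subr_eq subrr => /eqP <-.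
Qed.
Lemma T0_compl x : peirceT0 JT f x <-> T1 x.
Proof.
rewrite /peirceT1 /peirceT0 /= act_compl; split=> [|->]; last by rewrite subrr.
by move/eqP; rewrite subr_eq0 => /eqP <-.
Qed.

Lemma th_compl_diag a X : J1 a \/ J0 a -> theta F2 JT f a X = th a X.
Proof.
move=> ha; have D0 : DD e a = 0 by case: ha; [exact: DDe_J1 | exact: DDe_J0].
by rewrite /theta DD_compl D0 oppr0.
Qed.

(** Passing from [e] to [1 - e] changes the sign of [D_{e,a}], hence exchanges the two
    sides of a matrix: [\adj X] has the trace of [X] and the opposite traceless part. *)
Lemma th_compl a X : th a X = - theta F2 JT f a (\adj X).
Proof.
rewrite /theta DD_compl (linN (id_D_lin dec)).
have -> : \tr (\adj X) = \tr X by rewrite adj2 raddfB /= mxtrace_scalar mulr2n addrK.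
rewrite adj2 (linD (dev_lin F2)) dev_scalar (linN (dev_lin F2)) add0r.
by rewrite (linN ((elJ_bilin dec).1 a)); module.
Qed.

(** The actions of the two copies of SL2. *)
Definition Phi1 : rep (SL2f F) L := idem_rep F2 ee.
Definition Phi0 : rep (SL2f F) L := idem_rep F2 idem_compl.

Section Points.
Variable R : comAlgType F.
Implicit Type g : SL2 R.

Lemma Phi1_J1 g a X : J1 a -> Phi1 R g (bten (th a X) 1) =
  mext (th a) (SL2val g *m mxR R X *m \adj (SL2val g)).
Proof. exact: (acts_1 (idem_rep_acts F2 ee g)). Qed.
Lemma Phi1_J0 g a X : J0 a -> Phi1 R g (bten (th a X) 1) = bten (th a X) 1.
Proof.
move=> h; rewrite (acts_0 (idem_rep_acts F2 ee g)) // expr1n scale1r mext_mxR //.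
exact: th_linr.
Qed.
Lemma Phi1_Jh g a X : Jh a -> Phi1 R g (bten (th a X) 1) = mext (th a) (SL2val g *m mxR R X).
Proof. by move=> h; rewrite (acts_h (idem_rep_acts F2 ee g)) // scale1r. Qed.
Lemma Phi1_T1 g x u : T1 x ->
  Phi1 R g (bten (elTx x u) 1) = mext (elTx x) (SL2val g *m mxR R (u : 'cV_2)).
Proof. by move=> h; rewrite (acts_T1 (idem_rep_acts F2 ee g)) // scale1r. Qed.
Lemma Phi1_T0 g x u : T0 x -> Phi1 R g (bten (elTx x u) 1) = bten (elTx x u) 1.
Proof.
move=> h; rewrite (acts_T0 (idem_rep_acts F2 ee g)) // expr1n scale1r mext_mxR //.
exact: elTx_linr.
Qed.
Lemma Phi1_S g d : DJ d e = 0 -> Phi1 R g (bten (id_D dec d) 1) = bten (id_D dec d) 1.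
Proof. by move=> h; rewrite (acts_S (idem_rep_acts F2 ee g)) // expr1n. Qed.

Local Notation acts0 := (idem_rep_acts F2 idem_compl).

Lemma mext_compl a (A : 'M[R]_2) : mext (theta F2 JT f a) A = - mext (th a) (\adj A).
Proof.
have Tl : linear (fun A : 'M[R]_2 => - \adj A).
  by move=> c U W; rewrite adj2_lin opprD scalerN.
rewrite -(linN (mext_lin _)); apply: (mext_morph (Xi := id) (th_linr F2 JT f a) _ Tl) => // X.
rewrite (linN (mext_lin _)) /mxR -map_mx_adj mext_mxR; last exact: th_linr.
by rewrite th_compl adj2K btenNl opprK.
Qed.

Lemma Phi0_J1 g a X : J1 a -> Phi0 R g (bten (th a X) 1) = bten (th a X) 1.
Proof.
move=> h; rewrite -[th a X]th_compl_diag; last by left.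
rewrite (acts_0 (acts0 g)); last exact/J0_compl.
by rewrite expr1n scale1r mext_mxR //; apply: th_linr.
Qed.
Lemma Phi0_J0 g a X : J0 a -> Phi0 R g (bten (th a X) 1) =
  mext (th a) (SL2val g *m mxR R X *m \adj (SL2val g)).
Proof.
move=> h; rewrite -[th a X]th_compl_diag; last by right.
rewrite (acts_1 (acts0 g)); last exact/J1_compl.
by apply: eq_mext => Y; apply: th_compl_diag; right.
Qed.
Lemma Phi0_Jh g a X : Jh a -> Phi0 R g (bten (th a X) 1) =
  mext (th a) (mxR R X *m \adj (SL2val g)).
Proof.
move=> h; rewrite th_compl btenNl (linN (acts_lin (acts0 g))) (acts_h (acts0 g)); last exact/Jh_compl.
by rewrite mext_compl opprK scale1r adj2M /mxR map_mx_adj adj2K.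
Qed.
Lemma Phi0_T1 g x u : T1 x -> Phi0 R g (bten (elTx x u) 1) = bten (elTx x u) 1.
Proof.
move=> h; rewrite (acts_T0 (acts0 g)) ?expr1n ?scale1r ?mext_mxR //; last exact/T0_compl.
exact: elTx_linr.
Qed.
Lemma Phi0_T0 g x u : T0 x ->
  Phi0 R g (bten (elTx x u) 1) = mext (elTx x) (SL2val g *m mxR R (u : 'cV_2)).
Proof. by move=> h; rewrite (acts_T1 (acts0 g)) ?scale1r //; apply/T1_compl. Qed.
Lemma Phi0_S g d : DJ d e = 0 -> Phi0 R g (bten (id_D dec d) 1) = bten (id_D dec d) 1.
Proof.
by move=> h; rewrite (acts_S (acts0 g)) ?expr1n // DJ_compl h oppr0.
Qed.

Lemma mulmxr_lin m (A : 'M[R]_2) : linear (fun B : 'M[R]_(m, 2) => B *m A).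
Proof. by move=> c B C; rewrite mulmxDl -scalemxAl. Qed.

(** On the [Jh]-part one copy multiplies on the left, the other one on the right; on
    the other parts one of them acts trivially. *)
Lemma Phi1_Phi0_comm g h x : Phi1 R g (Phi0 R h x) = Phi0 R h (Phi1 R g x).
Proof.
have l1 := ract_lin Phi1 (g : SL2f F R); have l0 := ract_lin Phi0 (h : SL2f F R).
apply: (blift_ext (f := fun x => Phi1 R g (Phi0 R h x))
                  (g := fun x => Phi0 R h (Phi1 R g x))).
- by move=> c u v; rewrite l0 l1.
- by move=> c u v; rewrite l1 l0.
move=> {}x; elim/(peirce_ind (F2 := F2) ee): x => [x y xx xy|a X ha|a X ha|a X ha|u x hx|u x hx|d hd].
- by rewrite btenDl !(linD l0, linD l1) xx xy.
- rewrite Phi0_J1 // Phi1_J1 //; symmetry; apply: mext_fixed => // Y; exact: Phi0_J1.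
- rewrite Phi1_J0 // Phi0_J0 //; apply: mext_fixed => // Y; exact: Phi1_J0.
- rewrite Phi1_Jh // Phi0_Jh //.
  rewrite (mext_morph (th_linr F2 JT e a) l1 (mulmx_lin (SL2val g)) (fun Y => Phi1_Jh g Y ha)).
  rewrite (mext_morph (th_linr F2 JT e a) l0 (mulmxr_lin (\adj (SL2val h))) (fun Y => Phi0_Jh h Y ha)).
  by rewrite mulmxA.
- rewrite (Phi0_T1 h u hx) (Phi1_T1 g u hx); symmetry.
  by apply: mext_fixed => // v; exact: Phi0_T1.
- rewrite (Phi1_T0 g u hx) (Phi0_T0 h u hx).
  by apply: mext_fixed => // v; exact: Phi1_T0.
- by rewrite Phi0_S // Phi1_S // Phi0_S.
Qed.
End Points.
End TwoIdempotents.

(** * Standard modules in terms of matrices *)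

Section MatrixUnits.
Variables (F : fieldType) (F2 : (2%:R : F) != 0).

Lemma dev_delta00 : dev F2 (delta_mx ord0 ord0) = 2^-1 *: sl2H F.
Proof.
have h : 1 - 2^-1 = 2^-1 :> F.
  by apply: (mulfI F2); rewrite mulrBr mulfV // mulr1 addrK.
apply: sl2P; rewrite sl2valZ /= tr2 !mxE /= addr0 mulr1.
by apply: mx22P; rewrite !mxE /= ?mulr1n ?mulr0n ?h; ring.
Qed.
Lemma dev_delta11 : dev F2 (delta_mx ord_max ord_max) = - (2^-1 *: sl2H F).
Proof.
rewrite -dev_delta00; apply/eqP; rewrite -addr_eq0 -(linD (dev_lin F2)).
have -> : delta_mx ord_max ord_max + delta_mx ord0 ord0 = 1%:M :> 'M[F]_2.
  by apply: mx22P; rewrite !mxE /= ?addr0 ?add0r.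
by rewrite dev_scalar.
Qed.
Lemma dev_delta01 : dev F2 (delta_mx ord0 ord_max) = sl2E F.
Proof. by rewrite -[sl2E F](dev_sl2 F2). Qed.
Lemma dev_delta10 : dev F2 (delta_mx ord_max ord0) = sl2F F.
Proof. by rewrite -[sl2F F](dev_sl2 F2). Qed.
End MatrixUnits.

Section StandardModules.
Variables (F : fieldType) (F2 : (2%:R : F) != 0) (R : comAlgType F).

Lemma sl2_of_mext (A : 'M[R]_2) : \tr A = 0 -> sl2_of A = mext (dev F2) A.
Proof.
move=> tA; have A11 : A ord_max ord_max = - A ord0 ord0.
  by apply/eqP; rewrite -addr_eq0 addrC -tr2 tA.
have h : 2^-1 + 2^-1 = 1 :> F by rewrite -mulr2n -[LHS]mulr_natl mulfV.
rewrite /mext !sum2 dev_delta00 dev_delta11 dev_delta01 dev_delta10 A11 btenNl -[- A _ _]mulN1r -scale_bten scaleN1r opprK.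
rewrite /sl2_of !btenZl.
have -> : bten (sl2H F) (A ord0 ord0) =
    bten (sl2H F) (2^-1 *: A ord0 ord0) + bten (sl2H F) (2^-1 *: A ord0 ord0).
  by rewrite -btenDr -scalerDl h scale1r.
module.
Qed.

Lemma ad_act_mext (g : SL2 R) f :
  ad_rep F R g (bten f 1) = mext (dev F2) (SL2val g *m mxR R (sl2val f) *m \adj (SL2val g)).
Proof.
rewrite /= /bact blift_bten ?scale1r; last exact: ad_act_semi.
rewrite /ad_act -sl2_of_mext //= mxtrace_mulC mulmxA SL2_adjM mul1mx.
by have := sl2_tr f; rewrite !tr2 !mxE -rmorphD /= => ->; rewrite scale0r.
Qed.

Lemma nat_act_mext (g : SL2 R) (u : natmod F) :
  nat_rep F R g (bten u 1) = mext (fun v : 'cV_2 => v : natmod F) (SL2val g *m mxR R (u : 'cV_2)).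
Proof.
rewrite /= /bact blift_bten ?scale1r; last exact: natmod_act_semi.
by rewrite /natmod_act /natmod_of /mext; apply: eq_bigr => i _; rewrite big_ord1.
Qed.

Lemma bbil_mextl m n (M N P : lmodType F) (B : M -> N -> P) (C : 'M[F]_(m, n) -> M) A y :
  bilin B -> bbil B (mext C A) (bten y 1 : bext N R) = mext (fun X => B (C X) y) A.
Proof.
move=> b; rewrite /mext (lin_sum (bbil_linl b _)); apply: eq_bigr => i _.
rewrite (lin_sum (bbil_linl b _)); apply: eq_bigr => j _.
by rewrite (bbil_bten b) mulr1.
Qed.

Lemma tens_act_bten (S : groupFunctor F) (M N : lmodType F) (rho : rep S M) (sigma : rep S N)
    (g : S R) m n : tens_rep rho sigma R g (bten (tens m n) 1) =
  bbil (@tens F M N) (rho R g (bten m 1)) (sigma R g (bten n 1)).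
Proof.
by rewrite /= /bact blift_bten ?scale1r ?tens_actE //; apply: tens_act_semi.
Qed.
End StandardModules.

Lemma rep_hom_bten (F : fieldType) (S : groupFunctor F) (M N : lmodType F) (rho : rep S M)
    (sigma : rep S N) (h : M -> N) : linear h ->
  (forall (R : comAlgType F) (g : S R) m,
     blin h (rho R g (bten m 1)) = sigma R g (bten (h m) 1)) -> rep_hom rho sigma h.
Proof.
move=> hl hh; split=> // R g x; have bl := @blin_lin _ _ _ R _ hl.
apply: (blift_ext (f := fun x => blin h (rho R g x)) (g := fun x => sigma R g (blin h x))) => [c u v|c u v|m].
- by rewrite (ract_lin rho) bl.
- by rewrite bl (ract_lin sigma).
- by rewrite hh blin_bten.
Qed.

(** The isomorphism from the tensor square of the natural module to the matrices,
    under which left and right multiplication by [g] and [\adj h] act on the factors. *)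
Section TensorSquare.
Variable F : fieldType.

(** The matrix of the invariant symplectic form, which turns [g^T] into [\adj g]. *)
Definition symp (R : comNzRingType) : 'M[R]_2 := delta_mx ord0 ord_max - delta_mx ord_max ord0.

Lemma symp_adj (R : comNzRingType) (g : 'M[R]_2) : g^T *m symp R = symp R *m \adj g.
Proof. by rewrite adj2 tr2; apply: mx22P; rewrite !mxE !sum2 !mxE /=; ring. Qed.

Lemma symp_square (R : comNzRingType) : symp R *m symp R = - 1%:M.
Proof. by apply: mx22P; rewrite !mxE !sum2 !mxE /=; ring. Qed.

Lemma symp_mxR (R : comAlgType F) : mxR R (symp F) = symp R.
Proof. by rewrite /symp mxRD /mxR map_mxN -!/(mxR R _) !mxR_delta. Qed.

Definition outer (u v : natmod F) : 'M[F]_2 := (u : 'cV_2) *m (v : 'cV_2)^T *m symp F.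
Lemma outer_bilin : bilin outer.
Proof.
split=> [v | u] c x y; rewrite /outer /=.
  have e (x' y' : 'cV[F]_2) w : (c *: x' + y') *m w *m symp F =
      c *: (x' *m w *m symp F) + y' *m w *m symp F by rewrite !mulmxDl -!scalemxAl.
  exact: e.
have e (x' y' : 'cV[F]_2) w : w *m (c *: x' + y')^T *m symp F =
    c *: (w *m x'^T *m symp F) + w *m y'^T *m symp F.
  by rewrite linearP /= (mulmxDr w) mulmxDl -scalemxAr -scalemxAl.
exact: e.
Qed.
Definition tens_mx : tensor (natmod F) (natmod F) -> 'M[F]_2 := tlift outer.
Definition mx_tens (X : 'M[F]_2) : tensor (natmod F) (natmod F) :=
  \sum_i \sum_j (X *m - symp F) i j *: tens (delta_mx i ord0 : natmod F) (delta_mx j ord0 : natmod F).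

Lemma tens_mx_lin : linear tens_mx. Proof. exact/tlift_linear/outer_bilin. Qed.
Lemma tens_mx_tens u v : tens_mx (tens u v) = outer u v.
Proof. exact/tlift_tens/outer_bilin. Qed.

Lemma mx_tens_lin : linear mx_tens.
Proof.
move=> c X Y; rewrite /mx_tens scaler_sumr -big_split; apply: eq_bigr => i _ /=.
rewrite scaler_sumr -big_split; apply: eq_bigr => j _ /=.
by rewrite mulmxDl -scalemxAl !mxE scalerDl scalerA.
Qed.

Lemma mx_tensK : cancel mx_tens tens_mx.
Proof.
move=> X; transitivity (X *m - symp F *m symp F); last first.
  by rewrite -mulmxA mulNmx symp_square opprK mulmx1.
rewrite [X *m _]matrix_sum_delta /mx_tens (lin_sum tens_mx_lin) mulmx_suml; apply: eq_bigr => i _.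
rewrite (lin_sum tens_mx_lin) mulmx_suml; apply: eq_bigr => j _.
rewrite (linZ tens_mx_lin) tens_mx_tens /outer -scalemxAl; congr (_ *: (_ *m _)).
by rewrite trmx_delta mul_delta_mx.
Qed.

Lemma tens_mxK : cancel tens_mx mx_tens.
Proof.
have tb := tens_bilin (natmod F) (natmod F).
apply: (tensor_ext (f := mx_tens \o tens_mx) (g := id)) => [x y|//|u v] /=.
  by rewrite (linD tens_mx_lin) (linD mx_tens_lin).
rewrite tens_mx_tens /mx_tens /outer -[_ *m symp F *m _]mulmxA mulmxN symp_square opprK mulmx1.
rewrite {2}(natmod_eta u) (lin_sum (tb.1 v)); apply: eq_bigr => i _.
rewrite (linZ (tb.1 v)) {2}(natmod_eta v) (lin_sum (tb.2 _)) scaler_sumr.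
apply: eq_bigr => j _; rewrite (linZ (tb.2 _)) scalerA; congr (_ *: _).
by rewrite !mxE big_ord1 !mxE.
Qed.

(** Both sides are bilinear in the two factors of [t], and on [u (x) v] the identity is
    [(g u) (h v)^T s = g (u v^T s) \adj h], where [s] is [symp]. *)
Lemma nat10_tens_mx (R : comAlgType F) (g : SL2SL2f F R) (L : lmodType F)
    (B : 'M[F]_2 -> L) t : linear B ->
  blin (B \o tens_mx) (nat10_rep F R g (bten t 1)) =
  mext B (SL2val g.1 *m mxR R (tens_mx t) *m \adj (SL2val g.2)).
Proof.
move=> Bl; have tb := tens_bilin (natmod F) (natmod F).
have hl : linear (B \o tens_mx) by move=> c x y; rewrite /= tens_mx_lin Bl.
have bl := @blin_lin _ _ _ R _ hl.
have outR (w w' : 'cV[R]_2) :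
    blin (B \o tens_mx) (bbil (@tens F (natmod F) (natmod F))
      (mext (fun v : 'cV_2 => v : natmod F) w) (mext (fun v : 'cV_2 => v : natmod F) w')) =
    mext B (w *m w'^T *m symp R).
  have idl : linear (fun v : 'cV[F]_2 => v : natmod F) by [].
  apply: (mext_morph (Xi := fun x => blin (B \o tens_mx) (bbil (@tens F (natmod F) (natmod F)) x
      (mext (fun v : 'cV_2 => v : natmod F) w'))) (T := fun w => w *m w'^T *m symp R) idl) w.
  - by move=> c x y; rewrite (bbil_linl tb) bl.
  - by move=> c x y; rewrite !mulmxDl -!scalemxAl.
  move=> u.
  apply: (mext_morph (Xi := fun y => blin (B \o tens_mx) (bbil (@tens F (natmod F) (natmod F))
      (bten (u : natmod F) 1) y)) (T := fun w' => mxR R u *m w'^T *m symp R) idl) w'.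
  - by move=> c x y; rewrite (bbil_linr tb) bl.
  - by move=> c x y; rewrite linearP /= (mulmxDr (mxR R u)) mulmxDl -scalemxAr -scalemxAl.
  move=> v; rewrite (bbil_bten tb) mulr1 blin_bten // -symp_mxR /mxR map_trmx -!map_mxM.
  by rewrite -/(mxR R _) mext_mxR //= tens_mx_tens.
apply: (tensor_ext (f := fun t => blin (B \o tens_mx) (nat10_rep F R g (bten t 1)))
  (g := fun t => mext B (SL2val g.1 *m mxR R (tens_mx t) *m \adj (SL2val g.2)))) => [x y|x y|u v].
- by rewrite btenDl (linD (ract_lin _ _)) (linD bl).
- by rewrite (linD tens_mx_lin) mxRD mulmxDr mulmxDl (linD (mext_lin _)).
rewrite tens_act_bten (nat_act_mext g.1 u : nat1_rep F R g _ = _).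
rewrite (nat_act_mext g.2 v : nat0_rep F R g _ = _) outR tens_mx_tens; congr mext.
rewrite trmx_mul -!mulmxA symp_adj -symp_mxR; congr (_ *m _).
by rewrite /outer !mxRM !mulmxA /mxR map_trmx.
Qed.
End TensorSquare.

(** * The structure of type SL2 x SL2 *)

Section ProductStructure.
Variables (F : fieldType) (F2 : (2%:R : F) != 0) (beta : skew_form F).
Variables (L : lieAlgType F) (Psi : sstruct (SL2f F) L) (iota : sl2 F -> L).
Variables (J T D : lmodType F) (dec : isotypic_dec Psi J T D).
Variable JT : coordinatization beta iota dec.
Local Notation jm := (jmul JT).
Local Notation act := (jact (jt_mod JT)).
Local Notation DD := (co_D JT).
Local Notation DJ := (co_DJ JT).
Variable e : J.
Local Notation J1 := (peirceJ1 JT e).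
Local Notation Jh := (peirceJh JT e).
Local Notation J0 := (peirceJ0 JT e).
Local Notation T1 := (peirceT1 JT e).
Local Notation T0 := (peirceT0 JT e).
Hypothesis ee : jm e e = e.
Hypothesis F3 : (3%:R : F) != 0.
Local Notation th := (theta F2 JT e).
Local Notation elTx := (elTx dec).
Local Notation f := (jone JT - e).

Definition Phi_rep : rep (SL2SL2f F) L := @prod_rep F (SL2f F) (SL2f F) L (Phi1 F2 ee) (Phi0 F2 ee) (Phi1_Phi0_comm F2 ee).

Fact Phi_lie (R : comAlgType F) (g : SL2SL2f F R) x y :
  Phi_rep R g (blie x y) = blie (Phi_rep R g x) (Phi_rep R g y).
Proof.
exact: (etrans (congr1 (Phi1 F2 ee R g.1) (idem_rep_lie F2 (idem_compl ee) F3 g.2 x y))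
  (idem_rep_lie F2 ee F3 g.1 _ _)).
Qed.
Definition Phi : sstruct (SL2SL2f F) L := SStruct Phi_lie.

Section Points.
Variable R : comAlgType F.
Implicit Type g : SL2SL2f F R.

Lemma PhiE g x : Phi R g x = Phi1 F2 ee R g.1 (Phi0 F2 ee R g.2 x).
Proof. by []. Qed.

Lemma Phi_J1 g a X : J1 a -> Phi R g (bten (th a X) 1) =
  mext (th a) (SL2val g.1 *m mxR R X *m \adj (SL2val g.1)).
Proof. by move=> h; rewrite PhiE Phi0_J1 // Phi1_J1. Qed.
Lemma Phi_J0 g a X : J0 a -> Phi R g (bten (th a X) 1) =
  mext (th a) (SL2val g.2 *m mxR R X *m \adj (SL2val g.2)).
Proof.
move=> h; rewrite PhiE Phi0_J0 //; apply: mext_fixed => [|Y]; first exact: ract_lin.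
exact: Phi1_J0.
Qed.
Lemma Phi_Jh g a X : Jh a -> Phi R g (bten (th a X) 1) =
  mext (th a) (SL2val g.1 *m mxR R X *m \adj (SL2val g.2)).
Proof.
move=> h; rewrite PhiE Phi0_Jh // -mulmxA.
exact: (mext_morph (th_linr F2 JT e a) (ract_lin _ _) (mulmx_lin _) (fun Y => Phi1_Jh F2 ee g.1 Y h)).
Qed.
Lemma Phi_T1 g x u : T1 x ->
  Phi R g (bten (elTx x u) 1) = mext (elTx x) (SL2val g.1 *m mxR R (u : 'cV_2)).
Proof. by move=> h; rewrite PhiE (Phi0_T1 F2 ee g.2 u h) (Phi1_T1 F2 ee g.1 u h). Qed.
Lemma Phi_T0 g x u : T0 x ->
  Phi R g (bten (elTx x u) 1) = mext (elTx x) (SL2val g.2 *m mxR R (u : 'cV_2)).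
Proof.
move=> h; rewrite PhiE (Phi0_T0 F2 ee g.2 u h); apply: mext_fixed => [|v]; first exact: ract_lin.
exact: Phi1_T0.
Qed.
Lemma Phi_S g d : DJ d e = 0 -> Phi R g (bten (id_D dec d) 1) = bten (id_D dec d) 1.
Proof. by move=> h; rewrite PhiE Phi0_S // Phi1_S. Qed.
End Points.

Section Diagonal.
Variable R : comAlgType F.
Implicit Type g : SL2 R.

Lemma Psi_elJ g h a : Psi R g (bten (elJ dec h a) 1) =
  mext (fun X => elJ dec (dev F2 X) a) (SL2val g *m mxR R (sl2val h) *m \adj (SL2val g)).
Proof.
have l := id_J_lin dec.
rewrite /elJ -(blin_bten _ _ l) -(id_J_hom dec).2 tens_act_bten (ad_act_mext F2).
rewrite (bbil_mextl _ _ _ (tens_bilin _ _)) blin_mext //.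
Qed.

Lemma Psi_elT g x u : Psi R g (bten (elTx x u) 1) = mext (elTx x) (SL2val g *m mxR R (u : 'cV_2)).
Proof.
have l := id_T_lin dec.
rewrite /Defs.elT /elTx /elT -(blin_bten _ _ l) -(id_T_hom dec).2 tens_act_bten nat_act_mext.
rewrite (bbil_mextl _ _ _ (tens_bilin _ _)) blin_mext //.
Qed.

Lemma Psi_D g d : Psi R g (bten (id_D dec d) 1) = bten (id_D dec d) 1.
Proof.
have l := id_D_lin dec.
by rewrite -(blin_bten _ _ l) -(id_D_hom dec).2.
Qed.

Lemma mext_theta a (A : 'M[R]_2) : mext (th a) A =
  mext (fun X => elJ dec (dev F2 X) a) A + bten (id_D dec (DD e a)) (2 * \tr A).
Proof.
rewrite /mext !sum2 /theta !tr2 !mxE /= !(addr0, add0r) !mulr0 !mulr1 !scale0r !addr0.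
rewrite !btenDl !btenZl mulrDr !btenDr !scaler_nat !mulr_natl.
module.
Qed.

Lemma Psi_th g a X : Psi R g (bten (th a X) 1) =
  mext (th a) (SL2val g *m mxR R X *m \adj (SL2val g)).
Proof.
have El : linear (fun X => elJ dec (dev F2 X) a).
  by move=> c Y Z; rewrite (dev_lin F2) ((elJ_bilin dec).1 a).
rewrite mext_theta /theta btenDl (linD (ract_lin Psi _)) Psi_elJ; congr (_ + _).
  rewrite [in RHS](devE F2 X) mxRD (linD (conj_lin _)) conj_scalar (linD (mext_lin _)).
  rewrite -[(_%:A)%:M]scalemx1 (linZ (mext_lin _)) -[1%:M](map_mx1 (in_alg R)).
  by rewrite mext_mxR // dev_scalar (lin0 ((elJ_bilin dec).1 a)) bten0l scaler0 addr0.
rewrite btenZl -[(2 * \tr X) *: 1]mulr1 -scale_bten (linZ (ract_lin Psi _)) Psi_D scale_bten mulr1.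
rewrite mxtrace_mulC mulmxA SL2_adjM mul1mx; congr bten.
by rewrite !tr2 !mxE -rmorphD /= -scalerA scaler_nat mulr_natl.
Qed.

(** The given structure conjugates [X] in every [theta a X], whatever the Peirce
    component of [a]. *)
Lemma Psi_Phi g x : Psi R g x = Phi R (g, g) x.
Proof.
apply: (blift_ext (f := Psi R g) (g := Phi R (g, g))) => [||{}x].
- exact: ract_lin.
- exact: (ract_lin Phi_rep).
elim/(peirce_ind (F2 := F2) ee): x => [x y xx xy|a X ha|a X ha|a X ha|u x hx|u x hx|d hd].
- by rewrite btenDl (linD (ract_lin Psi _)) (linD (ract_lin Phi_rep _)) xx xy.
- by rewrite Psi_th Phi_J1.
- by rewrite Psi_th Phi_J0.
- by rewrite Psi_th Phi_Jh.
- exact: etrans (Psi_elT g x u) (esym (Phi_T1 (g, g) u hx)).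
- exact: etrans (Psi_elT g x u) (esym (Phi_T0 (g, g) u hx)).
- by rewrite Psi_D Phi_S.
Qed.
End Diagonal.
End ProductStructure.

(** * Differentials of the constructed structures *)

Section InfinitesimalMatrices.
Variable F : fieldType.

Lemma eps_mul (X : sl2 F) n (A : 'M[F]_(2, n)) :
  SL2_eps_mx X *m mxR (dual F) A = mxR (dual F) A + eps F *: mxR (dual F) (sl2val X *m A).
Proof. by rewrite /SL2_eps_mx mulmxDl mul1mx -scalemxAl mxRM. Qed.

Lemma eps_conj (X Y : sl2 F) (A : 'M[F]_2) :
  SL2_eps_mx X *m mxR (dual F) A *m \adj (SL2_eps_mx Y) =
  mxR (dual F) A + eps F *: mxR (dual F) (sl2val X *m A - A *m sl2val Y).
Proof.
rewrite eps_mul adj_eps -/(mxR _ _) mulmxBr mulmx1 mulmxDl -!scalemxAr -!scalemxAl scalerA eps2.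
by rewrite scale0r addr0 -!mxRM mxRD /mxR map_mxN scalerBr addrA.
Qed.

Lemma mext_eps m n (L : lmodType F) (B : 'M[F]_(m, n) -> L) X Y : linear B ->
  mext B (mxR (dual F) X + eps F *: mxR (dual F) Y) = bten (B X) 1 + bten (B Y) (eps F).
Proof.
by move=> Bl; rewrite (linD (mext_lin B)) (linZ (mext_lin B)) !mext_mxR // scale_bten mulr1.
Qed.
End InfinitesimalMatrices.

Section IdempotentDifferential.
Variables (F : fieldType) (F2 : (2%:R : F) != 0) (beta : skew_form F).
Variables (L : lieAlgType F) (Psi : sstruct (SL2f F) L) (iota : sl2 F -> L).
Variables (J T D : lmodType F) (dec : isotypic_dec Psi J T D).
Variable JT : coordinatization beta iota dec.
Local Notation jm := (jmul JT).
Local Notation act := (jact (jt_mod JT)).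
Local Notation DD := (co_D JT).
Local Notation DJ := (co_DJ JT).
Variable e : J.
Local Notation J1 := (peirceJ1 JT e).
Local Notation Jh := (peirceJh JT e).
Local Notation J0 := (peirceJ0 JT e).
Local Notation T1 := (peirceT1 JT e).
Local Notation T0 := (peirceT0 JT e).
Hypothesis ee : jm e e = e.
Local Notation th := (theta F2 JT e).
Local Notation elTx := (elTx dec).

Lemma idem_diff : is_differential (idem_rep F2 ee) (fun X x => lie (elJ dec X e) x).
Proof.
move=> X x; have acts := idem_rep_acts F2 ee (SL2_eps X).
elim/(peirce_ind (F2 := F2) ee): x => [x y xx xy|a Y h|a Y h|a Y h|u x h|u x h|d h].
- rewrite btenDl (linD (ract_lin _ _)) xx xy (linD (lie_linr _)) btenDl addrACA //.
- rewrite (acts_1 acts) // eps_conj mext_eps ?ad_th_1 //; exact: th_linr.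
- rewrite (acts_0 acts) // expr1n scale1r ad_th_0 // bten0l addr0 mext_mxR //; exact: th_linr.
- rewrite (acts_h acts) // scale1r eps_mul mext_eps ?ad_th_h //; exact: th_linr.
- rewrite (ad_elT_1 (JT := JT)) // [LHS](acts_T1 acts) // scale1r eps_mul mext_eps //.
  exact: elTx_linr.
- rewrite (ad_elT_0 (JT := JT)) // [LHS](acts_T0 acts) // expr1n scale1r bten0l addr0 mext_mxR //.
  exact: elTx_linr.
- by rewrite (ad_S (JT := JT)) // (acts_S acts) // expr1n bten0l addr0.
Qed.
End IdempotentDifferential.

Section ProductDifferential.
Variables (F : fieldType) (F2 : (2%:R : F) != 0) (beta : skew_form F).
Variables (L : lieAlgType F) (Psi : sstruct (SL2f F) L) (iota : sl2 F -> L).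
Variables (J T D : lmodType F) (dec : isotypic_dec Psi J T D).
Variable JT : coordinatization beta iota dec.
Local Notation jm := (jmul JT).
Local Notation act := (jact (jt_mod JT)).
Local Notation DD := (co_D JT).
Local Notation DJ := (co_DJ JT).
Variable e : J.
Local Notation J1 := (peirceJ1 JT e).
Local Notation Jh := (peirceJh JT e).
Local Notation J0 := (peirceJ0 JT e).
Local Notation T1 := (peirceT1 JT e).
Local Notation T0 := (peirceT0 JT e).
Hypothesis ee : jm e e = e.
Hypothesis F3 : (3%:R : F) != 0.
Local Notation th := (theta F2 JT e).
Local Notation elTx := (elTx dec).
Local Notation f := (jone JT - e).
Local Notation Phi := (Phi F2 ee F3).

Definition iota2 (X : sl2 F * sl2 F) : L := elJ dec X.1 e + elJ dec X.2 f.

Lemma iota2_lin : linear iota2.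
Proof.
move=> c X Y; rewrite /iota2 /= ((elJ_bilin dec).1 e) ((elJ_bilin dec).1 f); module.
Qed.

Lemma Phi_diff : is_differential Phi (fun X => lie (iota2 X)).
Proof.
move=> X x; rewrite /iota2 (linD (lie_linl x)).
exact: (@prod_diff F (SL2f F) (SL2f F) L _ _ (Phi1_Phi0_comm F2 ee) _ _ (fun Y => lie_linr _)
  (idem_diff F2 ee) (idem_diff F2 (idem_compl ee)) X x).
Qed.

Lemma iota2_lie X Y : iota2 (lie X Y) = lie (iota2 X) (iota2 Y).
Proof.
rewrite /iota2 (linD (lie_linl _)) !(linD (lie_linr _)) !(co_lieJJ JT) ee idem_compl //.
have ef : jm e f = 0 by rewrite jmulC jm_compl ee subrr.
have fe : jm f e = 0 by rewrite jmulC.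
have Def : DD e f = 0 by rewrite DDe_J0.
have Dfe : DD f e = 0 by rewrite co_D_skew Def oppr0.
rewrite ef fe Def Dfe !DD_self // (lin0 (id_D_lin dec)) !scaler0 !addr0.
by rewrite !(lin0 ((elJ_bilin dec).2 _)) addr0 add0r.
Qed.

Lemma elJ_inj0 X a : a != 0 -> elJ dec X a = 0 -> X = 0.
Proof.
move=> a0 h; apply: sl2P; apply/matrixP => i j; rewrite (lin0 (@sl2val_linear F)) mxE.
apply/eqP; have /eqP := cJ_elJ dec i j X a; rewrite h (lin0 (cJ_lin dec i j)) eq_sym.
by rewrite scaler_eq0 (negPf a0) orbF.
Qed.

Lemma iota2_inj : e != 0 -> e != jone JT -> injective iota2.
Proof.
move=> e0 e1 X Y /eqP; rewrite -subr_eq0 => /eqP h.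
have {}h : iota2 (X - Y) = 0 by rewrite (linD iota2_lin) (linN iota2_lin).
apply/eqP; rewrite -subr_eq0; apply/eqP; move: (X - Y) h => [Z W] h.
have hZ : Z = 0.
  apply: (elJ_inj0 e0); rewrite -[RHS](lin0 ((elJ_bilin dec).1 e)); congr elJ.
  apply: sl2P; apply/matrixP => i j; rewrite (lin0 (@sl2val_linear F)) mxE; apply/eqP.
  have /(congr1 (jm e)) := congr1 (cJ dec i j) h.
  rewrite /iota2 (linD (cJ_lin dec i j)) !cJ_elJ (lin0 (cJ_lin dec i j)) (lin0 (jm_linr JT e)).
  rewrite (linD (jm_linr JT e)) !(linZ (jm_linr JT e)) ee [jm e f]jmulC jm_compl ee subrr.
  by rewrite scaler0 addr0 => /eqP; rewrite scaler_eq0 (negPf e0) orbF.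
move: h; rewrite /iota2 /= hZ (lin0 ((elJ_bilin dec).1 e)) add0r => hW.
by rewrite (elJ_inj0 _ hW) // subr_eq0 eq_sym.
Qed.

Lemma Phi_inner : e != 0 -> e != jone JT -> inner_by Phi iota2.
Proof.
by move=> e0 e1; split; [split; [exact: iota2_lin | exact: iota2_lie] | exact: iota2_inj | exact: Phi_diff].
Qed.

Lemma hom_J1 a : J1 a -> rep_hom (ad1_rep F) Phi (fun X => th a (sl2val X)).
Proof.
move=> ha; apply: rep_hom_bten => [c X Y|R g X].
  by rewrite sl2valD sl2valZ (th_linr F2 JT e a).
have hl : linear (fun X : sl2 F => th a (sl2val X)).
  by move=> c Y Z; rewrite sl2valD sl2valZ (th_linr F2 JT e a).
rewrite Phi_J1 // (ad_act_mext F2 g.1 X : ad1_rep F R g _ = _) blin_mext //.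
by apply: eq_mext => Y; apply: th_dev => //; left.
Qed.

Lemma hom_J0 a : J0 a -> rep_hom (ad0_rep F) Phi (fun X => th a (sl2val X)).
Proof.
move=> ha; apply: rep_hom_bten => [c X Y|R g X].
  by rewrite sl2valD sl2valZ (th_linr F2 JT e a).
have hl : linear (fun X : sl2 F => th a (sl2val X)).
  by move=> c Y Z; rewrite sl2valD sl2valZ (th_linr F2 JT e a).
rewrite Phi_J0 // (ad_act_mext F2 g.2 X : ad0_rep F R g _ = _) blin_mext //.
by apply: eq_mext => Y; apply: th_dev => //; right.
Qed.

Lemma hom_Jh a : Jh a -> rep_hom (nat10_rep F) Phi (th a \o @tens_mx F).
Proof.
move=> ha; apply: rep_hom_bten => [c X Y|R g X].
  by rewrite /= tens_mx_lin (th_linr F2 JT e a).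
by rewrite nat10_tens_mx ?Phi_Jh //; apply: th_linr.
Qed.

Lemma hom_T1 x : T1 x -> rep_hom (nat1_rep F) Phi (elTx x).
Proof.
move=> hx; apply: rep_hom_bten => [|R g u]; first exact: elTx_linr.
rewrite (Phi_T1 F2 ee F3 g u hx) (nat_act_mext g.1 u : nat1_rep F R g _ = _) blin_mext //.
exact: elTx_linr.
Qed.

Lemma hom_T0 x : T0 x -> rep_hom (nat0_rep F) Phi (elTx x).
Proof.
move=> hx; apply: rep_hom_bten => [|R g u]; first exact: elTx_linr.
rewrite (Phi_T0 F2 ee F3 g u hx) (nat_act_mext g.2 u : nat0_rep F R g _ = _) blin_mext //.
exact: elTx_linr.
Qed.

Lemma hom_S d : DJ d e = 0 -> rep_hom (triv_rep (SL2SL2f F) F^o) Phi (fun c : F^o => (c : F) *: id_D dec d).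
Proof.
move=> hd; have hl : linear (fun c : F^o => (c : F) *: id_D dec d).
  by move=> c x y; rewrite scalerDl scalerA.
apply: rep_hom_bten => // R g c.
have l := ract_lin (Phi_rep F2 ee) (g : SL2SL2f F R).
by rewrite blin_bten // btenZl -[c *: 1]mulr1 -scale_bten (linZ l) Phi_S.
Qed.
End ProductDifferential.

(** * The six isotypic components *)

Definition kind_code (k : short_kind) : nat :=
  match k with Ad1 => 0 | Ad0 => 1 | Nat10 => 2 | Nat1 => 3 | Nat0 => 4 | Triv => 5 end.
Definition kinds : seq short_kind := [:: Ad1; Ad0; Nat10; Nat1; Nat0; Triv].
Lemma kind_codeK : cancel kind_code (nth Triv kinds).
Proof. by case. Qed.
HB.instance Definition _ := Countable.copy short_kind (can_type kind_codeK).

Section Kinds.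
Variables (F : fieldType) (F2 : (2%:R : F) != 0) (beta : skew_form F).
Variables (L : lieAlgType F) (Psi : sstruct (SL2f F) L) (iota : sl2 F -> L).
Variables (J T D : lmodType F) (dec : isotypic_dec Psi J T D).
Variable JT : coordinatization beta iota dec.
Local Notation jm := (jmul JT).
Local Notation act := (jact (jt_mod JT)).
Local Notation DD := (co_D JT).
Local Notation DJ := (co_DJ JT).
Variable e : J.
Local Notation J1 := (peirceJ1 JT e).
Local Notation Jh := (peirceJh JT e).
Local Notation J0 := (peirceJ0 JT e).
Local Notation T1 := (peirceT1 JT e).
Local Notation T0 := (peirceT0 JT e).
Hypothesis ee : jm e e = e.
Hypothesis F3 : (3%:R : F) != 0.
Local Notation th := (theta F2 JT e).
Local Notation elTx := (elTx dec).
Local Notation f := (jone JT - e).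
Local Notation Phi := (Phi F2 ee F3).
Local Notation cA := (cA JT e).
Local Notation cS := (cS JT e).

(** The copies of the module of kind [k] in [L] are parametrized by the subspace
    [kin k] of [kspace k]: [kmap k a] embeds the copy of parameter [a]. *)
Definition kspace (k : short_kind) : lmodType F :=
  match k with Ad1 | Ad0 | Nat10 => J | Nat1 | Nat0 => T | Triv => D end.

Definition kin (k : short_kind) : set (kspace k) :=
  match k with
  | Ad1 => J1 | Ad0 => J0 | Nat10 => Jh | Nat1 => T1 | Nat0 => T0
  | Triv => [set d | DJ d e = 0]
  end.

Definition kmap (k : short_kind) : kspace k -> short_mod F k -> L :=
  match k with
  | Ad1 | Ad0 => fun a X => th a (sl2val X)
  | Nat10 => fun a t => th a (tens_mx t)
  | Nat1 | Nat0 => fun x u => elTx x u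
  | Triv => fun d c => (c : F) *: id_D dec d
  end.

Definition kidx (k : short_kind) : finType :=
  match k with
  | Ad1 | Ad0 | Nat10 => ('I_2 * 'I_2)%type
  | Nat1 | Nat0 => 'I_2
  | Triv => unit
  end.

Definition kbase (k : short_kind) : kidx k -> short_mod F k :=
  match k with
  | Ad1 | Ad0 => fun i => dev F2 (delta_mx i.1 i.2)
  | Nat10 => fun i => mx_tens (delta_mx i.1 i.2)
  | Nat1 | Nat0 => fun i => delta_mx i ord0 : natmod F
  | Triv => fun _ => 1 : F^o
  end.

Definition kcoord (k : short_kind) : kidx k -> short_mod F k -> F :=
  match k with
  | Ad1 | Ad0 => fun i X => sl2val X i.1 i.2
  | Nat10 => fun i t => tens_mx t i.1 i.2
  | Nat1 | Nat0 => fun i u => (u : 'cV_2) i ord0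
  | Triv => fun _ c => c
  end.

(** The [i]-th coordinate, with values in the parameter space, of the component of
    kind [k]. *)
Definition kco (k : short_kind) : kidx k -> L -> kspace k :=
  match k with
  | Ad1 => fun i x => proj1 JT e (cA i.1 i.2 x)
  | Ad0 => fun i x => proj0 JT e (cA i.1 i.2 x)
  | Nat10 => fun i x => projh JT e (cA i.1 i.2 x)
  | Nat1 => fun i x => act e (cT dec i x)
  | Nat0 => fun i x => cT dec i x - act e (cT dec i x)
  | Triv => fun _ x => cS x
  end.

Lemma kmap_linr k a : linear (@kmap k a).
Proof.
have sl_lin (a' : J) : linear (fun X : sl2 F => th a' (sl2val X)).
  by move=> c X Y; rewrite sl2valD sl2valZ (th_linr F2 JT e a').
have tens_lin (a' : J) : linear (fun t => th a' (@tens_mx F t)).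
  by move=> c X Y; rewrite tens_mx_lin (th_linr F2 JT e a').
case: k a => a; [exact: sl_lin | exact: sl_lin | exact: (elTx_linr dec)
  | exact: (elTx_linr dec) | exact: tens_lin |].
by move=> c x y /=; rewrite scalerDl scalerA.
Qed.

Lemma kmap_linl k m : linear ((@kmap k)^~ m).
Proof.
case: k m => m c x y /=; try exact: (th_linl F2 JT e); try exact: (elTx_linl dec).
by rewrite (id_D_lin dec) scalerDr !scalerA mulrC.
Qed.

Lemma kco_lin k i : linear (@kco k i).
Proof.
case: k i => i c x y /=.
- by rewrite (cA_lin JT) proj1_lin.
- by rewrite (cA_lin JT) proj0_lin.
- by rewrite (cT_lin dec) (act_linr JT).
- by rewrite (cT_lin dec) (act_linr JT); module.
- by rewrite (cA_lin JT) projh_lin.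
- exact: cS_lin.
Qed.

Lemma kco_in k i x : kin (@kco k i x).
Proof.
case: k i => i /=; [exact: proj1_in | exact: proj0_in | exact: T1_act | exact: T0_act
  | exact: projh_in | exact: cS_in].
Qed.

Lemma kinP k c (a b : kspace k) : kin a -> kin b -> kin (c *: a + b).
Proof.
case: k a b => a b /=; rewrite /peirceJ1 /peirceJ0 /peirceT1 /peirceT0 /peirceJh /= => ha hb.
- by rewrite (jm_linr JT) ha hb.
- by rewrite (jm_linr JT) ha hb scaler0 addr0.
- by rewrite (act_linr JT) ha hb.
- by rewrite (act_linr JT) ha hb scaler0 addr0.
- by rewrite (jm_linr JT) ha hb scalerDr !scalerA mulrC.
- by rewrite (DJ_linl JT) ha hb scaler0 addr0.
Qed.

Lemma kin0 k : kin (0 : kspace k).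
Proof.
case: k => /=; rewrite /peirceJ1 /peirceJ0 /peirceT1 /peirceT0 /peirceJh /= ?scaler0;
  by [exact: lin0 (jm_linr JT e) | exact: lin0 (act_linr JT e) | exact: lin0 (DJ_linl JT e)].
Qed.

Lemma sum_pair2 (V : nmodType) (E : 'I_2 * 'I_2 -> V) :
  \sum_i E i = \sum_i \sum_j E (i, j).
Proof. by rewrite pair_bigA; apply: eq_bigr => -[]. Qed.

Lemma kcoord_sum k m : m = \sum_i kcoord i m *: @kbase k i.
Proof.
case: k m => m /=.
- by rewrite sum_pair2 -sl2_dev_sum.
- by rewrite sum_pair2 -sl2_dev_sum.
- exact: natmod_eta.
- exact: natmod_eta.
- rewrite sum_pair2 -[LHS]tens_mxK [X in mx_tens X]matrix_sum_delta.
  rewrite (lin_sum (@mx_tens_lin F)); apply: eq_bigr => i _.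
  by rewrite (lin_sum (@mx_tens_lin F)); apply: eq_bigr => j _; rewrite (linZ (@mx_tens_lin F)).
- by rewrite (bigD1 tt) //= big1 ?addr0 => [|[]//]; rewrite [_ *: _]mulr1.
Qed.

Lemma kco_same k i a m : kin a -> kco i (@kmap k a m) = kcoord i m *: a.
Proof.
case: k i a m => i a m /= ha.
- rewrite cA_th_diag ?dev_sl2 //; last by left.
  by rewrite (linZ (proj1_lin JT e)); have [-> _ _] := proj_J1 ha.
- rewrite cA_th_diag ?dev_sl2 //; last by right.
  by rewrite (linZ (proj0_lin JT e)); have [_ _ ->] := proj_J0 ha.
- by rewrite cT_elT (linZ (act_linr JT e)) ha.
- by rewrite cT_elT (linZ (act_linr JT e)) ha scaler0 subr0.
- rewrite cA_th_half // (linZ (projh_lin JT e)); have [_ -> _] := proj_Jh F2 ha => //.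
- by rewrite (linZ (cS_lin JT e)) cS_S.
Qed.

Lemma cA_theta_mult i j a X : J1 a \/ J0 a \/ Jh a -> exists c, cA i j (th a X) = c *: a.
Proof.
case=> [h | [h|h]]; last by exists (X i j); exact: cA_th_half.
  by exists (sl2val (dev F2 X) i j); apply: cA_th_diag => //; left.
by exists (sl2val (dev F2 X) i j); apply: cA_th_diag => //; right.
Qed.

Lemma kco_diff k l i a m : k != l -> kin a -> kco i (@kmap k a m) = 0 :> kspace l.
Proof.
have [l1 l0 lh] := And3 (linZ (proj1_lin JT e)) (linZ (proj0_lin JT e)) (linZ (projh_lin JT e)).
have z1 := lin0 (proj1_lin JT e); have z0 := lin0 (proj0_lin JT e).
have zh := lin0 (projh_lin JT e); have za := lin0 (act_linr JT e).
case: k a m => a m kl ha.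
- have [p1 ph p0] := proj_J1 ha.
  case: l i kl => i //= _; rewrite ?cT_th ?za ?subr0 ?cS_th //;
    have [c ->] := cA_theta_mult i.1 i.2 (sl2val m) (or_introl ha);
    by rewrite ?l0 ?lh ?p0 ?ph scaler0.
- have [p1 ph p0] := proj_J0 ha.
  case: l i kl => i //= _; rewrite ?cT_th ?za ?subr0 ?cS_th //;
    have [c ->] := cA_theta_mult i.1 i.2 (sl2val m) (or_intror (or_introl ha));
    by rewrite ?l1 ?lh ?p1 ?ph scaler0.
- case: l i kl => i //= _; rewrite ?cA_elT ?z1 ?z0 ?zh ?cS_elT //.
  by rewrite cT_elT (linZ (act_linr JT e)) ha subrr.
- case: l i kl => i //= _; rewrite ?cA_elT ?z1 ?z0 ?zh ?cS_elT //.
  by rewrite cT_elT (linZ (act_linr JT e)) ha scaler0.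
- have [p1 ph p0] := proj_Jh F2 ha.
  case: l i kl => i //= _; rewrite ?cT_th ?za ?subr0 ?cS_th //;
    have [c ->] := cA_theta_mult i.1 i.2 (tens_mx m) (or_intror (or_intror ha));
    by rewrite ?l1 ?l0 ?p1 ?p0 scaler0.
- case: l i kl => i //= _; rewrite ?(linZ (cA_lin JT e _ _)) ?(linZ (cT_lin dec _)) ?cA_S ?cT_D //;
    by rewrite ?scaler0 ?z1 ?z0 ?zh ?za ?subr0.
Qed.

Lemma kco_sum x : x = \sum_(k <- kinds) \sum_i kmap (@kco k i x) (kbase i).
Proof.
rewrite [LHS](generators_sum F2 JT e x) /kinds !big_cons big_nil addr0 /=.
have -> : \sum_(i : unit) (1 : F) *: id_D dec (cS x) = id_D dec (cS x).
  by rewrite (bigD1 tt) //= scale1r big1 ?addr0 // => -[].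
rewrite !sum_pair2 /=; set sT := \sum_i elT _ _ _; set sA := \sum_i \sum_j theta _ _ _ _ _.
have -> : sA = \sum_i \sum_j th (proj1 JT e (cA i j x)) (delta_mx i j)
    + \sum_i \sum_j th (proj0 JT e (cA i j x)) (delta_mx i j)
    + \sum_i \sum_j th (projh JT e (cA i j x)) (delta_mx i j).
  rewrite -!big_split; apply: eq_bigr => i _; rewrite -!big_split; apply: eq_bigr => j _ /=.
  rewrite {1}(peirce_sum JT e (cA i j x)) 2!(linD (th_linl F2 JT e _)); module.
have -> : sT = \sum_i elTx (act e (cT dec i x)) (delta_mx i ord0)
    + \sum_i elTx (cT dec i x - act e (cT dec i x)) (delta_mx i ord0).
  rewrite -big_split; apply: eq_bigr => i _; rewrite /= (linD (elTx_linl dec _)).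
  by rewrite addrCA (linN (elTx_linl dec _)) subrr addr0.
have -> : \sum_i \sum_j th (proj1 JT e (cA i j x)) (sl2val (dev F2 (delta_mx i j))) =
    \sum_i \sum_j th (proj1 JT e (cA i j x)) (delta_mx i j).
  by apply: eq_bigr => i _; apply: eq_bigr => j _; apply: th_dev => //; left; apply: proj1_in.
have -> : \sum_i \sum_j th (proj0 JT e (cA i j x)) (sl2val (dev F2 (delta_mx i j))) =
    \sum_i \sum_j th (proj0 JT e (cA i j x)) (delta_mx i j).
  by apply: eq_bigr => i _; apply: eq_bigr => j _; apply: th_dev => //; right; apply: proj0_in.
have -> : \sum_i \sum_j th (projh JT e (cA i j x)) (tens_mx (mx_tens (delta_mx i j))) =
    \sum_i \sum_j th (projh JT e (cA i j x)) (delta_mx i j).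
  by apply: eq_bigr => i _; apply: eq_bigr => j _; rewrite mx_tensK.
by rewrite -!addrA.
Qed.

Lemma kmap_hom k a : kin a -> rep_hom (short_rep F k) Phi (@kmap k a).
Proof.
case: k a => a h; [exact: hom_J1 | exact: hom_J0 | exact: hom_T1 | exact: hom_T0
  | exact: hom_Jh | exact: hom_S].
Qed.

Definition kpr (k : short_kind) (x : L) : L := \sum_i kmap (@kco k i x) (kbase i).

Definition kcomp (k : short_kind) : set L :=
  lspan [set x | exists a m, kin a /\ x = @kmap k a m].

Lemma kpr_lin k : linear (kpr k).
Proof.
move=> c x y; rewrite /kpr scaler_sumr -big_split; apply: eq_bigr => i _ /=.
by rewrite kco_lin kmap_linl.
Qed.

Lemma kcomp_map k a m : kin a -> kcomp k (@kmap k a m).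
Proof. by move=> ha; apply: lspan_sub; exists a, m. Qed.

Lemma kpr_in k x : kcomp k (kpr k x).
Proof. by apply: lspan_sum => i; apply/kcomp_map/kco_in. Qed.

Lemma kpr_id k x : kcomp k x -> kpr k x = x.
Proof.
apply: (lspan_lin (W := [set x | kpr k x = x])) x => [_ [a [m [ha ->]]]||c x y /= hx hy].
- rewrite /= /kpr [in RHS](kcoord_sum m) (lin_sum (kmap_linr a)); apply: eq_bigr => i _.
  by rewrite kco_same // (linZ (kmap_linl _)) (linZ (kmap_linr _)).
- exact: lin0 (kpr_lin k).
- by rewrite kpr_lin hx hy.
Qed.

Lemma kpr_other k l x : k != l -> kcomp k x -> kpr l x = 0.
Proof.
move=> kl; apply: (lspan_lin (W := [set x | kpr l x = 0])) x => [_ [a [m [ha ->]]]||c x y /= hx hy].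
- rewrite /= /kpr big1 // => i _; rewrite kco_diff //; exact: lin0 (kmap_linl _).
- exact: lin0 (kpr_lin l).
- by rewrite kpr_lin hx hy scaler0 addr0.
Qed.

Lemma kpr_sum x : x = \sum_(k <- kinds) kpr k x.
Proof. exact: kco_sum. Qed.

Lemma kinds_uniq : uniq kinds. Proof. by []. Qed.
Lemma mem_kinds k : k \in kinds. Proof. by case: k. Qed.

Lemma kcomp_dsum : is_dsum [seq kcomp k | k <- kinds] setT.
Proof.
set As := [seq kcomp k | k <- kinds].
have nthk (i : 'I_(size As)) : nth set0 As i = kcomp (nth Triv kinds i).
  by rewrite (nth_map Triv) //; case: i => i; rewrite size_map.
have szk (i : 'I_(size As)) : (i < size kinds)%N by case: i => i; rewrite size_map.
apply: (@is_dsum_proj _ _ As setT (fun i => kpr (nth Triv kinds i))) => //.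
- by move=> i; apply: kpr_lin.
- by move=> i x _; rewrite nthk; apply: kpr_in.
- by move=> x _; rewrite {1}(kpr_sum x) (big_nth Triv) big_mkord.
- move=> i j x; rewrite nthk; have [-> /kpr_id //|ij] := eqVneq i j.
  apply: kpr_other; apply: contra_neq ij => e'; apply/val_inj/eqP.
  by rewrite /= eq_sym -(nth_uniq Triv (szk j) (szk i) kinds_uniq) e'.
Qed.

Lemma kcomp_of_co k x : (forall l i, l != k -> kco i x = 0 :> kspace l) -> kcomp k x.
Proof.
move=> h; rewrite (kpr_sum x) (bigD1_seq k) //= ?mem_kinds ?kinds_uniq //.
rewrite big1 ?addr0; first exact: kpr_in.
by move=> l lk; rewrite /kpr big1 // => i _; rewrite h //; apply: lin0 (kmap_linl _).
Qed.

Lemma kind_ind (P : L -> Prop) : P 0 -> (forall x y, P x -> P y -> P (x + y)) ->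
  (forall k a i, kin a -> P (@kmap k a (kbase i))) -> forall x, P x.
Proof.
move=> P0 PD Pk x; rewrite (kco_sum x); apply: (big_ind P) => // k _.
by apply: (big_ind P) => // i _; apply/Pk/kco_in.
Qed.

(** * Weights *)

(** The weights of the two copies of [H] on the vectors of [kbase], see [kder_H]. *)
Definition kwt (k : short_kind) : kidx k -> F * F :=
  let h (i : 'I_2) : F := if i == ord0 then 1 else - 1 in
  match k with
  | Ad1 => fun i => (h i.1 - h i.2, 0)
  | Ad0 => fun i => (0, h i.1 - h i.2)
  | Nat10 => fun i => (h i.1, - h i.2)
  | Nat1 => fun i => (h i, 0)
  | Nat0 => fun i => (0, h i)
  | Triv => fun _ => (0, 0)
  end.

Local Notation E := (sl2E F). Local Notation H := (sl2H F). Local Notation Y := (sl2F F).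

(** The action of the Lie algebra on the standard modules; for the tensor product it is
    read on matrices. *)
Definition kder (k : short_kind) (X : sl2 F * sl2 F) : short_mod F k -> short_mod F k :=
  match k with
  | Ad1 => fun m => lie X.1 m
  | Ad0 => fun m => lie X.2 m
  | Nat10 => fun t => mx_tens (sl2val X.1 *m tens_mx t - tens_mx t *m sl2val X.2)
  | Nat1 => fun u => sl2val X.1 *m (u : 'cV_2)
  | Nat0 => fun u => sl2val X.2 *m (u : 'cV_2)
  | Triv => fun _ => 0
  end.

(** On matrices the group acts by [X |-> g X \adj h], whose derivative is
    [X1 X - X X2]. *)
Lemma nat10_diff (X : sl2 F * sl2 F) t : has_diff (nat10_rep F) X t (@kder Nat10 X t).
Proof.
pose eqv := fun x : bext (tensor (natmod F) (natmod F)) (dual F) => blin (@mx_tens F) (blin (@tens_mx F) x).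
have eqvK x : eqv x = x.
  apply: (blift_ext (f := eqv) (g := id)) => // [c u v|m].
    by rewrite /eqv (blin_lin (@tens_mx_lin F)) (blin_lin (@mx_tens_lin F)).
  rewrite /eqv blin_bten; last exact: tens_mx_lin.
  by rewrite blin_bten ?tens_mxK //; apply: mx_tens_lin.
rewrite /has_diff -[LHS]eqvK /eqv.
have -> : blin (@tens_mx F) = blin (id \o @tens_mx F) by [].
rewrite nat10_tens_mx // blin_mext; last exact: mx_tens_lin.
transitivity (mext (@mx_tens F \o id) (SL2_eps_mx X.1 *m mxR (dual F) (tens_mx t) *m \adj (SL2_eps_mx X.2))).
  by [].
rewrite eps_conj mext_eps /= ?tens_mxK //; exact: mx_tens_lin.
Qed.

Lemma kder_diff k X m : has_diff (short_rep F k) X m (kder X m).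
Proof.
case: k m => m; [exact/pull1_diff/ad_diff | exact/pull2_diff/ad_diff | exact/pull1_diff/nat_diff
  | exact/pull2_diff/nat_diff | exact: nat10_diff |].
by rewrite /has_diff /= bten0l addr0.
Qed.

(** Equivariance over the dual numbers makes every homomorphism commute with the Lie
    algebras. *)
Lemma hom_der k (h : short_mod F k -> L) X m : rep_hom (short_rep F k) Phi h ->
  h (kder X m) = lie (iota2 JT e X) (h m).
Proof. by move=> hh; exact: (rep_hom_diff hh (kder_diff X m) (Phi_diff F2 ee F3 X (h m))). Qed.

Lemma kmap_der k a X m : kin a -> lie (iota2 JT e X) (@kmap k a m) = kmap a (kder X m).
Proof. by move=> ha; rewrite -(hom_der _ _ (kmap_hom ha)). Qed.

Lemma kcomp_lie k X x : kcomp k x -> kcomp k (lie (iota2 JT e X) x).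
Proof.
apply: (lspan_lin (W := [set x | kcomp k (lie (iota2 JT e X) x)])) x => [_ [a [m [ha ->]]]||c x y /= hx hy].
- by rewrite /= kmap_der //; apply: kcomp_map.
- by rewrite /= (lin0 (lie_linr _)); apply: lspan0.
- by rewrite (lie_linr _); apply: lspanP.
Qed.

Lemma H_mul n i (j : 'I_n) : sl2val H *m delta_mx i j = (if i == ord0 then 1 else - 1) *: delta_mx i j.
Proof.
apply: mx2P => k; rewrite !mxE !sum2 !mxE /=; case: (ord2P i) => -> /=; case: (k == j) => /=; ring.
Qed.
Lemma mul_H n (i : 'I_n) j : delta_mx i j *m sl2val H = (if j == ord0 then 1 else - 1) *: delta_mx i j.
Proof.
apply/matrixP => k l; rewrite !mxE !sum2 !mxE /=; case: (ord2P j) => -> /=;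
  case: (ord2P l) => -> /=; case: (k == i) => /=; ring.
Qed.

Lemma kder_H k i : kder (H, 0) (@kbase k i) = (kwt i).1 *: kbase i
  /\ kder (0, H) (@kbase k i) = (kwt i).2 *: kbase i.
Proof.
have v0 : sl2val (0 : sl2 F) = 0 by exact: lin0 (@sl2val_linear F).
case: k i => i; split => /=; rewrite ?scale0r ?scaler0 ?v0 ?mul0mx ?mulmx0 ?subr0 ?sub0r //.
- by rewrite -(dev_bracket F2) H_mul mul_H -scalerBl (linZ (dev_lin F2)).
- exact: lin0 (lie_linl _).
- exact: lin0 (lie_linl _).
- by rewrite -(dev_bracket F2) H_mul mul_H -scalerBl (linZ (dev_lin F2)).
- exact: H_mul.
- exact: H_mul.
- by rewrite mx_tensK H_mul (linZ (@mx_tens_lin F)).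
- by rewrite mx_tensK mul_H -scaleNr (linZ (@mx_tens_lin F)).
Qed.

Lemma kcoord_wt k (i j : kidx k) : kwt i = kwt j \/ kcoord j (kbase i) = 0.
Proof.
have dz (a b c d : 'I_2) : (a, b) != (c, d) -> ~~ ((a == b) && (c == d)) ->
    sl2val (dev F2 (delta_mx a b)) c d = 0.
  move=> ab cd; rewrite !mxE /mxtrace [c == a]eq_sym [d == b]eq_sym.
  have -> : (a == c) && (b == d) = false by apply/negbTE; rewrite -xpair_eqE.
  have [cd'|_] := eqVneq c d; last by rewrite mulr0n subrr.
  move: cd; rewrite cd' eqxx andbT => ab'; rewrite mulr1n sub0r.
  by rewrite big1 ?mulr0 ?oppr0 // => x _; rewrite mxE; case: eqP => [->|//]; rewrite (negPf ab').
have mz (a b c d : 'I_2) : (a, b) != (c, d) -> (delta_mx a b : 'M[F]_2) c d = 0.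
  by move=> ab; rewrite mxE [c == a]eq_sym [d == b]eq_sym -xpair_eqE (negPf ab).
have [->|ij] := eqVneq i j; first by left.
case: k i j ij => i j ij /=; last by left.
- case: i j ij => a b [c d] ij /=; case/boolP: ((a == b) && (c == d)) => [/andP[/eqP-> /eqP->]|h].
    by left; rewrite !subrr.
  by right; apply: dz.
- case: i j ij => a b [c d] ij /=; case/boolP: ((a == b) && (c == d)) => [/andP[/eqP-> /eqP->]|h].
    by left; rewrite !subrr.
  by right; apply: dz.
- by right; rewrite mxE eq_sym (negPf ij).
- by right; rewrite mxE eq_sym (negPf ij).
- by right; rewrite mx_tensK; case: i j ij => a b [c d] ij; apply: mz.
Qed.

Lemma kco_weight l (j : kidx l) x :
  kco j (lie (iota2 JT e (H, 0)) x) = (kwt j).1 *: kco j x /\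
  kco j (lie (iota2 JT e (0, H)) x) = (kwt j).2 *: kco j x.
Proof.
elim/kind_ind: x => [|x y [x1 x2] [y1 y2]|k a i ha].
- by rewrite !(lin0 (lie_linr _)) (lin0 (kco_lin j)) !scaler0.
- by rewrite !(linD (lie_linr _)) !(linD (kco_lin j)) x1 x2 y1 y2 !scalerDr.
rewrite !kmap_der //; have [-> ->] := kder_H i; rewrite !(linZ (kmap_linr a)) !(linZ (kco_lin j)).
case: (eqVneq k l) => [kl | kl]; last by rewrite kco_diff // !scaler0.
move: l j kl => l j kl; subst l; rewrite kco_same //.
by have [-> //|->] := kcoord_wt i j; rewrite scale0r !scaler0.
Qed.

(** The squares of the weights distinguish the kinds as [1], [4] and [0] are distinct
    when the characteristic is not 2 or 3. *)
Definition ksq (k : short_kind) : F * F :=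
  match k with
  | Ad1 => (4, 0) | Ad0 => (0, 4) | Nat10 => (1, 1)
  | Nat1 => (1, 0) | Nat0 => (0, 1) | Triv => (0, 0)
  end.

Lemma ksq_inj : injective ksq.
Proof.
have F4 : (4 : F) != 0 by rewrite -[4%N]/(2 * 2)%N natrM mulf_neq0.
have F41 : (4 : F) != 1.
  by rewrite -subr_eq0; have -> : (4 - 1 : F) = 3; [ring|].
have F1 := oner_neq0 F.
have neqs : ((4 : F) == 0 = false) * ((4 : F) == 1 = false) * ((1 : F) == 0 = false) *
    ((0 : F) == 4 = false) * ((1 : F) == 4 = false) * ((0 : F) == 1 = false).
  have [a b c] := And3 (negPf F4) (negPf F41) (negPf F1).
  have [a' b' c'] := And3 (etrans (eq_sym 0 4) a) (etrans (eq_sym 1 4) b) (etrans (eq_sym 0 1) c).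
  by rewrite a b c a' b' c'.
by case=> [] [] //= /eqP; rewrite xpair_eqE !neqs ?andbF.
Qed.

Lemma kwt_sq k (i : kidx k) : kwt i = (0, 0) \/ ((kwt i).1 ^+ 2, (kwt i).2 ^+ 2) = ksq k.
Proof.
have z2 : 0 ^+ 2 = 0 :> F by rewrite expr0n.
have h2 (a : 'I_2) : (if a == ord0 then 1 else - 1) ^+ 2 = 1 :> F.
  by case: ifP => _; rewrite ?sqrrN expr1n.
have d2 (a b : 'I_2) : (if a == ord0 then 1 else - 1) - (if b == ord0 then 1 else - 1) = 0 :> F \/
    ((if a == ord0 then 1 else - 1) - (if b == ord0 then 1 else - 1)) ^+ 2 = 4 :> F.
  by case: ifP => _; case: ifP => _; rewrite ?subrr; [left | right; ring | right; ring | left].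
case: k i => i /=; rewrite ?h2 ?z2 ?sqrrN ?h2; try by right.
- by have [->|->] := d2 i.1 i.2; [left | right].
- by have [->|->] := d2 i.1 i.2; [left | right].
Qed.

(** A vector of nonzero weight lies in the only component having that weight. *)
Lemma hom_base k (h : short_mod F k -> L) i : rep_hom (short_rep F k) Phi h ->
  kwt i != (0, 0) -> kcomp k (h (kbase i)).
Proof.
move=> hh wi; apply: kcomp_of_co => l j; apply: contraNeq => c0.
have [w1 w2] := kder_H i; have hl := hh.1.
have h1 := hom_der (H, 0) (kbase i) hh; have h2 := hom_der (0, H) (kbase i) hh.
have [k1 k2] := kco_weight j (h (kbase i)).
move: k1 k2; rewrite -h1 -h2 w1 w2 !(linZ hl) !(linZ (kco_lin j)).
move=> /eqP; rewrite -subr_eq0 -scalerBl scaler_eq0 (negPf c0) orbF subr_eq0 => /eqP e1.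
move=> /eqP; rewrite -subr_eq0 -scalerBl scaler_eq0 (negPf c0) orbF subr_eq0 => /eqP e2.
apply/eqP/ksq_inj; have [i0|<-] := kwt_sq i; first by rewrite i0 eqxx in wi.
have [j0|<-] := kwt_sq j; last by rewrite e1 e2.
by move: wi; rewrite [kwt i]surjective_pairing e1 e2 j0 eqxx.
Qed.

Lemma kcompP k c x y : kcomp k x -> kcomp k y -> kcomp k (c *: x + y).
Proof. exact: lspanP. Qed.

(** The only vectors of weight zero to consider are the multiples of [H] in an adjoint
    module, and [H] is the bracket of [E] and [F]. *)
Lemma hom_comp k (h : short_mod F k -> L) m : k != Triv ->
  rep_hom (short_rep F k) Phi h -> kcomp k (h m).
Proof.
move=> kT hh; have hl := hh.1.
have N1 : (-1 : F) != 0 by rewrite oppr_eq0 oner_neq0.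
suff hb i : kcomp k (h (kbase i)).
  rewrite [m]kcoord_sum (lin_sum hl); apply: lspan_sum => i.
  by rewrite (linZ hl) -[_ *: _]addr0; apply: kcompP => //; apply: lspan0.
case: k h hh hl kT i {m} => h hh hl //= _ i.
- have hY : kcomp Ad1 (h (sl2F F)).
    have := @hom_base Ad1 h (ord_max, ord0) hh; rewrite /= dev_delta10; apply.
    by rewrite xpair_eqE /= (negPf (subrN1_neq0 F2)).
  have hE : kcomp Ad1 (h (sl2E F)).
    have := @hom_base Ad1 h (ord0, ord_max) hh; rewrite /= dev_delta01; apply.
    by rewrite xpair_eqE /= (negPf (subr1N_neq0 F2)).
  have hH : kcomp Ad1 (h (sl2H F)).
    rewrite -lie_EF; have /= -> := @hom_der Ad1 h (E, 0) (sl2F F) hh; exact: kcomp_lie.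
  case: i => a b; case: (ord2P a) => ->; case: (ord2P b) => -> //=.
  + by rewrite dev_delta00 (linZ hl) -[_ *: _]addr0; apply: kcompP => //; apply: lspan0.
  + by rewrite dev_delta01.
  + by rewrite dev_delta10.
  + by rewrite dev_delta11 -scaleNr (linZ hl) -[_ *: _]addr0; apply: kcompP => //; apply: lspan0.
- have hY : kcomp Ad0 (h (sl2F F)).
    have := @hom_base Ad0 h (ord_max, ord0) hh; rewrite /= dev_delta10; apply.
    by rewrite xpair_eqE /= (negPf (subrN1_neq0 F2)) andbF.
  have hE : kcomp Ad0 (h (sl2E F)).
    have := @hom_base Ad0 h (ord0, ord_max) hh; rewrite /= dev_delta01; apply.
    by rewrite xpair_eqE /= (negPf (subr1N_neq0 F2)) andbF.
  have hH : kcomp Ad0 (h (sl2H F)).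
    rewrite -lie_EF; have /= -> := @hom_der Ad0 h (0, E) (sl2F F) hh; exact: kcomp_lie.
  case: i => a b; case: (ord2P a) => ->; case: (ord2P b) => -> //=.
  + by rewrite dev_delta00 (linZ hl) -[_ *: _]addr0; apply: kcompP => //; apply: lspan0.
  + by rewrite dev_delta01.
  + by rewrite dev_delta10.
  + by rewrite dev_delta11 -scaleNr (linZ hl) -[_ *: _]addr0; apply: kcompP => //; apply: lspan0.
- apply: (@hom_base Nat1) hh _; rewrite xpair_eqE /= eqxx andbT.
  by case: ifP => _; rewrite ?oner_neq0.
- apply: (@hom_base Nat0) hh _; rewrite xpair_eqE /= eqxx.
  by case: ifP => _; rewrite ?oner_neq0.
- apply: (@hom_base Nat10) hh _; rewrite xpair_eqE /=.
  by case: ifP => _; rewrite ?(negPf N1) ?(negPf (oner_neq0 F)).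
Qed.

Lemma kmap_inj k a : kin a -> a != 0 -> injective (@kmap k a).
Proof.
move=> ha a0 m m' mm; rewrite [m]kcoord_sum [m']kcoord_sum; apply: eq_bigr => i _.
have := congr1 (kco i) mm; rewrite !kco_same // => /eqP.
by rewrite -subr_eq0 -scalerBl scaler_eq0 (negPf a0) orbF subr_eq0 => /eqP ->.
Qed.

Lemma kmap_copy k a : kin a -> a != 0 -> is_copy Phi (short_rep F k) (range (@kmap k a)).
Proof.
by move=> ha a0; exists (kmap a); split=> //; [exact: kmap_hom | exact: kmap_inj].
Qed.

Lemma isotypicE k : k != Triv -> isotypic Phi (short_rep F k) = kcomp k.
Proof.
move=> kT; apply/seteqP; split.
  apply: lspan_lin => [x [W [h [hh _ ->]] [m _ <-]]||]; [exact: hom_comp | exact: lspan0 | exact: kcompP].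
apply: lspan_lin => [x [a [m [ha ->]]]||]; [|exact: lspan0 | exact: lspanP].
have [a0|a0] := eqVneq a 0.
  by rewrite a0 (lin0 (kmap_linl m)); apply: lspan0.
by apply: lspan_sub; exists (range (kmap a)); [exact: kmap_copy | exists m].
Qed.

Lemma sl2_tr2 (X : sl2 F) : sl2val X ord0 ord0 + sl2val X ord_max ord_max = 0.
Proof. by rewrite -tr2 sl2_tr. Qed.

Lemma kco_trace x : (@kco Ad1 (ord0, ord0) x + @kco Ad1 (ord_max, ord_max) x = 0)
  /\ (@kco Ad0 (ord0, ord0) x + @kco Ad0 (ord_max, ord_max) x = 0).
Proof.
elim/kind_ind: x => [|x y [x1 x0] [y1 y0]|k a i ha].
- by rewrite !(lin0 (kco_lin _)) addr0.
- by rewrite !(linD (kco_lin _)) addrACA x1 y1 addrACA x0 y0 !addr0.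
split.
  have [kA|kA] := eqVneq k Ad1; last by rewrite !kco_diff ?addr0.
  by move: a i ha; rewrite kA => a i ha; rewrite !kco_same // -scalerDl [X in X *: _](sl2_tr2 (@kbase Ad1 i)) scale0r.
have [kA|kA] := eqVneq k Ad0; last by rewrite !kco_diff ?addr0.
by move: a i ha; rewrite kA => a i ha; rewrite !kco_same // -scalerDl [X in X *: _](sl2_tr2 (@kbase Ad0 i)) scale0r.
Qed.

Lemma lie_E_01 (X : sl2 F) :
  sl2val (lie E X) ord0 ord_max = sl2val X ord_max ord_max - sl2val X ord0 ord0.
Proof. rewrite sl2_lieE !mxE !sum2 !mxE /=; ring. Qed.

Lemma kco_E x :
  @kco Ad1 (ord0, ord_max) (lie (iota2 JT e (E, 0)) x) =
    @kco Ad1 (ord_max, ord_max) x - @kco Ad1 (ord0, ord0) x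
  /\ @kco Ad0 (ord0, ord_max) (lie (iota2 JT e (0, E)) x) =
    @kco Ad0 (ord_max, ord_max) x - @kco Ad0 (ord0, ord0) x.
Proof.
elim/kind_ind: x => [|x y [x1 x0] [y1 y0]|k a i ha].
- by rewrite !(lin0 (lie_linr _)) !(lin0 (kco_lin _)) subr0.
- by rewrite !(linD (lie_linr _)) !(linD (kco_lin _)) x1 y1 x0 y0; split; module.
rewrite !kmap_der //; split.
  have [kA|kA] := eqVneq k Ad1; last by rewrite !kco_diff ?subr0.
  by move: a i ha; rewrite kA => a i ha; rewrite !kco_same // -scalerBl; congr (_ *: _); apply: lie_E_01.
have [kA|kA] := eqVneq k Ad0; last by rewrite !kco_diff ?subr0.
by move: a i ha; rewrite kA => a i ha; rewrite !kco_same // -scalerBl; congr (_ *: _); apply: lie_E_01.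
Qed.

Lemma fixed_lie x X : fixed Phi x -> lie (iota2 JT e X) x = 0.
Proof.
move=> fx; have := Phi_diff F2 ee F3 X x; rewrite fx => h.
apply: esym; apply: (bten_dual_inj (x := x) (x' := x)).
by rewrite bten0l addr0.
Qed.

(** A fixed vector has weight zero, so that only its components of kind [Ad1] and
    [Ad0] along [H] must be excluded; brackets with [E] detect them. *)
Lemma fixedE : fixed Phi = kcomp Triv.
Proof.
apply/seteqP; split=> [x fx|].
  apply: kcomp_of_co => l i lT.
  have [k1 k2] := kco_weight i x; move: k1 k2; rewrite !fixed_lie // (lin0 (kco_lin i)).
  move=> /esym/eqP; rewrite scaler_eq0 => /orP[/eqP w1|/eqP //].
  move=> /esym/eqP; rewrite scaler_eq0 => /orP[/eqP w2|/eqP //].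
  have [t1 t0] := kco_trace x; have [e1 e0] := kco_E x.
  move: e1 e0; rewrite !fixed_lie // !(lin0 (kco_lin _)) => e1 e0.
  have tz (u v : J) : u + v = 0 -> 0 = v - u -> u = 0 /\ v = 0.
    move=> uv /eqP; rewrite eq_sym subr_eq0 => /eqP vu; move: uv; rewrite vu -mulr2n -scaler_nat => /eqP.
    by rewrite scaler_eq0 (negPf F2) => /eqP.
  have [a0 a1] := tz _ _ t1 e1; have [b0 b1] := tz _ _ t0 e0.
  have N1 : (-1 : F) != 0 by rewrite oppr_eq0 oner_neq0.
  case: l i lT w1 w2 => i //= _.
  + move=> w1 _; case: i w1 => a b /=; case: (ord2P a) => ->; case: (ord2P b) => -> //= /eqP.
      by rewrite (negPf (subr1N_neq0 F2)).
    by rewrite (negPf (subrN1_neq0 F2)).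
  + move=> _ w1; case: i w1 => a b /=; case: (ord2P a) => ->; case: (ord2P b) => -> //= /eqP.
      by rewrite (negPf (subr1N_neq0 F2)).
    by rewrite (negPf (subrN1_neq0 F2)).
  + by case: ifP => _ /eqP; rewrite ?(negPf N1) ?(negPf (oner_neq0 F)).
  + by move=> _; case: ifP => _ /eqP; rewrite ?(negPf N1) ?(negPf (oner_neq0 F)).
  + by case: ifP => _ /eqP; rewrite ?(negPf N1) ?(negPf (oner_neq0 F)).
apply: lspan_lin => [_ [d [c [hd ->]]] R g||c x y fx fy R g].
- have [_ h] := hom_S F2 ee F3 hd.
  by have := h R g (bten (c : F^o) 1); rewrite blin_bten //; apply: (hom_S F2 ee F3 hd).1.
- by move=> R g; rewrite bten0l; apply: lin0 (ract_lin _ _).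
- have l := ract_lin (Phi_rep F2 ee) (g : SL2SL2f F R).
  by rewrite btenDl btenZl -[c *: 1]mulr1 -scale_bten (linD l) (linZ l) fx fy.
Qed.
End Kinds.

(** * Decomposition into irreducible submodules *)

Section Short.
Variables (F : fieldType) (F2 : (2%:R : F) != 0) (beta : skew_form F).
Variables (L : lieAlgType F) (Psi : sstruct (SL2f F) L) (iota : sl2 F -> L).
Variables (J T D : lmodType F) (dec : isotypic_dec Psi J T D).
Variable JT : coordinatization beta iota dec.
Local Notation jm := (jmul JT).
Local Notation act := (jact (jt_mod JT)).
Local Notation DD := (co_D JT).
Local Notation DJ := (co_DJ JT).
Variable e : J.
Local Notation J1 := (peirceJ1 JT e).
Local Notation Jh := (peirceJh JT e).
Local Notation J0 := (peirceJ0 JT e).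
Local Notation T1 := (peirceT1 JT e).
Local Notation T0 := (peirceT0 JT e).
Hypothesis ee : jm e e = e.
Hypothesis F3 : (3%:R : F) != 0.
Local Notation Phi := (Phi F2 ee F3).
Local Notation kmap := (kmap F2 JT e).
Local Notation kco := (kco JT e).
Local Notation kin := (kin JT e).

Let basis k : set (kspace J T D k) := sval (cid (exists_basis (@kin k))).
Let basisP k : [/\ @basis k `<=` @kin k, lin_indep (@basis k) & @kin k `<=` lspan (@basis k)].
Proof. by rewrite /basis; case: cid. Qed.

Let fiber (k : short_kind) : choiceType := {b : kspace J T D k | `[< @basis k b >]}.
(* One copy for each kind and each vector of a basis of its parameter space. *)
Let index : choiceType := {k : short_kind & fiber k}.
Let vec (i : index) : kspace J T D (tag i) := val (tagged i).
Let incl (i : index) (m : short_mod F (tag i)) : L := kmap (vec i) m.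

Let vec_in i : kin (vec i).
Proof. by case: (basisP (tag i)) => h _ _; apply/h/asboolP/(valP (tagged i)). Qed.

Let incl_lin i : linear (@incl i).
Proof. exact: kmap_linr. Qed.

Let represented (x : L) : Prop := exists (s : seq index) (m : forall i : index, short_mod F (tag i)),
  uniq s /\ x = \sum_(i <- s) incl (m i).

Let sum_restrict (s t : seq index) (G : index -> L) : uniq s -> uniq t -> {subset s <= t} ->
  \sum_(i <- t) (if i \in s then G i else 0) = \sum_(i <- s) G i.
Proof.
move=> us ut st; rewrite -big_mkcond -big_filter; apply/perm_big/uniq_perm => //.
  exact: filter_uniq.
by move=> i; rewrite mem_filter andb_idr //; apply: st.
Qed.

Let represented0 : represented 0.
Proof. by exists [::], (fun i => 0); rewrite big_nil. Qed.

Let representedD x y : represented x -> represented y -> represented (x + y).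
Proof.
move=> [s [m [us ->]]] [t [n [ut ->]]].
pose st := undup (s ++ t).
exists st, (fun i => (if i \in s then m i else 0) + (if i \in t then n i else 0)).
split; first exact: undup_uniq.
rewrite -(@sum_restrict s st (fun i => incl (m i))) ?undup_uniq //; last first.
  by move=> i si; rewrite mem_undup mem_cat si.
rewrite -(@sum_restrict t st (fun i => incl (n i))) ?undup_uniq //; last first.
  by move=> i ti; rewrite mem_undup mem_cat ti orbT.
rewrite -big_split; apply: eq_bigr => i _ /=; rewrite (linD (@incl_lin i)).
by congr (_ + _); case: ifP; rewrite ?(lin0 (@incl_lin i)).
Qed.

Let represented_map k (b : kspace J T D k) m : @basis k b -> represented (kmap b m).
Proof.
move=> /asboolP hb; pose i : index := Tagged fiber (Sub b hb : fiber k).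
exists [:: i], (dfwith (fun j : index => 0 : short_mod F (tag j)) (m : short_mod F (tag i))).
by rewrite big_seq1 dfwith_in.
Qed.

(* The members of [s] of kind [k], with [k] no longer hidden in the index. *)
Let fiber_seq (s : seq index) k :
  exists t : seq (fiber k), [seq i <- s | tag i == k] = [seq Tagged fiber b | b <- t].
Proof.
elim: s => [|[l b] s [t ht]]; first by exists [::].
rewrite /= ht; have [lk|_] := eqVneq l k; last by exists t.
by move: b; rewrite lk => b; exists (b :: t).
Qed.

(** The coordinates [kco] of a vanishing sum are linear relations between the vectors
    of a basis. *)
Lemma Phi_short : is_short Phi.
Proof.
exists index, (fun i => tag i), incl; split => [i|x|s m us s0 i0 si].
- exact/kmap_hom/vec_in.
- suff [s [m [_ ->]]] : represented x by exists s, m.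
  rewrite (kco_sum F2 ee x); apply: (big_ind represented) => // k _.
  apply: (big_ind represented) => // i _.
  have [_ _ /(_ _ (kco_in F2 ee i x)) [s [sB ->]]] := basisP k.
  rewrite (lin_sum (kmap_linl F2 JT e (kbase F2 i))) big_seq.
  apply: (big_ind represented) => // p ps.
  by rewrite (linZ (kmap_linl _ _ _ _)) -(linZ (kmap_linr _ _ _ _)); apply/represented_map/sB.
case: i0 si => k b0 si; rewrite [m _](kcoord_sum F2); apply: big1 => j _.
rewrite /= in j *; have [t ht] := fiber_seq s k.
have [bk bi _] := basisP k.
have tk (b : fiber k) : kin (vec (Tagged fiber b)) by exact: vec_in.
pose c (b : fiber k) := kcoord j (m (Tagged fiber b)).
pose c' (v : kspace J T D k) := if insub v is Some b then c b else 0.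
have c'E b : c' (val b) = c b by rewrite /c' valK.
have ut : uniq (map val t).
  rewrite map_inj_uniq; last exact: val_inj.
  by apply: (@map_uniq _ _ (Tagged fiber)); rewrite -ht filter_uniq.
have rel : \sum_(v <- map val t) c' v *: v = 0.
  rewrite big_map -[RHS](lin0 (kco_lin JT e j)) -[in RHS]s0 (lin_sum (kco_lin JT e j)).
  rewrite [RHS](bigID (fun i : index => tag i == k)) /= [X in _ = _ + X]big1 ?addr0; last first.
    by move=> i ik; apply: kco_diff => //; apply: vec_in.
  rewrite -[RHS]big_filter ht big_map; apply: eq_bigr => b _.
  by rewrite c'E; exact: (esym (kco_same F2 ee j (m (Tagged fiber b)) (tk b))).
have b0t : b0 \in t.
  have : Tagged fiber b0 \in [seq Tagged fiber b | b <- t] by rewrite -ht mem_filter eqxx.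
  by move=> /mapP[b bt /eqP]; rewrite -tag_eqE /tag_eq eqxx /= tagged_asE => /eqP ->.
have tB v : v \in map val t -> @basis k v by move=> /mapP[b _ ->]; apply/asboolP/(valP b).
by rewrite -/(c b0) -c'E (bi _ _ ut tB rel) ?scale0r // map_f.
Qed.
End Short.

(** * Direct sums of two or three subspaces *)

Section SmallSums.
Variables (F : fieldType) (N : lmodType F).

Lemma is_dsum2 (A B W : set N) (p q : N -> N) : linear p -> linear q ->
  (forall x, W x -> [/\ A (p x), B (q x) & x = p x + q x]) ->
  (forall x y, A x -> B y -> W (x + y)) ->
  (forall x, A x -> p x = x /\ q x = 0) -> (forall x, B x -> p x = 0 /\ q x = x) ->
  is_dsum [:: A; B] W.
Proof.
move=> pl ql pW sW pA pB.
apply: (@is_dsum_proj _ _ [:: A; B] W (fun i => if i == ord0 then p else q)).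
- by move=> i; case: ifP.
- by move=> i x /pW [Ap Bq _]; case: (ord2P i) => ->.
- by move=> x /pW [_ _ h]; rewrite sum2.
- by move=> a aA; rewrite sum2; apply: sW; [exact: (aA ord0) | exact: (aA ord_max)].
move=> i j x; case: (ord2P j) => -> /= h; case: (ord2P i) => -> /=;
  by [case: (pA x h) | case: (pB x h)].
Qed.

Lemma is_dsum3 (A B C W : set N) (p q r : N -> N) : linear p -> linear q -> linear r ->
  (forall x, W x -> [/\ A (p x), B (q x), C (r x) & x = p x + q x + r x]) ->
  (forall x y z, A x -> B y -> C z -> W (x + y + z)) ->
  (forall x, A x -> [/\ p x = x, q x = 0 & r x = 0]) ->
  (forall x, B x -> [/\ p x = 0, q x = x & r x = 0]) ->
  (forall x, C x -> [/\ p x = 0, q x = 0 & r x = x]) ->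
  is_dsum [:: A; B; C] W.
Proof.
move=> pl ql rl pW sW pA pB pC.
pose o1 : 'I_3 := @Ordinal 3 1 isT.
have ord3P (i : 'I_3) : [\/ i = ord0, i = o1 | i = ord_max].
  by case: i => [[|[|[|//]]] hi]; [constructor 1 | constructor 2 | constructor 3]; apply/val_inj.
have sum3 (E : 'I_3 -> N) : \sum_i E i = E ord0 + E o1 + E ord_max.
  by rewrite !big_ord_recl big_ord0 addr0 addrA; congr (_ + E _ + E _); apply/val_inj.
apply: (@is_dsum_proj _ _ [:: A; B; C] W
  (fun i => if i == ord0 then p else if i == o1 then q else r)).
- by move=> i; case: ifP => // _; case: ifP.
- by move=> i x /pW [? ? ? _]; case: (ord3P i) => ->.
- by move=> x /pW [_ _ _ h]; rewrite sum3.
- by move=> a aA; rewrite sum3; apply: sW; [exact: (aA ord0) | exact: (aA o1) | exact: (aA ord_max)].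
move=> i j x; case: (ord3P j) => -> /= h; case: (ord3P i) => -> /=;
  by [case: (pA x h) | case: (pB x h) | case: (pC x h)].
Qed.
End SmallSums.

(** * The copy of sl2 given by the unit *)

Section InnerCoordinates.
Variables (F : fieldType) (F2 : (2%:R : F) != 0) (beta : skew_form F).
Variables (L : lieAlgType F) (Psi : sstruct (SL2f F) L) (iota : sl2 F -> L).
Variables (J T D : lmodType F) (dec : isotypic_dec Psi J T D).
Variable JT : coordinatization beta iota dec.
Local Notation jm := (jmul JT).
Local Notation act := (jact (jt_mod JT)).
Local Notation DD := (co_D JT).
Local Notation DJ := (co_DJ JT).
Local Notation E := (sl2E F). Local Notation H := (sl2H F). Local Notation Y := (sl2F F).

Lemma coordinates_ind (P : L -> Prop) : P 0 -> (forall x y, P x -> P y -> P (x + y)) ->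
  (forall X a, P (elJ dec X a)) -> (forall u x, P (elT dec u x)) ->
  (forall d, P (id_D dec d)) -> forall x, P x.
Proof.
move=> P0 PD PJ PT PDD x; rewrite (coordinates_sum dec F2 x).
apply: (PD) => //; apply: (PD); last by apply: (big_ind P).
by apply: (big_ind P) => // i _; apply: (big_ind P).
Qed.

Lemma lie_one_elJ X Z a : lie (elJ dec X (jone JT)) (elJ dec Z a) = elJ dec (lie X Z) a.
Proof. by rewrite (co_lieJJ JT) jmul1 DD_1l // (lin0 (id_D_lin dec)) scaler0 addr0. Qed.

Lemma lie_one_elT X u x : lie (elJ dec X (jone JT)) (elT dec u x) = elT dec (sl2val X *m u) x.
Proof. by rewrite (co_lieJT JT) jact1. Qed.

Lemma lie_one_D X d : lie (elJ dec X (jone JT)) (id_D dec d) = 0.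
Proof.
by rewrite lieC (co_lieDJ JT) DJ_one // (lin0 ((elJ_bilin dec).2 _)) oppr0.
Qed.

Lemma lie_H_entry (X : sl2 F) i j : sl2val (lie H X) i j =
  ((if i == ord0 then 1 else - 1) - (if j == ord0 then 1 else - 1)) * sl2val X i j.
Proof.
rewrite sl2_lieE !mxE !sum2 !mxE /=.
by case: (ord2P i) => ->; case: (ord2P j) => -> /=; ring.
Qed.

Lemma H_vec_entry (u : natmod F) i : (sl2val H *m (u : 'cV_2)) i ord0 =
  (if i == ord0 then 1 else - 1) * u i ord0.
Proof. by rewrite !mxE !sum2 !mxE /=; case: (ord2P i) => -> /=; ring. Qed.

Lemma cJ_H i j x : cJ dec i j (lie (elJ dec H (jone JT)) x) =
  ((if i == ord0 then 1 else - 1) - (if j == ord0 then 1 else - 1)) *: cJ dec i j x.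
Proof.
elim/coordinates_ind: x => [|x y hx hy|X a|u x|d].
- by rewrite (lin0 (lie_linr _)) (lin0 (cJ_lin dec i j)) scaler0.
- by rewrite (linD (lie_linr _)) !(linD (cJ_lin dec i j)) hx hy scalerDr.
- by rewrite lie_one_elJ !cJ_elJ lie_H_entry scalerA.
- by rewrite lie_one_elT !cJ_elT scaler0.
- by rewrite lie_one_D cJ_D (lin0 (cJ_lin dec i j)) scaler0.
Qed.

Lemma cT_H i x : cT dec i (lie (elJ dec H (jone JT)) x) =
  (if i == ord0 then 1 else - 1) *: cT dec i x.
Proof.
elim/coordinates_ind: x => [|x y hx hy|X a|u x|d].
- by rewrite (lin0 (lie_linr _)) (lin0 (cT_lin dec i)) scaler0.
- by rewrite (linD (lie_linr _)) !(linD (cT_lin dec i)) hx hy scalerDr.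
- by rewrite lie_one_elJ !cT_elJ scaler0.
- by rewrite lie_one_elT !cT_elT H_vec_entry scalerA.
- by rewrite lie_one_D cT_D (lin0 (cT_lin dec i)) scaler0.
Qed.

Lemma cD_one X x : cD dec (lie (elJ dec X (jone JT)) x) = 0.
Proof.
elim/coordinates_ind: x => [|x y hx hy|Z a|u x|d].
- by rewrite (lin0 (lie_linr _)) (lin0 (cD_lin dec)).
- by rewrite (linD (lie_linr _)) (linD (cD_lin dec)) hx hy addr0.
- by rewrite lie_one_elJ cD_elJ.
- by rewrite lie_one_elT cD_elT.
- by rewrite lie_one_D (lin0 (cD_lin dec)).
Qed.

Lemma cJ_E x : cJ dec ord0 ord_max (lie (elJ dec E (jone JT)) x) =
  cJ dec ord_max ord_max x - cJ dec ord0 ord0 x.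
Proof.
elim/coordinates_ind: x => [|x y hx hy|X a|u x|d].
- by rewrite (lin0 (lie_linr _)) !(lin0 (cJ_lin dec _ _)) subr0.
- by rewrite (linD (lie_linr _)) !(linD (cJ_lin dec _ _)) hx hy; module.
- by rewrite lie_one_elJ !cJ_elJ lie_E_01 scalerBl.
- by rewrite lie_one_elT !cJ_elT subr0.
- by rewrite lie_one_D !cJ_D (lin0 (cJ_lin dec _ _)) subr0.
Qed.

(** Brackets with [H] leave only the [D]-part and the diagonal of the [J]-part, which
    the bracket with [E] detects. *)
Lemma fixed_D x : (forall X, lie (elJ dec X (jone JT)) x = 0) -> x = id_D dec (cD dec x).
Proof.
move=> h; have hJ i j := cJ_H i j x; have hT i := cT_H i x.
have hE := cJ_E x; have tr := cJ_trace dec x.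
have T0' i : cT dec i x = 0.
  move: (hT i); rewrite h (lin0 (cT_lin dec i)) => /esym/eqP; rewrite scaler_eq0.
  by case: ifP => _; rewrite ?oppr_eq0 oner_eq0 => /eqP.
have J01 : cJ dec ord0 ord_max x = 0.
  move: (hJ ord0 ord_max); rewrite h (lin0 (cJ_lin dec _ _)) => /esym/eqP.
  by rewrite scaler_eq0 /= (negPf (subr1N_neq0 F2)) => /eqP.
have J10 : cJ dec ord_max ord0 x = 0.
  move: (hJ ord_max ord0); rewrite h (lin0 (cJ_lin dec _ _)) => /esym/eqP.
  by rewrite scaler_eq0 /= (negPf (subrN1_neq0 F2)) => /eqP.
move: hE; rewrite h (lin0 (cJ_lin dec _ _)) => /esym/eqP; rewrite subr_eq0 => /eqP hE.
have J00 : cJ dec ord0 ord0 x = 0.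
  by move: tr; rewrite hE -mulr2n -scaler_nat => /eqP; rewrite scaler_eq0 (negPf F2) => /eqP.
rewrite [LHS](coordinates_sum dec F2 x) !sum2 !T0' J01 J10 hE J00.
by rewrite !(lin0 ((elJ_bilin dec).2 _)) !(lin0 ((elT_bilin dec).2 _)) !add0r.
Qed.

(** The other weights of [H (x) 1] on [L] are [0], [-2], [1] and [-1]; they differ from
    [2] since the characteristic is not 2 or 3. *)
Lemma weight_two (F3 : (3%:R : F) != 0) x :
  lie (elJ dec H (jone JT)) x = 2 *: x -> x = elJ dec E (cJ dec ord0 ord_max x).
Proof.
move=> h; have hJ i j := cJ_H i j x; have hT i := cT_H i x; have hD := cD_one H x.
move: hD; rewrite h (linZ (cD_lin dec)) => /eqP; rewrite scaler_eq0 (negPf F2) => /eqP D0.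
have T0' i : cT dec i x = 0.
  move: (hT i); rewrite h (linZ (cT_lin dec i)) => /eqP; rewrite -subr_eq0 -scalerBl scaler_eq0.
  case: ifP => _ /orP[|/eqP //]; first by have -> : (2 - 1 : F) = 1; [ring | rewrite oner_eq0].
  by have -> : (2 - -1 : F) = 3; [ring | rewrite (negPf F3)].
have J0' i j : (i, j) != (ord0, ord_max) -> cJ dec i j x = 0.
  move: (hJ i j); rewrite h (linZ (cJ_lin dec i j)) => /eqP; rewrite -subr_eq0 -scalerBl scaler_eq0.
  case: (ord2P i) => ->; case: (ord2P j) => -> //= /orP[|/eqP //].
  - by rewrite subrr subr0 (negPf F2).
  - have -> : (2 - (- 1 - 1) : F) = 2 * 2 by ring.
    by rewrite mulf_eq0 (negPf F2).
  - by rewrite subrr subr0 (negPf F2).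
rewrite {1}(coordinates_sum dec F2 x) !sum2 !T0' D0 (J0' ord0 ord0) //
  (J0' ord_max ord0) // (J0' ord_max ord_max) // dev_delta01.
by rewrite !(lin0 ((elJ_bilin dec).2 _)) !(lin0 ((elT_bilin dec).2 _)) (lin0 (id_D_lin dec)) add0r !addr0.
Qed.
End InnerCoordinates.

(** * The idempotent of a structure of type SL2 x SL2 *)

Section IdempotentOfStructure.
Variables (F : fieldType) (F2 : (2%:R : F) != 0) (F3 : (3%:R : F) != 0) (beta : skew_form F).
Variables (L : lieAlgType F) (Psi : sstruct (SL2f F) L) (iota : sl2 F * sl2 F -> L).
Variables (J T D : lmodType F) (dec : isotypic_dec Psi J T D).
Variable JT : coordinatization beta (fun X => iota (X, X)) dec.
Hypotheses (iota_hom : lie_hom iota) (iota_inj : injective iota).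
Local Notation jm := (jmul JT).
Local Notation E := (sl2E F). Local Notation H := (sl2H F). Local Notation Y := (sl2F F).

Let il : linear iota. Proof. exact: iota_hom.1. Qed.
Let ib X1 X2 Z1 Z2 : lie (iota (X1, X2)) (iota (Z1, Z2)) = iota (lie X1 Z1, lie X2 Z2).
Proof. by rewrite -iota_hom.2. Qed.
Let i1 X : iota (X, X) = elJ dec X (jone JT). Proof. exact: (co_unit JT). Qed.
Let lie0 (X : sl2 F) : lie X 0 = 0. Proof. exact: lin0 (lie_linr X). Qed.

(** The vector [iota (E, 0)] has weight 2 for [H (x) 1], so it is [E (x) e] for some [e];
    brackets with the diagonal copy [f (x) 1] propagate this to all [iota (f, 0)], and
    [[E, F] = H] gives [e . e = e]. *)
Lemma iota_split :
  exists e : J, [/\ jm e e = e, e != 0, e != jone JT &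
    is_dsum [:: slx dec e; slx dec (jone JT - e)] (range iota)].
Proof.
pose e := cJ dec ord0 ord_max (iota (E, 0)); exists e.
have De1 : co_D JT e (jone JT) = 0 by rewrite co_D_skew DD_1l // oppr0.
have iE : iota (E, 0) = elJ dec E e.
  apply: (weight_two (JT := JT) F2 F3); rewrite -i1 ib lie_HE lie0 -(linZ il).
  by congr iota; congr pair; rewrite /= scaler0.
have iH : iota (H, 0) = elJ dec H e.
  rewrite -lie_EF -[0 in LHS](@lie0 0).
  have -> : lie (0 : sl2 F) 0 = lie 0 Y by rewrite lie0 [RHS]lieC lie0 oppr0.
  rewrite -ib iE i1 (co_lieJJ JT) De1 (lin0 (id_D_lin dec)) scaler0 addr0 lie_EF.
  by rewrite jmr1.
have iY : iota (Y, 0) = elJ dec Y e.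
  apply: (scalerI F2); rewrite -(linZ il) -(linZ ((elJ_bilin dec).1 e)) -lie_FH.
  rewrite -(lie_one_elJ F2 JT) -i1 -iH ib lie0 lie_FH; congr iota.
  by congr pair; rewrite /= scaler0.
have i_l X : iota (X, 0) = elJ dec X e.
  have sc c Z : iota (c *: Z, 0) = c *: iota (Z, 0).
    by rewrite -(linZ il); congr iota; congr pair; rewrite /= scaler0.
  have sD Z W : iota (Z + W, 0) = iota (Z, 0) + iota (W, 0).
    by rewrite -(linD il); congr iota; congr pair; rewrite /= addr0.
  rewrite [X]sl2_eta !sD !sc iE iH iY !(linD ((elJ_bilin dec).1 e)).
  by rewrite !(linZ ((elJ_bilin dec).1 e)).
have i_r X : iota (0, X) = elJ dec X (jone JT - e).
  rewrite (linD ((elJ_bilin dec).2 X)) (linN ((elJ_bilin dec).2 X)) -i1 -i_l.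
  rewrite -(linN il) -(linD il); congr iota; congr pair; rewrite /= ?subrr //.
  by rewrite oppr0 addr0.
have ee : jm e e = e.
  apply: (elJ_inj (dec := dec) (H_neq0 F)); rewrite -i_l -lie_EF -[0 in RHS](@lie0 0) -ib !i_l.
  by rewrite (co_lieJJ JT) DD_self // (lin0 (id_D_lin dec)) scaler0 addr0 lie_EF.
have E0 X a : a = 0 -> elJ dec X a = 0 by move=> ->; exact: lin0 ((elJ_bilin dec).2 X).
split=> //.
- apply/eqP => e0; have := i_l E; rewrite E0 // -(lin0 il) => /iota_inj /(congr1 fst) /eqP.
  by rewrite (negPf (E_neq0 F)).
- apply/eqP => e1; have := i_r E; rewrite E0 ?e1 ?subrr // -(lin0 il) => /iota_inj /(congr1 snd) /eqP.
  by rewrite (negPf (E_neq0 F)).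
have ef : jm e (jone JT - e) = 0 by rewrite jmulC jm_compl ee subrr.
have iotaE X1 X2 : iota (X1, X2) = elJ dec X1 e + elJ dec X2 (jone JT - e).
  rewrite -i_l -i_r -(linD il); congr iota; congr pair; by rewrite /= ?addr0 ?add0r.
(* Multiplication by [e] on the [J]-coordinates separates the two summands. *)
pose p (x : L) := \sum_i \sum_j elJ dec (dev F2 (delta_mx i j)) (jm e (cJ dec i j x)).
pose q (x : L) := \sum_i \sum_j elJ dec (dev F2 (delta_mx i j)) (cJ dec i j x - jm e (cJ dec i j x)).
have sumE X a : \sum_i \sum_j elJ dec (dev F2 (delta_mx i j)) (sl2val X i j *: a) = elJ dec X a.
  rewrite [in RHS](sl2_dev_sum F2 X) (lin_sum ((elJ_bilin dec).1 a)); apply: eq_bigr => i _.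
  rewrite (lin_sum ((elJ_bilin dec).1 a)); apply: eq_bigr => j _.
  by rewrite (linZ ((elJ_bilin dec).1 a)) (linZ ((elJ_bilin dec).2 _)).
have pl : linear p.
  move=> c x y; rewrite /p scaler_sumr -big_split; apply: eq_bigr => i _ /=.
  rewrite scaler_sumr -big_split; apply: eq_bigr => j _ /=.
  by rewrite (cJ_lin dec) (jm_linr JT) ((elJ_bilin dec).2 _).
have ql : linear q.
  move=> c x y; rewrite /q scaler_sumr -big_split; apply: eq_bigr => i _ /=.
  rewrite scaler_sumr -big_split; apply: eq_bigr => j _ /=.
  rewrite (cJ_lin dec) (jm_linr JT) -((elJ_bilin dec).2 _); congr elJ; module.
have pe X : p (elJ dec X e) = elJ dec X e /\ q (elJ dec X e) = 0.
  split; first by rewrite -[RHS]sumE; apply: eq_bigr => i _; apply: eq_bigr => j _;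
    rewrite cJ_elJ (linZ (jm_linr JT e)) ee.
  rewrite /q big1 // => i _; rewrite big1 // => j _.
  by rewrite cJ_elJ (linZ (jm_linr JT e)) ee subrr E0.
have pf X : p (elJ dec X (jone JT - e)) = 0 /\ q (elJ dec X (jone JT - e)) = elJ dec X (jone JT - e).
  split; last by rewrite -[RHS]sumE; apply: eq_bigr => i _; apply: eq_bigr => j _;
    rewrite cJ_elJ (linZ (jm_linr JT e)) ef scaler0 subr0.
  rewrite /p big1 // => i _; rewrite big1 // => j _.
  by rewrite cJ_elJ (linZ (jm_linr JT e)) ef scaler0 E0.
apply: (is_dsum2 (p := p) (q := q)) => //.
- move=> _ [[X1 X2] _ <-]; rewrite iotaE (linD pl) (linD ql).
  have [[-> ->] [-> ->]] := (pe X1, pf X2); rewrite addr0 add0r.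
  by split=> //; [exists X1 | exists X2].
- by move=> _ _ [X1 _ <-] [X2 _ <-]; exists (X1, X2).
- by move=> _ [X _ <-]; exact: pe.
- by move=> _ [X _ <-]; exact: pf.
Qed.
End IdempotentOfStructure.

(** * The isotypic decomposition attached to an idempotent *)

Section Conclusion.
Variables (F : fieldType) (F2 : (2%:R : F) != 0) (beta : skew_form F).
Variables (L : lieAlgType F) (Psi : sstruct (SL2f F) L) (iota : sl2 F -> L).
Variables (J T D : lmodType F) (dec : isotypic_dec Psi J T D).
Variable JT : coordinatization beta iota dec.
Local Notation jm := (jmul JT).
Local Notation act := (jact (jt_mod JT)).
Local Notation DD := (co_D JT).
Local Notation DJ := (co_DJ JT).
Variable e : J.
Local Notation J1 := (peirceJ1 JT e).
Local Notation Jh := (peirceJh JT e).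
Local Notation J0 := (peirceJ0 JT e).
Local Notation T1 := (peirceT1 JT e).
Local Notation T0 := (peirceT0 JT e).
Hypothesis ee : jm e e = e.
Hypothesis F3 : (3%:R : F) != 0.
Local Notation th := (theta F2 JT e).
Local Notation Phi := (Phi F2 ee F3).
Local Notation kcomp := (kcomp F2 JT e).
Local Notation DeJh := [set id_D dec (DD e a) | a in Jh].

Lemma peirceJ_dsum : is_dsum [:: J1; Jh; J0] setT.
Proof.
apply: (is_dsum3 (p := proj1 JT e) (q := projh JT e) (r := proj0 JT e)) => //.
- exact: proj1_lin.
- exact: projh_lin.
- exact: proj0_lin.
- by move=> x _; split; [exact: proj1_in | exact: projh_in | exact: proj0_in | exact: peirce_sum].
- by move=> x; apply: proj_J1.
- by move=> x; apply: proj_Jh.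
- by move=> x; apply: proj_J0.
Qed.

Lemma peirceT_dsum : is_dsum [:: T1; T0] setT.
Proof.
have ql : linear (fun x => x - act e x) by move=> c x y; rewrite (act_linr JT); module.
apply: (is_dsum2 (p := act e) (q := fun x => x - act e x)) => //.
- exact: act_linr.
- by move=> x _; split; [exact: T1_act | exact: T0_act | rewrite addrC subrK].
- by move=> x /= h; rewrite h subrr.
- by move=> x /= h; rewrite h subr0.
Qed.

Lemma theta_diag a (X : sl2 F) : J1 a \/ J0 a -> th a (sl2val X) = elJ dec X a.
Proof.
by move=> ha; rewrite /theta dev_sl2 sl2_tr mulr0 scale0r addr0.
Qed.

Lemma slA_J1 : slA dec J1 = kcomp Ad1.
Proof.
congr lspan; apply/seteqP; split=> [_ [X _ [a ha <-]] | _ [a [X [ha ->]]]].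
  by exists a, X; split=> //=; rewrite theta_diag //; left.
by exists X => //; exists a => //=; rewrite theta_diag //; left.
Qed.

Lemma slA_J0 : slA dec J0 = kcomp Ad0.
Proof.
congr lspan; apply/seteqP; split=> [_ [X _ [a ha <-]] | _ [a [X [ha ->]]]].
  by exists a, X; split=> //=; rewrite theta_diag //; right.
by exists X => //; exists a => //=; rewrite theta_diag //; right.
Qed.

Lemma VA_T1 : VA dec T1 = kcomp Nat1.
Proof.
congr lspan; apply/seteqP; split=> [_ [u _ [x hx <-]] | _ [x [u [hx ->]]]].
  by exists x, u.
by exists u => //; exists x.
Qed.

Lemma VA_T0 : VA dec T0 = kcomp Nat0.
Proof.
congr lspan; apply/seteqP; split=> [_ [u _ [x hx <-]] | _ [x [u [hx ->]]]].
  by exists x, u.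
by exists u => //; exists x.
Qed.

(** The projections of [L] onto its [J]-part and its [D]-part. *)
Definition partJ (x : L) : L := \sum_i \sum_j elJ dec (dev F2 (delta_mx i j)) (cJ dec i j x).
Definition partD (x : L) : L := id_D dec (cD dec x).

Lemma partJ_lin : linear partJ.
Proof.
move=> c x y; rewrite /partJ scaler_sumr -big_split; apply: eq_bigr => i _ /=.
rewrite scaler_sumr -big_split; apply: eq_bigr => j _ /=.
by rewrite (cJ_lin dec) ((elJ_bilin dec).2 _).
Qed.
Lemma partD_lin : linear partD.
Proof. by move=> c x y; rewrite /partD (cD_lin dec) (id_D_lin dec). Qed.

Lemma partJ_elJ X a : partJ (elJ dec X a) = elJ dec X a.
Proof.
rewrite [RHS](coordinates_sum dec F2) cD_elJ (lin0 (id_D_lin dec)) addr0.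
by rewrite [X in _ = _ + X]big1 ?addr0 // => i _; rewrite cT_elJ (lin0 ((elT_bilin dec).2 _)).
Qed.
Lemma partJ_D d : partJ (id_D dec d) = 0.
Proof.
by rewrite /partJ big1 // => i _; rewrite big1 // => j _; rewrite cJ_D (lin0 ((elJ_bilin dec).2 _)).
Qed.
Lemma partD_elJ X a : partD (elJ dec X a) = 0.
Proof. by rewrite /partD cD_elJ (lin0 (id_D_lin dec)). Qed.
Lemma partD_D d : partD (id_D dec d) = id_D dec d.
Proof. by rewrite /partD cD_D. Qed.

Lemma partJ_theta a X : partJ (th a X) = elJ dec (dev F2 X) a.
Proof. by rewrite /theta (linD partJ_lin) (linZ partJ_lin) partJ_elJ partJ_D scaler0 addr0. Qed.
Lemma partD_theta a X : partD (th a X) = (2 * \tr X) *: id_D dec (DD e a).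
Proof. by rewrite /theta (linD partD_lin) (linZ partD_lin) partD_elJ partD_D add0r. Qed.

(** Scalar matrices single out [D_{e,a}]: the factor [1/4] compensates [2] times the
    trace [2] of the unit matrix. *)
Lemma theta_scalar a c : th a (4^-1 * c)%:M = c *: id_D dec (DD e a).
Proof.
rewrite /theta dev_scalar (lin0 ((elJ_bilin dec).1 a)) add0r mxtrace_scalar.
have F4 : (4 : F) != 0 by rewrite -[4%N]/(2 * 2)%N natrM mulf_neq0.
have -> : 2 * (4^-1 * c *+ 2) = 4 * 4^-1 * c by ring.
by rewrite mulfV // mul1r.
Qed.

Lemma kcomp_theta a X : Jh a -> kcomp Nat10 (th a X).
Proof. by move=> ha; rewrite -[X]mx_tensK; apply: (kcomp_map F2 (k := Nat10)). Qed.

Lemma DeJhP c x y : DeJh x -> DeJh y -> DeJh (c *: x + y).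
Proof.
move=> [a ha <-] [b hb <-]; exists (c *: a + b).
  exact: (kinP (e := e) (k := Nat10) (JT := JT)).
by rewrite (DD_linr JT) (id_D_lin dec).
Qed.
Lemma DeJh0 : DeJh 0.
Proof.
exists 0; first exact: (kin0 JT e Nat10).
by rewrite (lin0 (DD_linr JT e)) (lin0 (id_D_lin dec)).
Qed.

Lemma nat10_dsum : is_dsum [:: slA dec Jh; DeJh] (kcomp Nat10).
Proof.
apply: (is_dsum2 partJ_lin partD_lin).
- apply: lspan_lin => [_ [a [t [ha ->]]]||c x y [x1 x2 x3] [y1 y2 y3]].
  + rewrite [kmap _ _ _ _ _]/(th a (tens_mx t)) partJ_theta partD_theta; split=> //.
      by apply: lspan_sub; exists (dev F2 (tens_mx t)) => //; exists a.
    rewrite -[_ *: _]addr0; apply: DeJhP; [by exists a | exact: DeJh0].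
  + by rewrite (lin0 partJ_lin) (lin0 partD_lin) addr0; split=> //; [exact: lspan0 | exact: DeJh0].
  + rewrite partJ_lin partD_lin; split; [exact: lspanP | exact: DeJhP |].
    by rewrite {1}x3 {1}y3; module.
- move=> x y hx [a ha <-]; rewrite -[x]scale1r; apply: kcompP; last first.
    by rewrite -[id_D _ _]scale1r -theta_scalar; apply: kcomp_theta.
  apply: lspan_lin hx => [_ [X _ [b hb <-]]||]; [|exact: lspan0 | exact: kcompP].
  by rewrite -[X](dev_sl2 F2); have := kcomp_theta (sl2val X) hb; rewrite /theta sl2_tr mulr0 scale0r addr0.
- apply: lspan_lin => [_ [X _ [b hb <-]]||c x y [x1 x2] [y1 y2]].
  + by rewrite partJ_elJ partD_elJ.
  + by rewrite (lin0 partJ_lin) (lin0 partD_lin).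
  + by rewrite partJ_lin partD_lin x1 x2 y1 y2 scaler0 addr0.
- by move=> _ [a _ <-]; rewrite partJ_D partD_D.
Qed.

Lemma half_copy a : Jh a -> a != 0 -> exists2 W : set L,
  is_dsum [:: slx dec a; [set c *: id_D dec (DD e a) | c in setT]] W
  & is_copy Phi (nat10_rep F) W.
Proof.
move=> ha a0; exists (range (@kmap _ F2 _ _ _ _ _ _ _ dec JT e Nat10 a)); last first.
  exact: (kmap_copy F2 ee F3 (k := Nat10)).
apply: (is_dsum2 partJ_lin partD_lin).
- move=> _ [t _ <-]; rewrite [kmap _ _ _ _ _]/(th a (tens_mx t)) partJ_theta partD_theta.
  by split=> //; exists (dev F2 (tens_mx t)).
- move=> _ _ [X _ <-] [c _ <-]; exists (mx_tens (sl2val X + (4^-1 * c)%:M)) => //=.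
  rewrite mx_tensK (linD (th_linr F2 JT e a)) theta_scalar; congr (_ + _).
  by rewrite /theta dev_sl2 sl2_tr mulr0 scale0r addr0.
- by move=> _ [X _ <-]; rewrite partJ_elJ partD_elJ.
- by move=> _ [c _ <-]; rewrite (linZ partJ_lin) (linZ partD_lin) partJ_D partD_D scaler0.
Qed.

Lemma slx_copy1 a : J1 a -> a != 0 -> is_copy Phi (ad1_rep F) (slx dec a).
Proof.
move=> ha a0; have -> : slx dec a = range (@kmap _ F2 _ _ _ _ _ _ _ dec JT e Ad1 a).
  by congr (_ @` _); apply/funext => X; rewrite /= theta_diag //; left.
exact: (kmap_copy F2 ee F3 (k := Ad1)).
Qed.
Lemma slx_copy0 a : J0 a -> a != 0 -> is_copy Phi (ad0_rep F) (slx dec a).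
Proof.
move=> ha a0; have -> : slx dec a = range (@kmap _ F2 _ _ _ _ _ _ _ dec JT e Ad0 a).
  by congr (_ @` _); apply/funext => X; rewrite /= theta_diag //; right.
exact: (kmap_copy F2 ee F3 (k := Ad0)).
Qed.

Lemma kcomp_TrivE : kcomp Triv = [set id_D dec d | d in [set d | DJ d e = 0]].
Proof.
apply/seteqP; split.
  apply: lspan_lin => [_ [d [c [hd ->]]]||c _ _ [d hd <-] [d' hd' <-]].
  - exists (c *: d); last by rewrite (linZ (id_D_lin dec)).
    by rewrite /= (linZ (DJ_linl JT e)) hd scaler0.
  - by exists 0; [exact: lin0 (DJ_linl JT e) | exact: lin0 (id_D_lin dec)].
  - exists (c *: d + d'); last exact: id_D_lin.
    by rewrite /= (DJ_linl JT) hd hd' scaler0 addr0.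
move=> _ [d hd <-]; rewrite -[id_D dec d]scale1r.
exact: (kcomp_map F2 (k := Triv)).
Qed.

Lemma fixed_pull : fixed (ss_pull (diagf (SL2f F)) Phi) = range (id_D dec).
Proof.
apply/seteqP; split=> [x fx | _ [d _ <-] R g].
  exists (cD dec x) => //; apply/esym/(fixed_D F2 (JT := JT)) => X.
  have -> : elJ dec X (jone JT) = iota2 JT e (X, X).
    by rewrite /iota2 /= -(linD ((elJ_bilin dec).2 X)) addrC subrK.
  apply: esym; apply: (bten_dual_inj (x := x) (x' := x)).
  by rewrite -(Phi_diff F2 ee F3 (X, X) x) bten0l addr0; apply/esym/fx.
exact: etrans (esym (Psi_Phi F2 ee F3 g _)) (Psi_D dec g d).
Qed.

Lemma fixed_dsum : is_dsum [:: fixed Phi; DeJh] (range (id_D dec)).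
Proof.
pose p x := id_D dec (cS JT e x); pose q x := - (4 *: id_D dec (DD e (DJ (cD dec x) e))).
have pl : linear p by move=> c x y; rewrite /p (cS_lin JT) (id_D_lin dec).
have ql : linear q.
  by move=> c x y; rewrite /q (cD_lin dec) (DJ_linl JT) (DD_linr JT) (id_D_lin dec); module.
rewrite fixedE kcomp_TrivE; apply: (is_dsum2 pl ql).
- move=> _ [d _ <-]; rewrite /p /q; split.
  + by exists (cS JT e (id_D dec d)) => //; apply: cS_in.
  + rewrite -scaleNr -[_ *: _]addr0; apply: DeJhP; last exact: DeJh0.
    by exists (DJ (cD dec (id_D dec d)) e) => //; apply: DJ_e_Jh.
  + by rewrite /cS cD_D /projS (linD (id_D_lin dec)) (linZ (id_D_lin dec)) addrK.
- by move=> _ _ [d _ <-] [a _ <-]; exists (d + DD e a) => //; rewrite (linD (id_D_lin dec)).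
- move=> _ [d hd <-]; rewrite /p /q cS_S // cD_D hd (lin0 (DD_linr JT e)).
  by rewrite (lin0 (id_D_lin dec)) scaler0 oppr0.
- move=> _ [a ha <-]; rewrite /p /q /cS cD_D projS_DDe // (lin0 (id_D_lin dec)); split=> //.
  rewrite -(linZ (id_D_lin dec)) -(linZ (DD_linr JT e)) DDe_e //.
  by rewrite (linN (DD_linr JT e)) (linN (id_D_lin dec)) opprK.
Qed.
End Conclusion.
Theorem theorem3p3 (F : fieldType) (char_neq2 : 2%N \notin [pchar F])
    (char_neq3 : 3%N \notin [pchar F]) (beta : skew_form F) :
  (forall (L : lieAlgType F) (Phi : sstruct (SL2SL2f F) L)
      (iota : sl2 F * sl2 F -> L) (J T D : lmodType F)
      (dec : isotypic_dec (ss_pull (diagf (SL2f F)) Phi) J T D)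
      (JT : coordinatization beta (fun f => iota (f, f)) dec),
    is_short Phi -> inner_by Phi iota ->
    exists e : J, [/\ jmul JT e e = e, e != 0, e != jone JT &
      is_dsum [:: slx dec e; slx dec (jone JT - e)] (range iota)])
  /\
  (forall (L : lieAlgType F) (Psi : sstruct (SL2f F) L) (iota : sl2 F -> L)
      (J T D : lmodType F) (dec : isotypic_dec Psi J T D)
      (JT : coordinatization beta iota dec) (e : J),
    inner_by Psi iota ->
    jmul JT e e = e -> e != 0 -> e != jone JT ->
    let J1 := peirceJ1 JT e in
    let Jh := peirceJh JT e in
    let J0 := peirceJ0 JT e in
    let T1 := peirceT1 JT e in
    let T0 := peirceT0 JT e in
    let DeJh := [set id_D dec (co_D JT e a) | a in Jh] in
    exists Phi : sstruct (SL2SL2f F) L,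
      [/\ is_short Phi,
          is_inner Phi
        & forall (R : comAlgType F) (g : SL2 R) (x : bext L R),
            Psi R g x = ss_pull (diagf (SL2f F)) Phi R g x]
      /\ (is_dsum [:: J1; Jh; J0] setT /\ is_dsum [:: T1; T0] setT)
      /\ is_dsum [:: slA dec J1; slA dec J0; isotypic Phi (nat10_rep F);
                     VA dec T1; VA dec T0; fixed Phi] setT
      /\ [/\ isotypic Phi (ad1_rep F) = slA dec J1,
             isotypic Phi (ad0_rep F) = slA dec J0,
             is_dsum [:: slA dec Jh; DeJh] (isotypic Phi (nat10_rep F)),
             isotypic Phi (nat1_rep F) = VA dec T1
           & isotypic Phi (nat0_rep F) = VA dec T0]
      /\ [/\ forall a, J1 a -> a != 0 -> is_copy Phi (ad1_rep F) (slx dec a),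
             forall a, J0 a -> a != 0 -> is_copy Phi (ad0_rep F) (slx dec a),
             forall a, Jh a -> a != 0 -> exists2 W : set L,
               is_dsum [:: slx dec a;
                           [set c *: id_D dec (co_D JT e a) | c in setT]] W
               & is_copy Phi (nat10_rep F) W,
             forall x, T1 x -> x != 0 -> is_copy Phi (nat1_rep F) (Vx dec x)
           & forall x, T0 x -> x != 0 -> is_copy Phi (nat0_rep F) (Vx dec x)]
      /\ fixed (ss_pull (diagf (SL2f F)) Phi) = range (id_D dec)
      /\ is_dsum [:: fixed Phi; DeJh] (range (id_D dec))).
Proof.
have F2 : (2%:R : F) != 0 by apply: contraNneq char_neq2 => h; rewrite inE /= h eqxx.
have F3 : (3%:R : F) != 0 by apply: contraNneq char_neq3 => h; rewrite inE /= h eqxx.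
split=> [L Phi0 iota J T D dec JT _ [ih ij _] | L Psi iota J T D dec JT e _ ee e0 e1 J1 Jh J0 T1 T0 DeJh].
  exact: (iota_split F2 F3 JT ih ij).
exists (Phi F2 ee F3); split; [|split; [|split; [|split; [|split; [|split]]]]].
- split; [exact: Phi_short | by exists (iota2 JT e); apply: Phi_inner | exact: Psi_Phi].
- by split; [exact: peirceJ_dsum | exact: peirceT_dsum].
- have := @kcomp_dsum F F2 _ _ _ _ _ _ _ dec JT e ee; rewrite /= -(slA_J1 F2 JT) -(slA_J0 F2 JT) -VA_T1 -VA_T0.
  by rewrite -(fixedE F2 ee F3) -(isotypicE F2 ee F3 (k := Nat10)).
- split.
  + by rewrite (slA_J1 F2 JT e) -(isotypicE F2 ee F3 (k := Ad1)).
  + by rewrite (slA_J0 F2 JT e) -(isotypicE F2 ee F3 (k := Ad0)).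
  + rewrite (isotypicE F2 ee F3 (k := Nat10)) //; exact: nat10_dsum.
  + by rewrite (VA_T1 F2 JT e) -(isotypicE F2 ee F3 (k := Nat1)).
  + by rewrite (VA_T0 F2 JT e) -(isotypicE F2 ee F3 (k := Nat0)).
- split; [exact: slx_copy1 | exact: slx_copy0 | exact: half_copy | |].
  + exact: (kmap_copy F2 ee F3 (k := Nat1)).
  + exact: (kmap_copy F2 ee F3 (k := Nat0)).
- exact: fixed_pull.
- exact: fixed_dsum.
Qed.
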